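(* Let $T>0$ and let $(u,\zeta_1,\zeta_2)$ be the weak solution on $[0,T]$ (as defined in the context), and assume that $$u\in C([0,T];\tilde H^4_0(0,L)),\quad u_t\in L^2(0,T;\tilde H^4_0(0,L)),\quad u_{tt}\in L^2(0,T;\tilde H^2_0(0,L)).$$ Let $(u_h,\tilde\zeta_1,\tilde\zeta_2)$ be the semi-discrete solution in the cubic Hermite space $W_h$ of mesh size $h$ (as defined in the context), let $\tilde u$ be the nodal Hermite projection of $u$ onto $W_h$, $\epsilon_h:=u_h-\tilde u$, and $\zeta^e_i:=\tilde\zeta_i-\zeta_i$, $i=1,2$. Then there is a constant $C$, independent of $h$, of $t$ and of the solution, such that for $0\le t\le T$ $$E(t;u_h-u,\tilde\zeta_1-\zeta_1,\tilde\zeta_2-\zeta_2)^{1/2}\le C\Big(E(0;\epsilon_h,\zeta^e_1,\zeta^e_2)^{1/2}+h^2\big(\|u_{tt}\|_{L^2(0,T;H^2(0,L))}+\|u_t\|_{L^2(0,T;H^4(0,L))}+\|u\|_{C([0,T];H^4(0,L))}\big)\Big).$$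
   Context: Coefficients. Fix $L>0$, an integer $r\ge1$, constants $M,J,k_1,k_2>0$, and strictly positive functions $\mu,\Lambda\in C^4[0,L]$. For $j=1,2$ let $A_j\in\mathbb{R}^{r\times r}$ be Hurwitz (all eigenvalues have negative real part), $b_j,c_j\in\mathbb{R}^r$, and $d_j,\delta_j\in\mathbb{R}$ such that the transfer function $\mathcal{G}_j(s)=\big((s\,\mathrm{Id}-A_j)^{-1}b_j\big)\cdot c_j+d_j$ satisfies $\operatorname{Re}\mathcal{G}_j(i\omega)\ge d_j\ge\delta_j>0$ for all $\omega\ge0$. Fix symmetric positive definite matrices $P_j\in\mathbb{R}^{r\times r}$, scalars $\epsilon_j>0$ and vectors $q_j\in\mathbb{R}^r$ (existing by the Kalman–Yakubovich–Popov lemma) with $P_jA_j+A_j^\top P_j=-q_jq_j^\top-\epsilon_jP_j$ and $P_jb_j=c_j-q_j\sqrt{2(d_j-\delta_j)}$, $j=1,2$. Spaces. $\tilde H^k_0(0,L):=\{u\in H^k(0,L):u(0)=u_x(0)=0\}$. $H:=\mathbb{R}\times\mathbb{R}\times L^2(0,L)$, with elements $\hat\varphi=({}^1\hat\varphi,{}^2\hat\varphi,{}^3\hat\varphi)$ and inner product $J\,({}^1\hat\varphi)({}^1\hat\nu)+M\,({}^2\hat\varphi)({}^2\hat\nu)+(\mu\,{}^3\hat\varphi,{}^3\hat\nu)_{L^2}$. $V:=\{\hat w=(w_x(L),w(L),w): w\in\tilde H^2_0(0,L)\}$ with inner product $(\hat w_1,\hat w_2)_V=(\Lambda(w_1)_{xx},(w_2)_{xx})_{L^2}$;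 $V\subset H\subset V'$ is a Gelfand triple with duality pairing ${}_{V'}\langle\cdot,\cdot\rangle_V$ extending the inner product of $H$. Weak solution. $(u,\zeta_1,\zeta_2)$ is the weak solution on $(0,T)$ if $\hat u=(u_x(L),u(L),u)\in L^2(0,T;V)\cap H^1(0,T;H)\cap H^2(0,T;V')$, $\zeta_1,\zeta_2\in H^1(0,T;\mathbb{R}^r)$, and for a.e. $t\in(0,T)$ and all $\hat w\in V$ $${}_{V'}\langle\hat u_{tt},\hat w\rangle_V+(\hat u,\hat w)_V+k_1u_x(L)w_x(L)+k_2u(L)w(L)+d_1({}^1\hat u_t)w_x(L)+d_2({}^2\hat u_t)w(L)+c_1\cdot\zeta_1\,w_x(L)+c_2\cdot\zeta_2\,w(L)=0,$$ $(\zeta_1)_t=A_1\zeta_1+b_1({}^1\hat u_t)$, $(\zeta_2)_t=A_2\zeta_2+b_2({}^2\hat u_t)$, with initial data $\hat u(0)=\hat u_0\in V$, $\hat u_t(0)=\hat v_0\in H$, $\zeta_i(0)=\zeta_{i,0}\in\mathbb{R}^r$. It exists and is unique. Discrete space. Let $P\in\mathbb{N}$, $h=L/P$, $x_m=mh$ for $m=0,\dots,P$. $W_h\subset\tilde H^2_0(0,L)$ is the space of $C^1[0,L]$ functions that are cubic polynomials on each $[x_{m-1},x_m]$ and vanish together with their first derivative at $x=0$; its Hermite basis $w_1,\dots,w_{2P}$ is given, for $m=1,\dots,P$ and $k=0,\dots,P$, by $w_{2m-1}(x_k)=\delta_{mk}$, $w_{2m-1}'(x_k)=0$, $w_{2m}(x_k)=0$,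 $w_{2m}'(x_k)=\delta_{mk}$ (Kronecker delta). The nodal projection is $\tilde u(t,x)=\sum_{m=1}^Pu(t,x_m)w_{2m-1}(x)+\sum_{m=1}^Pu_x(t,x_m)w_{2m}(x)$. Semi-discrete solution. $u_h\in C^2([0,\infty);W_h)$, $\tilde\zeta_1,\tilde\zeta_2\in C^1([0,\infty);\mathbb{R}^r)$ such that for all $w\in W_h$, $t>0$ $$\int_0^L\mu(u_h)_{tt}w\,dx+\int_0^L\Lambda(u_h)_{xx}w_{xx}\,dx+M(u_h)_{tt}(t,L)w(L)+J(u_h)_{xtt}(t,L)w_x(L)+k_1(u_h)_x(t,L)w_x(L)+k_2u_h(t,L)w(L)$$ $$+d_1(u_h)_{xt}(t,L)w_x(L)+d_2(u_h)_t(t,L)w(L)+c_1\cdot\tilde\zeta_1(t)\,w_x(L)+c_2\cdot\tilde\zeta_2(t)\,w(L)=0,$$ $(\tilde\zeta_1)_t=A_1\tilde\zeta_1+b_1(u_h)_{xt}(t,L)$, $(\tilde\zeta_2)_t=A_2\tilde\zeta_2+b_2(u_h)_t(t,L)$, with initial conditions $u_h(0)=u_{h,0}\in W_h$, $(u_h)_t(0)=v_{h,0}\in W_h$, $\tilde\zeta_i(0)=\zeta_{i,0}$. Energy functional. $$E(t;u,\zeta_1,\zeta_2):=\frac12\int_0^L\left(\Lambda u_{xx}(t,x)^2+\mu u_t(t,x)^2\right)dx+\frac M2u_t(t,L)^2+\frac J2u_{xt}(t,L)^2+\frac{k_1}2u_x(t,L)^2+\frac{k_2}2u(t,L)^2+\frac12\zeta_1^\top(t)P_1\zeta_1(t)+\frac12\zeta_2^\top(t)P_2\zeta_2(t).$$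 *)

(* Defs.v *)
From HB Require Import structures.
From mathcomp Require Import all_boot all_order all_algebra.
From mathcomp Require Import complex.
From mathcomp Require Import all_classical all_reals all_analysis.
Set Implicit Arguments.
Unset Strict Implicit.
Unset Printing Implicit Defensive.
Import Order.TTheory GRing.Theory Num.Theory.
Import numFieldNormedType.Exports.
Local Open Scope classical_set_scope.
Local Open Scope ring_scope.

(* Conventions.  An element of a function space is a representative; function
   spaces are sets [X] of representatives inside an ambient vector space [E],
   with a (semi)norm [N : E -> R] that is only meaningful on [X] and whose null
   vectors are identified with 0. *)

Section Calculus.
Context {R : realType}.

(* E-valued limits and derivatives relative to a set D of times, hence one-sided
   at end points of D. *)
Definition continuous_in (E : lmodType R) (N : E -> R) (D : set R)
    (f : R -> E) :=
  forall t, D t -> (fun s => N (f s - f t)) @ within D (nbhs t) --> (0 : R).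

Definition derivative_in (E : lmodType R) (N : E -> R) (D : set R)
    (f f' : R -> E) :=
  forall t, D t ->
    (fun s => N ((s - t)^-1 *: (f s - f t) - f' t)) @ within D (dnbhs t)
      --> (0 : R).

Definition absR (x : R^o) : R := `|x|.

Definition Ck_in (D : set R) (k : nat) (f : R -> R^o) :=
  exists F : nat -> R -> R^o,
    [/\ F 0%N = f,
        forall j, (j < k)%N -> derivative_in absR D (F j) (F j.+1) &
        forall j, (j <= k)%N -> continuous_in absR D (F j)].

(* C^1 functions with compact support in the open interval ]a, b[, the test
   functions of the one-dimensional weak derivative (as in Brezis, Ch. 8). *)
Definition test_function (a b : R) (phi : R -> R) :=
  [/\ forall x, derivable phi x 1,
      continuous (derive1 phi) &
      exists c d, [/\ a < c, d < b & forall x, x \notin `[c, d] -> phi x = 0]].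

End Calculus.

Section Sobolev.
Context {R : realType}.
Local Notation leb := (@lebesgue_measure R).
Local Notation Fn := (R -> R^o).
Variable L : R.

Definition L2 (f : Fn) :=
  measurable_fun `[0, L] f /\
  (\int[leb]_(x in `[0%R, L]) ((f x ^+ 2)%:E) < +oo)%E.

Definition is_weak_derivative (f g : Fn) :=
  forall phi, test_function 0 L phi ->
    \int[leb]_(x in `[0, L]) (f x * derive1 phi x) =
    - \int[leb]_(x in `[0, L]) (g x * phi x).

Fixpoint Hk (k : nat) (f : Fn) : Prop :=
  if k is k'.+1 then L2 f /\ exists g, is_weak_derivative f g /\ Hk k' g
  else L2 f.

(* A chosen representative; it is unique up to null sets when it exists. *)
Definition wD (f : Fn) : Fn :=
  xget (fun=> 0) [set g | L2 g /\ is_weak_derivative f g].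

Definition wDn (k : nat) (f : Fn) : Fn := iter k wD f.

(* The representative of f continuous on [0, L], which is unique there. *)
Definition crep (f : Fn) : Fn :=
  xget (fun=> 0) [set g | continuous_in absR `[0, L] g /\
    {ae leb, forall x, x \in `[0, L] -> f x = g x}].

(* Point value at x of the k-th derivative of an element of H^(k+1). *)
Definition value (k : nat) (f : Fn) (x : R) : R := crep (wDn k f) x.

Definition normHk (k : nat) (f : Fn) : R :=
  Num.sqrt (\sum_(j < k.+1) \int[leb]_(x in `[0, L]) (wDn j f x ^+ 2)).

Definition ipL2 (f g : Fn) : R := \int[leb]_(x in `[0, L]) (f x * g x).

Definition Hk0 (k : nat) : set Fn :=
  [set w | [/\ Hk k w, value 0 w 0 = 0 & value 1 w 0 = 0]].

End Sobolev.

Section Bochner.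
Context {R : realType}.
Local Notation leb := (@lebesgue_measure R).
Variables (E : lmodType R) (X : set E) (N : E -> R) (T : R).

Definition simple_function (s : R -> E) :=
  exists (k : nat) (A : 'I_k -> set R) (x : 'I_k -> E),
    (forall i, measurable (A i) /\ X (x i)) /\
    forall t, s t = \sum_(i < k) (\1_(A i) t : R) *: x i.

Definition strongly_measurable (f : R -> E) :=
  exists s : nat -> R -> E,
    (forall n, simple_function (s n)) /\
    {ae leb, forall t, t \in `]0, T[ ->
      (fun n => N (f t - s n t)) @ \oo --> (0 : R)}.

Definition L2_in (f : R -> E) :=
  [/\ {ae leb, forall t, t \in `]0, T[ -> X (f t)},
      strongly_measurable f &
      (\int[leb]_(t in `]0%R, T[) ((N (f t) ^+ 2)%:E) < +oo)%E].

Definition normL2_in (f : R -> E) : R :=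
  Num.sqrt (\int[leb]_(t in `]0, T[) (N (f t) ^+ 2)).

Definition C_in (f : R -> E) :=
  (forall t, t \in `[0, T] -> X (f t)) /\ continuous_in N `[0, T] f.

Definition normC_in (f : R -> E) : R := sup [set N (f t) | t in `[0, T]].

(* f has a continuous representative, whose value at time 0 is f0. *)
Definition initial_value (f : R -> E) (f0 : E) :=
  exists g, [/\ C_in g,
    {ae leb, forall t, t \in `]0, T[ -> X (f t) /\ N (f t - g t) = 0},
    X f0 & N (g 0 - f0) = 0].

(* g is the distributional time derivative of f on ]0, T[; the vector-valued
   identity is tested against the functionals [pair _ y], y in Y. *)
Definition is_time_derivative (F : Type) (Y : set F) (pair : E -> F -> R)
    (f g : R -> E) :=
  forall phi, test_function 0 T phi -> forall y, Y y ->
    \int[leb]_(t in `]0, T[) (pair (f t) y * derive1 phi t) =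
    - \int[leb]_(t in `]0, T[) (pair (g t) y * phi t).

End Bochner.

Section Model.
Context {R : realType} {r : nat}.
Local Notation leb := (@lebesgue_measure R).
Local Notation Fn := (R -> R^o).
Local Notation vec := 'cV[R]_r.

Definition dotv (x y : vec) : R := \sum_(i < r) x i 0 * y i 0.
Definition normv (x : vec) : R := Num.sqrt (dotv x x).
Definition quad (P : 'M[R]_r) (x : vec) : R := dotv x (P *m x).

Definition spd (P : 'M[R]_r) := P^T = P /\ forall x, x != 0 -> 0 < quad P x.

Definition hurwitz (A : 'M[R]_r) :=
  forall z : R[i], eigenvalue (map_mx (real_complex R) A) z ->
    complex.Re z < 0.

Record controller := Controller {
  cA : 'M[R]_r; cb : vec; cc : vec; cd : R; cdelta : R;
  cP : 'M[R]_r; cq : vec; ceps : R }.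

Definition transfer (k : controller) (s : R[i]) : R[i] :=
  let toC := real_complex R in
  ((map_mx toC (cc k))^T *m
    (invmx (s%:M - map_mx toC (cA k)) *m map_mx toC (cb k))) 0 0 + toC (cd k).

Definition controller_ok (k : controller) :=
  [/\ hurwitz (cA k),
      0 < cdelta k <= cd k,
      (forall omega : R, 0 <= omega ->
         cd k <= complex.Re (transfer k (Complex 0 omega))),
      (spd (cP k) /\ 0 < ceps k) &
      (cP k *m cA k + (cA k)^T *m cP k =
         - (cq k *m (cq k)^T) - ceps k *: cP k /\
       cP k *m cb k = cc k - Num.sqrt (2 * (cd k - cdelta k)) *: cq k)].

Record beam := Beam {
  bL : R; bM : R; bJ : R; bk1 : R; bk2 : R;
  bmu : Fn; bLam : Fn;
  ctr1 : controller; ctr2 : controller }.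

Definition beam_ok (B : beam) :=
  [/\ (0 < r)%N,
      [/\ 0 < bL B, 0 < bM B, 0 < bJ B, 0 < bk1 B & 0 < bk2 B],
      (Ck_in `[0, bL B] 4 (bmu B) /\ Ck_in `[0, bL B] 4 (bLam B)),
      (forall x, x \in `[0, bL B] -> 0 < bmu B x /\ 0 < bLam B x) &
      controller_ok (ctr1 B) /\ controller_ok (ctr2 B)].

Section Spaces.
Variable B : beam.
Let L := bL B.

Definition triple : lmodType R := (R^o * R^o * Fn)%type.

Definition Hsp : set triple := [set z | L2 L z.2].

Definition ipH (z y : triple) : R :=
  bJ B * z.1.1 * y.1.1 + bM B * z.1.2 * y.1.2 +
  \int[leb]_(x in `[0, L]) (bmu B x * z.2 x * y.2 x).

Definition normH (z : triple) : R := Num.sqrt (ipH z z).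

Definition hat (w : Fn) : triple := (value L 1 w L, value L 0 w L, w).

Definition Vsp : set triple := [set hat w | w in Hk0 L 2].

Definition ipV (z y : triple) : R :=
  \int[leb]_(x in `[0, L]) (bLam B x * wDn L 2 z.2 x * wDn L 2 y.2 x).

Definition normV (z : triple) : R := Num.sqrt (ipV z z).

Definition functional := triple -> R^o.

Definition Vdual : set functional :=
  [set F | (forall (a : R) z y, Vsp z -> Vsp y ->
              F (a *: z + y) = a * F z + F y) /\
           exists c : R, forall z, Vsp z -> `|F z| <= c * normV z].

Definition normVdual (F : functional) : R :=
  sup [set `|F z| | z in [set z | Vsp z /\ normV z <= 1]].

Definition duality (F : functional) (z : triple) : R := F z.

(* The embedding of H into V'. *)
Definition embed (z : triple) : functional := fun y => ipH z y.

(* ut, utt, z1t, z2t are the time derivatives of (u_x(L), u(L), u), ut, z1, z2.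
   z1 and z2 are the continuous representatives. *)
Definition weak_solution (T : R) (u : R -> Fn) (z1 z2 : R -> vec)
    (u0 v0 : triple) (z10 z20 : vec) :=
  exists (ut : R -> triple) (utt : R -> functional) (z1t z2t : R -> vec),
  let uhat t := hat (u t) in
  [/\ [/\ L2_in Vsp normV T uhat, L2_in Hsp normH T ut,
          is_time_derivative T Hsp ipH uhat ut,
          L2_in Vdual normVdual T utt &
          is_time_derivative T Vsp duality (fun t => embed (ut t)) utt],
      [/\ C_in setT normv T z1, C_in setT normv T z2,
          (L2_in setT normv T z1t /\ L2_in setT normv T z2t),
          is_time_derivative T setT dotv z1 z1t &
          is_time_derivative T setT dotv z2 z2t],
      {ae leb, forall t, t \in `]0, T[ -> forall w, Hk0 L 2 w ->
        duality (utt t) (hat w) + ipV (uhat t) (hat w)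
        + bk1 B * value L 1 (u t) L * value L 1 w L
        + bk2 B * value L 0 (u t) L * value L 0 w L
        + cd (ctr1 B) * (ut t).1.1 * value L 1 w L
        + cd (ctr2 B) * (ut t).1.2 * value L 0 w L
        + dotv (cc (ctr1 B)) (z1 t) * value L 1 w L
        + dotv (cc (ctr2 B)) (z2 t) * value L 0 w L = 0},
      {ae leb, forall t, t \in `]0, T[ ->
        z1t t = cA (ctr1 B) *m z1 t + (ut t).1.1 *: cb (ctr1 B) /\
        z2t t = cA (ctr2 B) *m z2 t + (ut t).1.2 *: cb (ctr2 B)} &
      [/\ (Vsp u0 /\ initial_value Hsp normH T uhat u0),
          Hsp v0,
          initial_value Vdual normVdual T (fun t => embed (ut t)) (embed v0),
          z1 0 = z10 & z2 0 = z20]].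

Definition node (P m : nat) : R := m%:R * (L / P%:R).

Definition Wh (P : nat) : set Fn :=
  [set w | (exists w' : Fn,
              [/\ derivative_in absR `[0, L] w w',
                  continuous_in absR `[0, L] w', w 0 = 0 & w' 0 = 0]) /\
           forall m, (m < P)%N -> exists p : {poly R}, (size p <= 4)%N /\
             forall x, x \in `[node P m, node P m.+1] -> w x = p.[x]].

Definition hermite_basis (P : nat) (w : nat -> Fn) :=
  forall m, (1 <= m <= P)%N ->
    [/\ Wh P (w (2 * m - 1)%N), Wh P (w (2 * m)%N) &
        forall k, (k <= P)%N ->
        [/\ w (2 * m - 1)%N (node P k) = (m == k)%:R,
            value L 1 (w (2 * m - 1)%N) (node P k) = 0,
            w (2 * m)%N (node P k) = 0 &
            value L 1 (w (2 * m)%N) (node P k) = (m == k)%:R]].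

Definition nodal_projection (P : nat) (w : nat -> Fn) (f : Fn) : Fn :=
  fun x => \sum_(1 <= m < P.+1) value L 0 f (node P m) * w (2 * m - 1)%N x
         + \sum_(1 <= m < P.+1) value L 1 f (node P m) * w (2 * m)%N x.

(* W_h is finite dimensional; the norm of H^2 is used for its topology.
   vh and ah are the first and second time derivatives of uh. *)
Definition semidiscrete_solution (P : nat) (uh vh ah : R -> Fn)
    (z1 z2 : R -> vec) (uh0 vh0 : Fn) (z10 z20 : vec) :=
  let D := `[0, +oo[%classic : set R in
  let NW := normHk L 2 in
  exists z1t z2t : R -> vec,
  [/\ [/\ forall t, 0 <= t -> [/\ Wh P (uh t), Wh P (vh t) & Wh P (ah t)],
          derivative_in NW D uh vh, derivative_in NW D vh ah &
          continuous_in NW D ah],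
      [/\ derivative_in normv D z1 z1t, derivative_in normv D z2 z2t,
          continuous_in normv D z1t & continuous_in normv D z2t],
      forall t w, 0 < t -> Wh P w ->
        \int[leb]_(x in `[0, L]) (bmu B x * ah t x * w x)
        + \int[leb]_(x in `[0, L]) (bLam B x * wDn L 2 (uh t) x * wDn L 2 w x)
        + bM B * value L 0 (ah t) L * value L 0 w L
        + bJ B * value L 1 (ah t) L * value L 1 w L
        + bk1 B * value L 1 (uh t) L * value L 1 w L
        + bk2 B * value L 0 (uh t) L * value L 0 w L
        + cd (ctr1 B) * value L 1 (vh t) L * value L 1 w L
        + cd (ctr2 B) * value L 0 (vh t) L * value L 0 w L
        + dotv (cc (ctr1 B)) (z1 t) * value L 1 w L
        + dotv (cc (ctr2 B)) (z2 t) * value L 0 w L = 0,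
      forall t, 0 < t ->
        z1t t = cA (ctr1 B) *m z1 t + value L 1 (vh t) L *: cb (ctr1 B) /\
        z2t t = cA (ctr2 B) *m z2 t + value L 0 (vh t) L *: cb (ctr2 B) &
      [/\ (Wh P uh0 /\ Wh P vh0),
          {in `[0, L], uh 0 =1 uh0}, {in `[0, L], vh 0 =1 vh0},
          z1 0 = z10 & z2 0 = z20]].

(* ut is the time derivative of u. *)
Definition energy (t : R) (u ut : R -> Fn) (z1 z2 : R -> vec) : R :=
  2^-1 * \int[leb]_(x in `[0, L])
           (bLam B x * wDn L 2 (u t) x ^+ 2 + bmu B x * ut t x ^+ 2)
  + bM B / 2 * value L 0 (ut t) L ^+ 2 + bJ B / 2 * value L 1 (ut t) L ^+ 2
  + bk1 B / 2 * value L 1 (u t) L ^+ 2 + bk2 B / 2 * value L 0 (u t) L ^+ 2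
  + 2^-1 * quad (cP (ctr1 B)) (z1 t) + 2^-1 * quad (cP (ctr2 B)) (z2 t).

End Spaces.
End Model.

(* Main.v *)
Require Import Defs.
From mathcomp Require Import all_boot all_order all_algebra.
From mathcomp Require Import ring lra.
From mathcomp Require Import all_classical all_reals all_analysis.
From mathcomp Require Import measurable_realfun.
Set Implicit Arguments.
Unset Strict Implicit.
Unset Printing Implicit Defensive.
Import Order.TTheory GRing.Theory Num.Theory.
Import numFieldNormedType.Exports.
Local Open Scope classical_set_scope.
Local Open Scope ring_scope.

(** Let Pi be the nodal projection, e = uh - Pi u and p = vh - Pi v the discrete
    errors, sg = Pi u - u and rh = Pi v - v the interpolation errors, so that
    uh - u = e + sg and vh - v = p + rh. The interpolation errors are of order h^2 in
    the norms of the energy: Pi f is the orthogonal projection of f for the form of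
    second derivatives, whence in the L^2 norm f - Pi f is at most h^2 f'' (interp_H2)
    and its second derivative at most h^2 f'''' (interp_H4). Since the free end is a
    node, they have no boundary values there.

    It remains to bound the energy Q of (e, p) and of the controller errors. Formally,
    testing the difference of the two variational equations with p gives
      Q' / 2 <= - (mu rh', p) - (Lambda sg'', p''),
    because the Kalman-Yakubovich-Popov identities make the controllers dissipative
    (kyp_dissipation). The last term is not controlled by the energy, but it is the
    time derivative of - (Lambda sg'', e'') plus (Lambda (sg')'', e''). So the modified
    energy Q + 2 (Lambda sg'', e'') has a rate of at most a constant times sqrt Q times
    h^2 (|v'|_{H^2} + |v|_{H^4}); with S the supremum of sqrt Q this gives
    S^2 <= Q(0) + g S, where g is a multiple of h^2 times the norms of the statement,
    hence S <= sqrt (Q 0) + g (energy_stability).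

    Since v' is merely square integrable in time, p, rh and the energy need not be
    differentiable at any given time. Therefore time derivatives are replaced by right
    increments, and the differential inequality by the principle growth: an increment
    that is at most that of a nondecreasing K plus o(s - t) may be summed up. The
    increments of sg and rh are bounded by path_bound, a Minkowski inequality in time
    that is derived from scalar functionals (integrals of derivatives over intervals,
    point values), since those are the functionals for which a distributional time
    derivative can be integrated (time_prim, transports_itg_pv). The weak equation
    enters through weak_facts: against a fixed w the momentum of v is a primitive of
    the continuous remaining terms. The limit of its difference quotients along the
    moving test function p s + p t is cvg_mform, and the rate of the modified energy
    is energy_rate.

    The spaces are made accessible by identifying H^k with chains of primitives
    (Hk_chain): a weak derivative is a derivative in the integral sense (weak_prim),
    and the chosen representatives agree with those of the chain. *)

(** * Integrals over compact intervals *)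

Section LowerIntegrals.
Local Open Scope ring_scope.
Context d (T : measurableType d) (R : realType) (mu : {measure set T -> \bar R}).
Import HBNNSimple.

(** The integral of a nonnegative function is a supremum over the simple functions
    below it, hence monotone without measurability. This matters because the norm
    t |-> N (u t) of a path of representatives is not known to be measurable. *)
Lemma nonneg_le_integral (D : set T) (f g : T -> \bar R) :
  (forall x, D x -> (0 <= f x)%E) -> (forall x, D x -> (f x <= g x)%E) ->
  (\int[mu]_(x in D) f x <= \int[mu]_(x in D) g x)%E.
Proof.
move=> f0 fg; have g0 x : D x -> (0 <= g x)%E by move=> Dx; exact: le_trans (f0 _ Dx) (fg _ Dx).
rewrite !ge0_integralE// ge_ereal_sup// => _ [h/= hf] <-.
apply: ereal_sup_ubound; exists h => //= x.
apply: (le_trans (hf x)); rewrite !patchE; case: ifPn => // /set_mem; exact: fg.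
Qed.

Lemma nonneg_ae_le_integral (D : set T) (f g : T -> \bar R) :
  measurable D -> measurable_fun D f ->
  (forall x, D x -> (0 <= f x)%E) -> (forall x, D x -> (0 <= g x)%E) ->
  {ae mu, forall x, D x -> (f x <= g x)%E} ->
  (\int[mu]_(x in D) f x <= \int[mu]_(x in D) g x)%E.
Proof.
move=> mD mf f0 g0 [N [mN N0 sN]].
rewrite (ge0_negligible_integral mN mD mf f0 N0) integral_mkcondr [leRHS]integral_mkcond.
rewrite [leLHS]integral_mkcond; apply: nonneg_le_integral => x _.
  rewrite !patchE; case: ifPn => // /set_mem Dx; case: ifPn => // _; exact: f0.
rewrite !patchE; case: ifPn => // /set_mem Dx; case: ifPn => [|_]; last exact: g0.
move=> /set_mem xN; move/subsetCl : sN => /(_ x xN) /=; exact.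
Qed.

(** Measurability is asked of f only: g may be an arbitrary representative. For
    nonnegative functions, one inequality discards a null set from f, the other
    compares each simple function below g with f. *)
Lemma ae_eq_integral_gen (D : set T) (f g : T -> \bar R) :
  measurable D -> measurable_fun D f ->
  {ae mu, forall x, D x -> f x = g x} ->
  (\int[mu]_(x in D) f x = \int[mu]_(x in D) g x)%E.
Proof.
have H (u v : T -> \bar R) : measurable D -> measurable_fun D u ->
    (forall x, D x -> 0 <= u x)%E ->
    (forall x, D x -> 0 <= v x)%E -> {ae mu, forall x, D x -> u x = v x} ->
    (\int[mu]_(x in D) u x = \int[mu]_(x in D) v x)%E.
  move=> mD mfu u0 v0 uv; apply/eqP; rewrite eq_le; apply/andP; split.
    apply: nonneg_ae_le_integral => //.
    by apply: (@filterS _ _ (ae_filter_ringOfSetsType mu)) uv => x h Dx; rewrite h.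
  rewrite [leLHS]ge0_integralE// ge_ereal_sup// => _ [h/= hv] <-.
  rewrite -integralT_nnsfun [leRHS]integral_mkcond.
  apply: nonneg_ae_le_integral => //.
  - by apply/measurable_EFinP; exact: measurable_funP.
  - by move=> x _; rewrite lee_fin.
  - by move=> x _; rewrite patchE; case: ifPn => // /set_mem; exact: u0.
  apply: (@filterS _ _ (ae_filter_ringOfSetsType mu)) uv => x hx _; apply: (le_trans (hv x)); rewrite !patchE.
  by case: ifPn => // /set_mem Dx; rewrite hx.
move=> mD mf fg; rewrite integralE [RHS]integralE; congr (_ - _)%E; apply: H => //.
- exact: measurable_funepos.
- by apply: (@filterS _ _ (ae_filter_ringOfSetsType mu)) fg => x h Dx; rewrite !funeposE h.
- exact: measurable_funeneg.
- by apply: (@filterS _ _ (ae_filter_ringOfSetsType mu)) fg => x h Dx; rewrite !funenegE h.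
Qed.

End LowerIntegrals.

Section RealIntegrals.
Context {R : realType}.
Local Notation leb := (@lebesgue_measure R).
Implicit Types (a b c d k : R) (f g : R -> R).

(** For b < a the interval is empty and the integral is 0. *)
Definition itg a b f : R := \int[leb]_(x in `[a, b]) f x.
Definition intble a b f := leb.-integrable `[a, b] (EFin \o f).
Definition L2on a b f := measurable_fun `[a, b] f /\
  (\int[leb]_(x in `[a, b]) ((f x ^+ 2)%:E) < +oo)%E.

Lemma subitv a b c d : a <= c -> d <= b -> `[c, d] `<=` `[a, b].
Proof.
move=> ac db x /=; rewrite !in_itv/= => /andP[cx xd].
by rewrite (le_trans ac cx) (le_trans xd db).
Qed.

Lemma intble_sub a b c d f : a <= c -> d <= b -> intble a b f -> intble c d f.
Proof. by move=> ac db; apply: integrableS => //; exact: subitv. Qed.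

Lemma intble_meas a b f : intble a b f -> measurable_fun `[a, b] f.
Proof. by move=> /measurable_int /measurable_EFinP. Qed.

Lemma intbleD a b f g : intble a b f -> intble a b g -> intble a b (fun x => f x + g x).
Proof. by move=> hf hg; apply: eq_integrable (integrableD _ hf hg). Qed.

Lemma intbleZ a b k f : intble a b f -> intble a b (fun x => k * f x).
Proof. by move=> hf; apply: eq_integrable (integrableZl _ k hf). Qed.

Lemma intbleN a b f : intble a b f -> intble a b (fun x => - f x).
Proof. by move=> /(intbleZ (-1)); apply: eq_integrable => // x _ /=; rewrite mulN1r. Qed.

Lemma intbleB a b f g : intble a b f -> intble a b g -> intble a b (fun x => f x - g x).
Proof. by move=> hf /intbleN; exact: intbleD. Qed.

Lemma intble_cst a b k : intble a b (fun=> k).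
Proof.
by apply: continuous_compact_integrable; [exact: segment_compact|exact/continuous_subspaceT/cst_continuous].
Qed.

Lemma intble_norm a b f : intble a b f -> intble a b (fun x => `|f x|).
Proof. by move=> hf; have := integrable_norm hf. Qed.

Lemma le_intble a b f g : measurable_fun `[a, b] f ->
  (forall x, a <= x <= b -> `|f x| <= g x) -> intble a b g -> intble a b f.
Proof.
move=> mf fg; apply: le_integrable => //; first exact/measurable_EFinP.
move=> x /=; rewrite in_itv/= => xab; rewrite lee_fin.
by rewrite (le_trans (fg _ xab))// ler_norm.
Qed.

Lemma itg_EFin a b f : intble a b f -> (\int[leb]_(x in `[a, b]) (f x)%:E)%E = (itg a b f)%:E.
Proof. by move=> hf; rewrite /itg /Rintegral fineK//; exact: integrable_fin_num. Qed.

Lemma itgD a b f g : intble a b f -> intble a b g ->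
  itg a b (fun x => f x + g x) = itg a b f + itg a b g.
Proof. exact: RintegralD. Qed.

Lemma itgB a b f g : intble a b f -> intble a b g ->
  itg a b (fun x => f x - g x) = itg a b f - itg a b g.
Proof. exact: RintegralB. Qed.

Lemma itgZ a b k f : intble a b f -> itg a b (fun x => k * f x) = k * itg a b f.
Proof. exact: RintegralZl. Qed.

Lemma eq_itg a b f g : (forall x, a <= x <= b -> f x = g x) -> itg a b f = itg a b g.
Proof. by move=> fg; apply: eq_Rintegral => x; rewrite inE/= in_itv/=; exact: fg. Qed.

Lemma itg_cst a b k : a <= b -> itg a b (fun=> k) = k * (b - a).
Proof.
move=> ab; rewrite /itg Rintegral_cst//= lebesgue_measure_itv/=.
rewrite lte_fin; case: ltP => // ba.
have -> : a = b by apply/le_anti; rewrite ab ba.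
by rewrite subrr.
Qed.

Lemma itg_ge0 a b f : (forall x, a <= x <= b -> 0 <= f x) -> 0 <= itg a b f.
Proof. by move=> h; apply: Rintegral_ge0 => x /=; rewrite in_itv/=; exact: h. Qed.

Lemma le_itg a b f g : intble a b f -> intble a b g ->
  (forall x, a <= x <= b -> f x <= g x) -> itg a b f <= itg a b g.
Proof. by move=> hf hg h; apply: le_Rintegral => // x /=; rewrite in_itv/=; exact: h. Qed.

Lemma le_norm_itg a b f : intble a b f -> `|itg a b f| <= itg a b (fun x => `|f x|).
Proof. by move=> hf; exact: le_normr_Rintegral. Qed.

Lemma itg_pt a f : itg a a f = 0.
Proof. by rewrite /itg set_itv1 Rintegral_set1. Qed.

Lemma itg_split a b c f : a <= c -> c <= b -> intble a b f ->
  itg a b f = itg a c f + itg c b f.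
Proof.
move=> ac cb hf; have := @Rintegral_itvB R f (BLeft a) (BRight b) c hf.
rewrite !bnd_simp => /(_ ac cb) /eqP; rewrite subr_eq addrC -!/(itg _ _ _) => /eqP ->; congr (_ + _).
apply: Rintegral_itv_obnd_cbnd; apply: integrableS hf => //.
by apply: subset_itv; rewrite bnd_simp.
Qed.

Lemma aeS (P Q : set R) : (forall x, P x -> Q x) ->
  {ae leb, forall x, P x} -> {ae leb, forall x, Q x}.
Proof. by move=> PQ; apply: (@filterS _ _ (ae_filter_ringOfSetsType leb)). Qed.

Lemma ae2 (P Q S : set R) : (forall x, P x -> Q x -> S x) ->
  {ae leb, forall x, P x} -> {ae leb, forall x, Q x} -> {ae leb, forall x, S x}.
Proof. by move=> PQ; apply: (@filterS2 _ _ (ae_filter_ringOfSetsType leb)). Qed.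

Lemma aeI (P Q : set R) : {ae leb, forall x, P x} -> {ae leb, forall x, Q x} ->
  {ae leb, forall x, P x /\ Q x}.
Proof. by apply: ae2. Qed.

Lemma ae_neq c : {ae leb, forall x, x != c}.
Proof.
exists [set c]; split => //; first exact: lebesgue_measure_set1.
by move=> x /= /negP; rewrite negbK => /eqP.
Qed.

Lemma ae_eq_integral_leb (D : set R) (f g : R -> \bar R) :
  measurable D -> measurable_fun D f -> {ae leb, forall x, D x -> f x = g x} ->
  (\int[leb]_(x in D) f x = \int[leb]_(x in D) g x)%E.
Proof. by move=> mD mf fg; apply: ae_eq_integral_gen. Qed.

Lemma nonneg_ae_le_integral_leb (D : set R) (f g : R -> \bar R) :
  measurable D -> measurable_fun D f ->
  (forall x, D x -> (0 <= f x)%E) -> (forall x, D x -> (0 <= g x)%E) ->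
  {ae leb, forall x, D x -> (f x <= g x)%E} ->
  (\int[leb]_(x in D) f x <= \int[leb]_(x in D) g x)%E.
Proof. by move=> mD mf f0 g0 fg; apply: nonneg_ae_le_integral. Qed.

Lemma ae_eq_itg a b f g : measurable_fun `[a, b] f ->
  {ae leb, forall x, a <= x <= b -> f x = g x} -> itg a b f = itg a b g.
Proof.
move=> mf fg; congr fine; apply: ae_eq_integral_gen => //; first exact/measurable_EFinP.
by apply: aeS fg => x h /=; rewrite in_itv/= => /h ->.
Qed.

(** The minimum of f and g equals f almost everywhere and lies below g everywhere. *)
Lemma ae_le_itg a b f g : intble a b f -> intble a b g ->
  {ae leb, forall x, a <= x <= b -> f x <= g x} -> itg a b f <= itg a b g.
Proof.
move=> hf hg fg.
have mf := intble_meas hf; have mg := intble_meas hg.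
have mm : measurable_fun `[a, b] (fun x => Num.min (f x) (g x)) by exact: measurable_minr.
rewrite (@ae_eq_itg _ _ f (fun x => Num.min (f x) (g x)))//; last first.
  by apply: aeS fg => x h /h; move/min_idPl => ->.
apply: le_itg => //; last by move=> x _; by rewrite ge_min lexx orbT.
apply: (le_intble mm _ (intbleD (intble_norm hf) (intble_norm hg))) => x _ /=.
by rewrite minEle; case: ifP => _; rewrite ?lerDl ?lerDr.
Qed.

Lemma L2on_sqr a b f : L2on a b f -> intble a b (fun x => f x ^+ 2).
Proof.
move=> [mf ifin]; apply/integrableP; split; first by apply/measurable_EFinP; exact: measurable_funX.
under eq_integral do rewrite /= ger0_norm ?sqr_ge0//.
exact: ifin.
Qed.

Lemma L2onP a b f : measurable_fun `[a, b] f -> intble a b (fun x => f x ^+ 2) -> L2on a b f.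
Proof.
move=> mf /integrableP[_]; split => //.
apply: le_lt_trans b0; apply: nonneg_le_integral => x _ /=; rewrite ?lee_fin ?sqr_ge0//.
exact: ler_norm.
Qed.

Lemma L2on_mul a b f g : L2on a b f -> L2on a b g -> intble a b (fun x => f x * g x).
Proof.
move=> hf hg; apply: (le_intble _ _ (intbleD (L2on_sqr hf) (L2on_sqr hg))).
  by apply: measurable_funM; [case: hf | case: hg].
move=> x _; rewrite normrM -(real_normK (num_real (f x))) -(real_normK (num_real (g x))).
have := sqr_ge0 (`|f x| - `|g x|).
have := mulr_ge0 (normr_ge0 (f x)) (normr_ge0 (g x)).
nra.
Qed.

Lemma L2on_bnd a b f k : measurable_fun `[a, b] f -> (forall x, a <= x <= b -> `|f x| <= k) ->
  L2on a b f.
Proof.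
move=> mf fk; apply: L2onP => //; apply: (@le_intble _ _ _ (fun=> k ^+ 2)).
- exact: measurable_funX.
- move=> x xab; rewrite ger0_norm ?sqr_ge0// -(real_normK (num_real (f x))).
  by rewrite ler_sqr ?nnegrE// ?(le_trans _ (fk x xab)) ?fk.
- exact: intble_cst.
Qed.

Lemma L2on_cst a b k : L2on a b (fun=> k).
Proof. by apply: (@L2on_bnd _ _ _ `|k|). Qed.

Lemma L2on_int a b f : L2on a b f -> intble a b f.
Proof.
by move=> /L2on_mul /(_ (L2on_cst a b 1)); apply: eq_integrable => // x _ /=; rewrite mulr1.
Qed.

Lemma L2onD a b f g : L2on a b f -> L2on a b g -> L2on a b (fun x => f x + g x).
Proof.
move=> hf hg; apply: L2onP; first by apply: measurable_funD; [case: hf|case: hg].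
have := intbleD (L2on_sqr hf) (intbleD (intbleZ 2 (L2on_mul hf hg)) (L2on_sqr hg)).
by apply: eq_integrable => // x _ /=; congr EFin; ring.
Qed.

Lemma L2onMb a b f g k : measurable_fun `[a, b] f -> (forall x, a <= x <= b -> `|f x| <= k) ->
  L2on a b g -> L2on a b (fun x => f x * g x).
Proof.
move=> mf fk [mg ig]; have mfg : measurable_fun `[a, b] (fun x => f x * g x).
  exact: measurable_funM.
apply: L2onP => //; apply: (@le_intble _ _ _ (fun x => k ^+ 2 * g x ^+ 2)).
- exact: measurable_funX.
- move=> x xab; rewrite ger0_norm ?sqr_ge0// exprMn ler_wpM2r ?sqr_ge0//.
  rewrite -(real_normK (num_real (f x))).
  by rewrite ler_sqr ?nnegrE// ?(le_trans _ (fk x xab)) ?fk.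
- by apply: intbleZ; apply: L2on_sqr.
Qed.

Lemma L2onZ a b k f : L2on a b f -> L2on a b (fun x => k * f x).
Proof. by apply: (@L2onMb _ _ _ _ `|k|). Qed.

Lemma L2onN a b f : L2on a b f -> L2on a b (fun x => - f x).
Proof. by move=> /(@L2onZ a b (-1)); under eq_fun do rewrite mulN1r. Qed.

Lemma L2onB a b f g : L2on a b f -> L2on a b g -> L2on a b (fun x => f x - g x).
Proof. by move=> hf /L2onN; exact: L2onD. Qed.

Lemma L2on_sub a b c d f : a <= c -> d <= b -> L2on a b f -> L2on c d f.
Proof.
move=> ac db hf; apply: L2onP; first by case: hf => [h _]; apply: measurable_funS h => //; exact: subitv.
exact: (intble_sub ac db (L2on_sqr hf)).
Qed.

Lemma L2on_norm a b f : L2on a b f -> L2on a b (fun x => `|f x|).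
Proof.
move=> hf; apply: L2onP; first by apply: measurableT_comp => //; case: hf.
by have := L2on_sqr hf; apply: eq_integrable => // x _ /=; rewrite real_normK ?num_real.
Qed.

(** The common core of all Cauchy-Schwarz inequalities below. *)
Lemma discriminant_le (A B C : R) : (forall t, 0 <= A + 2 * t * B + t ^+ 2 * C) -> 0 <= C ->
  B ^+ 2 <= A * C.
Proof.
move=> H C0; have [C00|Cp] := eqVneq C 0.
  rewrite C00 mulr0; have [->|B0] := eqVneq B 0; first by rewrite expr0n.
  have := H (- (A + 1) / (2 * B)); rewrite C00 mulr0 addr0.
  have -> : 2 * (- (A + 1) / (2 * B)) * B = - (A + 1) by field.
  lra.
have := H (- B / C); have C1 : 0 < C by rewrite lt_def Cp.
have -> : A + 2 * (- B / C) * B + (- B / C) ^+ 2 * C = (A * C - B ^+ 2) / C by field.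
by rewrite pmulr_lge0 ?invr_gt0// subr_ge0.
Qed.

Lemma itg_CS a b f g : L2on a b f -> L2on a b g ->
  itg a b (fun x => f x * g x) ^+ 2 <=
  itg a b (fun x => f x ^+ 2) * itg a b (fun x => g x ^+ 2).
Proof.
move=> hf hg; apply: discriminant_le => [t|]; last by apply: itg_ge0 => x _; exact: sqr_ge0.
have <- : itg a b (fun x => (f x + t * g x) ^+ 2) =
   itg a b (fun x => f x ^+ 2) + 2 * t * itg a b (fun x => f x * g x)
   + t ^+ 2 * itg a b (fun x => g x ^+ 2).
  have i1 := L2on_sqr hf; have i2 := intbleZ (2 * t) (L2on_mul hf hg).
  have i3 := intbleZ (t ^+ 2) (L2on_sqr hg).
  rewrite -!itgZ ?L2on_sqr ?L2on_mul// -!itgD//; last exact: intbleD.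
  by apply: eq_itg => x _; ring.
by apply: itg_ge0 => x _; exact: sqr_ge0.
Qed.

Definition nrm2 a b f := Num.sqrt (itg a b (fun x => f x ^+ 2)).

Lemma nrm2_ge0 a b f : 0 <= nrm2 a b f. Proof. exact: sqrtr_ge0. Qed.

Lemma nrm2_sqr a b f : nrm2 a b f ^+ 2 = itg a b (fun x => f x ^+ 2).
Proof. by rewrite sqr_sqrtr//; apply: itg_ge0 => x _; exact: sqr_ge0. Qed.

Lemma le_sqrW (x y : R) : 0 <= y -> x ^+ 2 <= y ^+ 2 -> `|x| <= y.
Proof.
by move=> y0; rewrite -(real_normK (num_real x)) ler_sqr ?nnegrE.
Qed.

Lemma itg_CSn a b f g : L2on a b f -> L2on a b g ->
  `|itg a b (fun x => f x * g x)| <= nrm2 a b f * nrm2 a b g.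
Proof.
move=> hf hg; apply: le_sqrW; first by rewrite mulr_ge0 ?nrm2_ge0.
by rewrite exprMn !nrm2_sqr itg_CS.
Qed.

Lemma itg_L1L2 a b f : a <= b -> L2on a b f ->
  itg a b (fun x => `|f x|) <= Num.sqrt (b - a) * nrm2 a b f.
Proof.
move=> ab hf; have := itg_CSn (L2on_cst a b 1) (L2on_norm hf).
rewrite (_ : itg a b (fun x => 1 * `|f x|) = itg a b (fun x => `|f x|)); last first.
  by apply: eq_itg => x _; rewrite mul1r.
rewrite ger0_norm; last by apply: itg_ge0.
move=> /le_trans; apply; rewrite le_eqVlt; apply/orP; left; apply/eqP; congr (_ * _).
  by rewrite /nrm2 itg_cst// expr1n mul1r.
by rewrite /nrm2; congr Num.sqrt; apply: eq_itg => x _; rewrite real_normK ?num_real.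
Qed.

Lemma itg_holder a b f : a <= b -> L2on a b f ->
  `|itg a b f| <= Num.sqrt (b - a) * nrm2 a b f.
Proof.
move=> ab hf; apply: le_trans (itg_L1L2 ab hf); apply: le_norm_itg; exact: L2on_int.
Qed.

Lemma le_itg_sub a b c d f : a <= c -> c <= d -> d <= b -> intble a b f ->
  (forall x, a <= x <= b -> 0 <= f x) -> itg c d f <= itg a b f.
Proof.
move=> ac cd db hf f0; rewrite (itg_split ac (le_trans cd db) hf).
rewrite (itg_split cd db) ?(intble_sub ac _ hf)//.
have h1 : 0 <= itg a c f by apply: itg_ge0 => x /andP[ax xc]; apply: f0; lra.
have h2 : 0 <= itg d b f by apply: itg_ge0 => x /andP[ax xc]; apply: f0; lra.
lra.
Qed.

Lemma le_nrm2_sub a b c d f : a <= c -> c <= d -> d <= b -> L2on a b f ->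
  nrm2 c d f <= nrm2 a b f.
Proof.
move=> ac cd db hf; apply: ler_wsqrtr; apply: le_itg_sub => //; first exact: L2on_sqr.
by move=> x _; exact: sqr_ge0.
Qed.

Lemma continuous_in_within a b f : continuous_in absR `[a, b] f <->
  {within `[a, b], continuous f}.
Proof.
rewrite subspace_continuousP; split => h x xab.
  have := h x xab; rewrite /absR => /cvgr0Pnorm_lt H; apply/cvgrPdist_lt => e e0.
  have := H e e0; apply: filterS => y; rewrite normr_id => ?; by rewrite distrC.
have := h x xab => /cvgrPdist_lt H; apply/cvgr0Pnorm_lt => e e0.
have := H e e0; apply: filterS => y; by rewrite /absR normr_id distrC.
Qed.

Lemma within_ball (D : set R) t (P : R -> Prop) :
  (\forall s \near within D (nbhs t), P s) <->
  exists2 d, 0 < d & forall s, D s -> `|s - t| < d -> P s.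
Proof.
split => [/nbhs_ballP[d /= d0 H]|[d d0 H]].
  by exists d => // s Ds st; apply: H => //; rewrite /ball/= distrC.
apply/nbhs_ballP; exists d => //= s; rewrite /ball/= distrC => st Ds; exact: H.
Qed.

Lemma within_dball (D : set R) t (P : R -> Prop) :
  (\forall s \near within D (dnbhs t), P s) <->
  exists2 d, 0 < d & forall s, D s -> s != t -> `|s - t| < d -> P s.
Proof.
split => [/nbhs_ballP[d /= d0 H]|[d d0 H]].
  by exists d => // s Ds st sd; apply: H => //; rewrite /ball/= distrC.
apply/nbhs_ballP; exists d => //= s; rewrite /ball/= distrC => st nst Ds; exact: H.
Qed.

Lemma continuous_in_epsP (E : lmodType R) (N : E -> R) (D : set R) (f : R -> E) :
  (forall x, 0 <= N x) ->
  (continuous_in N D f <-> forall t, D t -> forall e : R, 0 < e -> exists2 d : R, 0 < d &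
    forall s, D s -> `|s - t| < d -> N (f s - f t) < e).
Proof.
move=> N0; split => [H t Dt e e0|H t Dt].
  move: (H t Dt) => /cvgr0Pnorm_lt /(_ e e0) /within_ball[d d0 K].
  by exists d => // s Ds st; have := K s Ds st; rewrite ger0_norm.
apply/cvgr0Pnorm_lt => e e0; apply/within_ball; have [d d0 K] := H t Dt e e0.
by exists d => // s Ds st; rewrite ger0_norm//; exact: K.
Qed.

Lemma derivative_in_epsP (E : lmodType R) (N : E -> R) (D : set R) (f f' : R -> E) :
  (forall x, 0 <= N x) ->
  (derivative_in N D f f' <-> forall t, D t -> forall e : R, 0 < e -> exists2 d : R, 0 < d &
    forall s, D s -> s != t -> `|s - t| < d -> N ((s - t)^-1 *: (f s - f t) - f' t) < e).
Proof.
move=> N0; split => [H t Dt e e0|H t Dt].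
  move: (H t Dt) => /cvgr0Pnorm_lt /(_ e e0) /within_dball[d d0 K].
  by exists d => // s Ds ns st; have := K s Ds ns st; rewrite ger0_norm.
apply/cvgr0Pnorm_lt => e e0; apply/within_dball; have [d d0 K] := H t Dt e e0.
by exists d => // s Ds ns st; rewrite ger0_norm//; exact: K.
Qed.

Lemma absR_ge0 (x : R^o) : 0 <= absR x. Proof. exact: normr_ge0. Qed.

Lemma cont_meas a b f : continuous_in absR `[a, b] f -> measurable_fun `[a, b] f.
Proof.
by move=> /continuous_in_within; apply: subspace_continuous_measurable_fun.
Qed.

Lemma cont_bnd a b f : continuous_in absR `[a, b] f ->
  exists2 k : R, 0 <= k & forall x, a <= x <= b -> `|f x| <= k.
Proof.
move=> /continuous_in_within cf; have [ab|ba] := leP a b; last first.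
  by exists 0 => // x /andP[ax xb]; have := le_trans ax xb; rewrite leNgt ba.
have [c _ H] := EVT_max ab cf; have [e _ G] := EVT_min ab cf.
exists (`|f c| + `|f e|); first by rewrite addr_ge0.
move=> x xab; have {}H := H x xab; have {}G := G x xab.
have := ler_norm (f c); have := ler_norm (- f e); rewrite normrN => h1 h2.
rewrite ler_norml; have := normr_ge0 (f c); have := normr_ge0 (f e); lra.
Qed.

Lemma cont_L2on a b f : continuous_in absR `[a, b] f -> L2on a b f.
Proof. by move=> cf; have [k _ fk] := cont_bnd cf; apply: L2on_bnd fk; exact: cont_meas. Qed.

End RealIntegrals.

(** * Primitives and a growth principle *)

Section Calculus1.
Context {R : realType}.
Local Notation leb := (@lebesgue_measure R).
Implicit Types (a b c d k t s : R) (f g p q : R -> R).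

Lemma FTC2 a b f : a <= b -> (forall x : R, derivable f x 1) -> continuous (derive1 f) ->
  itg a b (derive1 f) = f b - f a.
Proof.
rewrite le_eqVlt => /predU1P[->|ab] df cf'; first by rewrite itg_pt subrr.
have c1 : {within `[a, b], continuous (derive1 f)} by exact: continuous_subspaceT.
have cf : continuous f by move=> x; apply: differentiable_continuous; apply/derivable1_diffP.
have c2 : derivable_oo_LRcontinuous f a b.
  split; first by move=> x _; exact: df.
  + exact: cvg_at_right_filter (cf a).
  + exact: cvg_at_left_filter (cf b).
by rewrite /itg /Rintegral (continuous_FTC2 ab c1 c2 (fun x _ => erefl)).
Qed.

(** A function whose right increments are dominated, up to an arbitrarily small
    slope, by those of a nondecreasing K grows no more than K. Neither function has
    to be differentiable, so that K may be the primitive of a rate that is merely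
    integrable. One follows the supremum c of the times up to which the estimate
    holds with a slack e: continuity carries it to c, and the hypothesis beyond c;
    at the left end point, where nothing is assumed, the slack is used instead. *)
Lemma growth a b (F K : R -> R) : a <= b -> continuous_in absR `[a, b] F ->
  (forall s t, a <= s -> s <= t -> t <= b -> K s <= K t) ->
  (forall t, a < t -> t < b -> forall e : R, 0 < e -> exists2 d : R, 0 < d &
     forall s, t < s -> s < t + d -> s <= b -> F s - F t <= K s - K t + e * (s - t)) ->
  F b - F a <= K b - K a.
Proof.
move=> ab /(continuous_in_epsP _ _ absR_ge0) cF mK H; rewrite lerBlDr.
apply/ler_addgt0Pr => e0 e00.
pose e := e0 / (b - a + 1).
have e_gt0 : 0 < e by rewrite divr_gt0//; lra.
have -> : e0 = e * (b - a) + e by rewrite /e; field; apply/eqP; lra.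
pose G t := F t <= F a + (K t - K a) + e * (t - a) + e.
pose S := [set t | a <= t <= b /\ forall s, a <= s -> s <= t -> G s].
suff : S b by move=> [_ /(_ b ab (lexx _))]; rewrite /G; lra.
have Sa : S a.
  split; first by rewrite lexx.
  move=> s as_ sa; have -> : s = a by apply/le_anti; rewrite sa as_.
  by rewrite /G; nra.
have bS : ubound S b by move=> t [/andP[]].
have supS : has_sup S by split; [exists a|exists b].
pose c := sup S.
have ac : a <= c by apply: sup_ubound => //; exists b.
have cb : c <= b by apply: ge_sup => //; exists a.
have Gl s : a <= s -> s < c -> G s.
  move=> as_ sc; have [t [_ Ht]] := @sup_adherent _ S (c - s) ltac:(lra) supS.
  rewrite -/c => st; apply: Ht => //; lra.
have ci : `[a, b]%classic c by rewrite /= in_itv/= ac.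
have Gc : G c.
  move: ac; rewrite le_eqVlt => /predU1P[<-|ac]; first by case: Sa => _; exact.
  rewrite /G; apply/ler_addgt0Pr => e1 e10; have [d d0 Hd] := cF c ci e1 e10.
  pose s := Num.max a (c - d / 2).
  have as_ : a <= s by rewrite le_max lexx.
  have sc : s < c by rewrite gt_max ac; lra.
  have cs : c - d / 2 <= s by rewrite le_max lexx orbT.
  have := Hd s; rewrite /= in_itv/= as_ (ltW (lt_le_trans sc cb)) => /(_ isT).
  rewrite ler0_norm; last lra.
  move=> /(_ ltac:(lra)); rewrite /absR ltr_norml => /andP[h1 h2].
  have := Gl s as_ sc; rewrite /G; have := mK s c as_ (ltW sc) cb; nra.
have Sc : S c.
  split; first by rewrite ac.
  by move=> s as_; rewrite le_eqVlt => /predU1P[->//|]; exact: Gl.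
move: cb; rewrite le_eqVlt => /predU1P[<-//|cb]; exfalso.
suff [d d0 Hd] : exists2 d, 0 < d & forall s, c < s -> s < c + d -> s <= b -> G s.
  pose s := Num.min b (c + d / 2).
  have sb : s <= b by rewrite ge_min lexx.
  have cs : c < s by rewrite lt_min cb; lra.
  have sd : s <= c + d / 2 by rewrite ge_min lexx orbT.
  have : S s.
    split; first by rewrite sb; lra.
    move=> t at_ ts; have [tc|ct] := leP t c; first by case: Sc => _; apply.
    by apply: Hd => //; lra.
  by move=> /(sup_ubound supS.2); rewrite -/c; lra.
have [ac'|ca] := ltP a c.
  have [d d0 Hd] := H c ac' cb e e_gt0; exists d => // s cs sd sb.
  by have := Hd s cs sd sb; move: Gc; rewrite /G; lra.
have ca' : c = a by apply/le_anti; rewrite ac ca.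
have [d d0 Hd] := cF c ci e e_gt0; exists d => // s cs sd sb.
have := Hd s; rewrite /= in_itv/= sb (ltW (le_lt_trans ac cs)) => /(_ isT).
rewrite ger0_norm; last lra.
move=> /(_ ltac:(lra)); rewrite /absR ltr_norml ca' => /andP[_ h2].
by have := mK a s (lexx _) ltac:(lra) sb; rewrite /G; nra.
Qed.

(** The functions of class H^1 on [a, b] with their derivative, encoded by the
    fundamental theorem of calculus. *)
Definition is_prim a b f g := L2on a b g /\ forall x, a <= x <= b -> f x = f a + itg a x g.

Lemma is_prim_diff a b f g x y : is_prim a b f g -> a <= x -> x <= y -> y <= b ->
  f y - f x = itg x y g.
Proof.
move=> [g2 fg] ax xy yb; rewrite (fg y) ?yb ?(le_trans ax xy)//.
rewrite (fg x) ?ax ?(le_trans xy yb)// (itg_split ax xy).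
  by rewrite opprD addrACA subrr add0r addrC addKr.
by apply: intble_sub (L2on_int g2).
Qed.

Lemma is_prim_holder a b f g x y : is_prim a b f g -> a <= x -> x <= y -> y <= b ->
  `|f y - f x| <= Num.sqrt (y - x) * nrm2 a b g.
Proof.
move=> fg ax xy yb; rewrite (is_prim_diff fg ax xy yb).
have g2 := fg.1; apply: le_trans (itg_holder xy (L2on_sub ax yb g2)) _.
by rewrite ler_wpM2l ?sqrtr_ge0// le_nrm2_sub.
Qed.

Lemma is_prim_cont a b f g : is_prim a b f g -> continuous_in absR `[a, b] f.
Proof.
move=> fg; apply/(continuous_in_epsP _ _ absR_ge0) => t; rewrite /= in_itv/= => /andP[at_ tb] e e0.
pose M := nrm2 a b g + 1.
have M0 : 0 < M by rewrite ltr_wpDl ?nrm2_ge0.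
exists ((e / M) ^+ 2); first by rewrite exprn_gt0// divr_gt0.
move=> s; rewrite /= in_itv/= => /andP[as_ sb] st.
have key x y : a <= x -> x <= y -> y <= b -> y - x < (e / M) ^+ 2 -> `|f y - f x| < e.
  move=> ax xy yb yx; apply: le_lt_trans (is_prim_holder fg ax xy yb) _.
  have : Num.sqrt (y - x) < e / M.
    rewrite -(ger0_norm (ltW (divr_gt0 e0 M0))) -sqrtr_sqr ltr_sqrt//.
    by rewrite exprn_gt0// divr_gt0.
  rewrite ltr_pdivlMr// => h; apply: le_lt_trans h.
  by rewrite ler_wpM2l ?sqrtr_ge0// lerDl.
have [ts|/ltW st'] := leP t s.
  by apply: key => //; rewrite -(ger0_norm (_ : 0 <= s - t)) ?subr_ge0.
by rewrite /absR distrC; apply: key => //; rewrite -(ger0_norm (_ : 0 <= t - s)) ?subr_ge0// distrC.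
Qed.

Lemma is_prim_sub a b c d f g : a <= c -> c <= d -> d <= b -> is_prim a b f g -> is_prim c d f g.
Proof.
move=> ac cd db fg; split; first exact: L2on_sub fg.1.
move=> x /andP[cx xd]; rewrite -(is_prim_diff fg ac cx (le_trans xd db)); lra.
Qed.

Lemma is_primP a b g : a <= b -> L2on a b g -> is_prim a b (fun x => itg a x g) g.
Proof. by move=> ab g2; split => // x _; rewrite itg_pt add0r. Qed.

Lemma is_prim_lin a b f g p q k : is_prim a b f g -> is_prim a b p q ->
  is_prim a b (fun x => k * f x + p x) (fun x => k * g x + q x).
Proof.
move=> [g2 fg] [q2 pq]; split; first by apply: L2onD => //; exact: L2onZ.
move=> x xab; rewrite fg// pq// itgD ?itgZ.
- lra.
- by apply: L2on_int; apply: L2on_sub g2; case/andP: xab.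
- by apply: L2on_int; apply: L2onZ; apply: L2on_sub g2; case/andP: xab.
- by apply: L2on_int; apply: L2on_sub q2; case/andP: xab.
Qed.

Lemma is_prim_cst a b k : is_prim a b (fun=> k) (fun=> 0).
Proof.
split; first exact: L2on_cst.
by move=> x /andP[ax xb]; rewrite itg_cst// mul0r addr0.
Qed.

Lemma eq_is_prim a b f f' g : (forall x, a <= x <= b -> f x = f' x) ->
  a <= b -> is_prim a b f g -> is_prim a b f' g.
Proof.
move=> ff' ab [g2 H]; split=> // x xab; rewrite -ff'// -ff' ?lexx//; exact: H.
Qed.

Lemma cont_L2mul a b f g : continuous_in absR `[a, b] f -> L2on a b g ->
  L2on a b (fun x => f x * g x).
Proof. by move=> cf; have [k _ fk] := cont_bnd cf; apply: (L2onMb (cont_meas cf) fk). Qed.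

Lemma cont_mul a b f g : continuous_in absR `[a, b] f -> continuous_in absR `[a, b] g ->
  continuous_in absR `[a, b] (fun x => f x * g x).
Proof.
move=> /continuous_in_within cf /continuous_in_within cg; apply/continuous_in_within => x.
by apply: cvgM; [exact: cf|exact: cg].
Qed.

Lemma cont_add a b f g : continuous_in absR `[a, b] f -> continuous_in absR `[a, b] g ->
  continuous_in absR `[a, b] (fun x => f x + g x).
Proof.
move=> /continuous_in_within cf /continuous_in_within cg; apply/continuous_in_within => x.
by apply: cvgD; [exact: cf|exact: cg].
Qed.

Lemma cont_cst a b k : continuous_in absR `[a, b] (fun=> k).
Proof. by apply/continuous_in_within => x; apply: cvg_cst. Qed.

Lemma cont_opp a b f : continuous_in absR `[a, b] f ->
  continuous_in absR `[a, b] (fun x => - f x).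
Proof.
by move=> /continuous_in_within cf; apply/continuous_in_within => x; apply: cvgN; exact: cf.
Qed.

(** Integration by parts. The functions need not be differentiable at any given
    point, so growth is applied to plus and minus the defect D of the formula: its
    increment over [t, s] is the integral of g (p s - p) + q (f t - f), which by
    continuity is at most e1 times the integral of |g| + |q|. *)
Lemma is_prim_mul a b f g p q : a <= b -> is_prim a b f g -> is_prim a b p q ->
  itg a b (fun x => g x * p x + f x * q x) = f b * p b - f a * p a.
Proof.
move=> ab fg pq.
have cf := is_prim_cont fg; have cp := is_prim_cont pq.
have [g2 _] := fg; have [q2 _] := pq.
pose h x := g x * p x + f x * q x.
have h2 : L2on a b h.
  apply: L2onD; last exact: cont_L2mul.
  by have := cont_L2mul cp g2; congr L2on; apply/funext => x; rewrite mulrC.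
have hp := is_primP ab h2; have ch := is_prim_cont hp.
pose D x := f x * p x - itg a x h.
have cD : continuous_in absR `[a, b] D by apply: cont_add; [exact: cont_mul|exact: cont_opp].
pose k x : R := `|g x| + `|q x|.
have k2 : L2on a b k by apply: L2onD; exact: L2on_norm.
have k0 x : 0 <= k x by rewrite addr_ge0.
have kp := is_primP ab k2.
have mk s t : a <= s -> s <= t -> t <= b -> itg a s k <= itg a t k.
  move=> as_ st tb; rewrite -subr_ge0 (is_prim_diff kp as_ st tb).
  by apply: itg_ge0 => x _.
suff main (F : R -> R) : (F = D \/ F = \- D) -> F b - F a <= 0.
  have h1 := main D (or_introl erefl); have h2' := main _ (or_intror erefl).
  have : D b - D a = 0 by apply/le_anti; rewrite h1 /=; move: h2'; rewrite /=; lra.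
  rewrite /D itg_pt -/h; lra.
move=> FD; apply/ler_addgt0Pr => e e0; rewrite add0r.
pose e1 := e / (itg a b k + 1).
have K0 : 0 <= itg a b k by apply: itg_ge0.
have e10 : 0 < e1 by rewrite divr_gt0//; lra.
apply: (@le_trans _ _ (e1 * itg a b k - e1 * itg a a k)); last first.
  rewrite itg_pt mulr0 subr0 /e1 mulrAC ler_pdivrMr; last lra.
  by nra.
apply: (@growth a b F (fun x => e1 * itg a x k)) => //.
- by case: FD => ->//; exact: cont_opp.
- by move=> s t as_ st tb; rewrite ler_pM2l//; exact: mk.
move=> t at_ tb e2 e20.
have ti : `[a, b]%classic t by rewrite /= in_itv/= !ltW.
move/(continuous_in_epsP _ _ absR_ge0): cf => /(_ t ti (e1 / 2) ltac:(lra)) [d1 d10 H1].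
move/(continuous_in_epsP _ _ absR_ge0): cp => /(_ t ti (e1 / 2) ltac:(lra)) [d2 d20 H2].
exists (Num.min d1 d2); first by rewrite lt_min d10.
move=> s ts sd sb.
have sd1 : s < t + d1 by apply: lt_le_trans sd _; rewrite lerD2l ge_min lexx.
have sd2 : s < t + d2 by apply: lt_le_trans sd _; rewrite lerD2l ge_min lexx orbT.
have as_ : a <= t by exact: ltW.
have ts' := ltW ts.
have ids u : intble a b u -> intble t s u by exact: intble_sub.
have E : D s - D t = itg t s (fun x => g x * (p s - p x) + q x * (f t - f x)).
  have -> : itg t s (fun x => g x * (p s - p x) + q x * (f t - f x)) =
     itg t s (fun x => (p s * g x + f t * q x) - h x).
    by apply: eq_itg => x _; rewrite /h; ring.
  have i1 := L2on_sub as_ sb g2; have i2 := L2on_sub as_ sb q2.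
  have j1 : intble t s (fun x => p s * g x) by apply: L2on_int; exact: L2onZ.
  have j2 : intble t s (fun x => f t * q x) by apply: L2on_int; exact: L2onZ.
  rewrite itgB; [|exact: intbleD|by apply: ids; exact: L2on_int].
  rewrite [X in _ = X - _]itgD // !itgZ; [|exact: L2on_int..].
  rewrite -(is_prim_diff fg)// -(is_prim_diff pq)// -(is_prim_diff hp)// /D; ring.
have B : `|D s - D t| <= e1 * itg a s k - e1 * itg a t k.
  rewrite -mulrBr (is_prim_diff kp as_ ts' sb) E.
  have cpp : continuous_in absR `[a, b] (fun x => p s - p x).
    by apply: cont_add; [exact: cont_cst|apply: cont_opp; exact: is_prim_cont pq].
  have cff : continuous_in absR `[a, b] (fun x => f t - f x).
    by apply: cont_add; [exact: cont_cst|apply: cont_opp; exact: is_prim_cont fg].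
  have i0 : intble a b (fun x => g x * (p s - p x) + q x * (f t - f x)).
    by apply: L2on_int; apply: L2onD;
      [have := cont_L2mul cpp g2|have := cont_L2mul cff q2];
      congr L2on; apply/funext => x; rewrite mulrC.
  apply: le_trans (le_norm_itg (ids _ i0)) _.
  rewrite -itgZ; last by apply: ids; exact: L2on_int.
  apply: le_itg; [by apply: intble_norm; exact: ids|by apply: intbleZ; apply: ids; exact: L2on_int|].
  move=> x /andP[tx xs]; apply: le_trans (ler_normD _ _) _; rewrite !normrM /k mulrDr.
  have xi : `[a, b]%classic x by rewrite /= in_itv/=; apply/andP; split; lra.
  have si : `[a, b]%classic s by rewrite /= in_itv/=; apply/andP; split; lra.
  have h1 := H1 x xi ltac:(rewrite ger0_norm; lra).
  have h2' := H2 x xi ltac:(rewrite ger0_norm; lra).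
  have h3 := H2 s si ltac:(rewrite ger0_norm; lra).
  have h4 : `|p s - p x| <= e1.
    have -> : p s - p x = (p s - p t) - (p x - p t) by ring.
    by apply: le_trans (ler_normB _ _) _; move: h2' h3; rewrite /absR; lra.
  have h5 : `|f t - f x| <= e1 by rewrite distrC; move: h1; rewrite /absR; lra.
  by apply: lerD; rewrite mulrC; apply: ler_wpM2r.
have : F s - F t <= `|D s - D t|.
  by case: FD => -> /=; [exact: ler_norm|rewrite -normrN; apply: le_trans (ler_norm _); lra].
have : 0 <= e2 * (s - t) by rewrite mulr_ge0 ?ltW// subr_gt0.
move: B; lra.
Qed.

End Calculus1.

(** * Norms from averages *)

Section Riesz.
Context {R : realType}.
Local Notation leb := (@lebesgue_measure R).
Implicit Types (a b c d t s x L K : R) (f g p q : R -> R).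

Definition grid L n i : R := i%:R * (L / n%:R).

Lemma grid0 L n : grid L n 0 = 0. Proof. by rewrite /grid mul0r. Qed.

Lemma gridn L n : (0 < n)%N -> grid L n n = L.
Proof. by move=> n0; rewrite /grid mulrCA divff ?mulr1// pnatr_eq0 -lt0n. Qed.

Lemma gridS L n i : grid L n i.+1 = grid L n i + L / n%:R.
Proof. by rewrite /grid -natr1; ring. Qed.

Lemma le_grid L n i j : 0 < L -> (i <= j)%N -> grid L n i <= grid L n j.
Proof.
move=> L0 ij; rewrite /grid ler_wpM2r ?ler_nat// divr_ge0 ?(ltW L0)//.
Qed.

Lemma grid_ge0 L n i : 0 < L -> 0 <= grid L n i.
Proof. by move=> L0; rewrite -(grid0 L n) le_grid. Qed.

Lemma grid_leL L n i : 0 < L -> (i <= n)%N -> grid L n i <= L.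
Proof.
case: n => [|n] L0 ni; first by move: ni; rewrite leqn0 => /eqP ->; rewrite grid0 ltW.
by rewrite -[leRHS](@gridn _ n.+1)// le_grid.
Qed.

Lemma itg_cells_le L n f k : 0 < L -> intble 0 L f -> (k <= n)%N ->
  itg 0 (grid L n k) f = \sum_(i < k) itg (grid L n i) (grid L n i.+1) f.
Proof.
move=> L0 hf; elim: k => [|k IH] kn; first by rewrite big_ord0 grid0 itg_pt.
rewrite big_ord_recr /= -IH ?(ltnW kn)//; apply: itg_split; rewrite ?grid_ge0 ?le_grid//.
by apply: intble_sub hf; rewrite ?grid_leL.
Qed.

Lemma itg_cells L n f : 0 < L -> (0 < n)%N -> intble 0 L f ->
  itg 0 L f = \sum_(i < n) itg (grid L n i) (grid L n i.+1) f.
Proof. by move=> L0 n0 hf; rewrite -itg_cells_le// gridn. Qed.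

Lemma cell_index L n x : 0 < L -> (0 < n)%N -> 0 <= x < L ->
  exists2 i, (i < n)%N & grid L n i <= x < grid L n i.+1 /\ Num.floor (x * n%:R / L) = i%:Z.
Proof.
move=> L0 n0 /andP[x0 xL]; have n0' : 0 < n%:R :> R by rewrite ltr0n.
have y0 : 0 <= x * n%:R / L by rewrite divr_ge0 ?mulr_ge0// ltW.
have := floor_itv (x * n%:R / L).
have := y0; rewrite -floor_ge0; case E : (Num.floor _) => [i|//] _ /andP[h1 h2].
have e1 : grid L n i <= x.
  have -> : grid L n i = i%:R * L / n%:R by rewrite /grid mulrA.
  by rewrite ler_pdivrMr// -ler_pdivlMr.
exists i; last first.
  split => //; rewrite e1 /=.
  have -> : grid L n i.+1 = i.+1%:R * L / n%:R by rewrite /grid mulrA.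
  rewrite ltr_pdivlMr// -ltr_pdivrMr//; apply: lt_le_trans h2 _.
  by rewrite -natr1 intrD.
have := le_lt_trans e1 xL; rewrite -[ltRHS](gridn L n0) /grid ltr_pM2r ?divr_gt0//.
by rewrite ltr_nat.
Qed.

Lemma L2on_cell L n i f : 0 < L -> (i < n)%N -> L2on 0 L f -> L2on (grid L n i) (grid L n i.+1) f.
Proof. by move=> L0 ni; apply: L2on_sub; rewrite ?grid_ge0 ?grid_leL. Qed.

(** The L^2 norm is controlled by the averages over the cells of all uniform grids:
    the piecewise averages psi converge to f almost everywhere by Lebesgue's
    differentiation theorem, and Fatou's lemma applies to their squares. Integrals
    over intervals are continuous functionals, easy to follow along a path. *)
Lemma riesz_sqr L f K : 0 < L -> L2on 0 L f ->
  (forall n, (0 < n)%N ->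
    \sum_(i < n) (n%:R / L) * itg (grid L n i) (grid L n i.+1) f ^+ 2 <= K) ->
  itg 0 L (fun x => f x ^+ 2) <= K.
Proof.
move=> L0 f2 H.
pose f0 := f \_ `[0, L].
have f0E x : 0 <= x <= L -> f0 x = f x.
  by move=> xL; rewrite /f0 patchE mem_set//= in_itv.
(* psi n averages f over the n + 1 cells; below, E x n is the cell of x *)
pose c n i := (n.+1%:R / L) * itg (grid L n.+1 i) (grid L n.+1 i.+1) f.
pose psi n x := \sum_(i < n.+1) c n i * \1_(`[grid L n.+1 i, grid L n.+1 i.+1[) x.
have psiE n x i : (i < n.+1)%N -> grid L n.+1 i <= x < grid L n.+1 i.+1 -> psi n x = c n i.
  move=> ni xi; rewrite /psi (bigD1 (Ordinal ni))//= big1 ?addr0.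
    by rewrite indicE mem_set ?mulr1//= in_itv.
  move=> j ji; rewrite indicE memNset ?mulr0//= in_itv/= => /andP[h1 h2].
  case/andP: xi => h3 h4.
  have [ij|ij|ij] := ltngtP i j; last by move/eqP: ji; apply; apply/val_inj.
  - by have := le_grid n.+1 L0 ij; lra.
  - by have := le_grid n.+1 L0 ij; lra.
have mpsi n : measurable_fun setT (psi n).
  by apply: measurable_sum => i; apply: measurable_funM => //; exact: measurable_indic.
have L2psi n : L2on 0 L (psi n).
  apply: (@L2on_bnd _ _ _ _ (\sum_(i < n.+1) `|c n i|)); first exact: measurable_funS (mpsi n).
  move=> x _; apply: le_trans (ler_norm_sum _ _ _) _; apply: ler_sum => i _.
  rewrite normrM ler_piMr// indicE; case: (_ \in _); rewrite ?normr1 ?normr0//.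
have Ipsi n : itg 0 L (fun x => psi n x ^+ 2) <= K.
  rewrite (@itg_cells _ n.+1)//; last exact: L2on_sqr.
  apply: le_trans (H n.+1 isT); apply: ler_sum => i _.
  rewrite -(@ae_eq_itg _ _ _ (fun=> c n i ^+ 2))//; last first.
    exists [set grid L n.+1 i.+1]; split => //; first exact: lebesgue_measure_set1.
    move=> x /= /not_implyP[/andP[h1 h2] h3]; apply: contrapT => h4; apply: h3.
    rewrite (@psiE n x i)// h1 lt_neqAle h2 andbT; exact/eqP.
  rewrite itg_cst ?le_grid//; have -> : grid L n.+1 i.+1 - grid L n.+1 i = L / n.+1%:R by rewrite gridS; ring.
  rewrite /c; set I := itg _ _ _; have : n.+1%:R != 0 :> R by rewrite pnatr_eq0.
  move: n.+1%:R => m m0; rewrite le_eqVlt; apply/orP; left; apply/eqP; field.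
  by rewrite m0 gt_eqF.
pose j (x : R) n : int := Num.floor (x * n.+1%:R / L).
pose E (x : R) n : set R := `[(j x n)%:~R * (L / n.+1%:R), (j x n + 1)%:~R * (L / n.+1%:R)]%classic.
have h0 n : 0 < L / n.+1%:R by rewrite divr_gt0.
have muE x n : leb (E x n) = (L / n.+1%:R)%:E.
  rewrite /E lebesgue_measure_itv/= lte_fin ltr_pM2r// ltr_int ltrDl ltr01.
  by rewrite -EFinB -mulrBl -intrB addrAC subrr add0r mul1r.
have hE x : nicely_shrinking x (E x).
  split; first by move=> n; exact: measurable_itv.
  have h2 n : 0 < 2 * (L / n.+1%:R) by rewrite mulr_gt0.
  exists (4, fun n => PosNum (h2 n)); split => //=.
  - rewrite -(mulr0 2); apply: cvgM; first exact: cvg_cst.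
    rewrite -(mulr0 L); apply: cvgM; first exact: cvg_cst.
    exact: cvg_harmonic.
  - move=> n y; rewrite /E/= in_itv/= /ball/= => /andP[h1 h3].
    have := floor_itv (x * n.+1%:R / L); rewrite -/(j x n) => /andP[].
    rewrite ler_pdivlMr// -ler_pdivrMr ?ltr0n// -mulrA => g1.
    rewrite ltr_pdivrMr// -ltr_pdivlMr ?ltr0n// -mulrA => g2.
    move: h3 g2; rewrite intrD mulrDl mul1r => h3 g2.
    rewrite ltr_norml; move: (h0 n) h1 g1 h3 g2; move: (L / n.+1%:R) (_%:~R) => w z; nra.
  - move=> n; rewrite lebesgue_measure_ball; last exact/ltW/h2.
    by rewrite (muE x n) -EFinM lee_fin; move: (h0 n); move: (L / n.+1%:R) => w w0; lra.
have lf0 : locally_integrable setT f0.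
  by apply: integrable_locally_restrict => //; exact: L2on_int f2.
have cvpsi : {ae leb, forall x, `[0, L]%classic x -> (f x ^+ 2)%:E = limn_einf (fun n => (psi n x ^+ 2)%:E)}.
  apply: ae2 (lebesgue_differentiation lf0) (ae_neq L) => x xl xL.
  rewrite /= in_itv/= => x0L; apply/esym.
  have x0L' : 0 <= x < L by case/andP: x0L => -> ? /=; rewrite lt_neqAle xL.
  suff cv : psi n x @[n --> \oo] --> f x.
    have cv2 : (psi n x ^+ 2)%:E @[n --> \oo] --> (f x ^+ 2)%:E.
      by apply/cvg_EFin; [exact: nearW|exact: cvgM].
    by rewrite is_cvg_limn_einfE; [exact/cvg_lim|apply/cvg_ex; eexists; exact: cv2].
  rewrite -(f0E _ x0L).
  suff : (psi n x)%:E @[n --> \oo] --> (f0 x)%:E by move=> /fine_cvg.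
  have := nice_lebesgue_differentiation hE lf0 xl.
  apply: cvg_trans; apply: near_eq_cvg; apply: nearW => n /=.
  have [i ni [xi ji]] := cell_index L0 (ltn0Sn n) x0L'.
  rewrite (psiE _ _ _ ni xi) muE /c.
  have eE : E x n = `[grid L n.+1 i, grid L n.+1 i.+1]%classic.
    by rewrite /E /j ji /grid -[in RHS](addn1 i).
  rewrite eE inver gt_eqF// [X in (_ * X)%E](_ : _ = (itg (grid L n.+1 i) (grid L n.+1 i.+1) f)%:E).
    by rewrite -EFinM invf_div.
  rewrite /itg /Rintegral fineK.
    apply: eq_integral => y; rewrite inE/= in_itv/= => /andP[y1 y2]; rewrite f0E//.
    by rewrite (le_trans (grid_ge0 _ _ L0) y1) (le_trans y2)// grid_leL.
  by apply: integrable_fin_num => //; apply: L2on_int; exact: L2on_cell.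
have mL : measurable (`[0, L]%classic : set R) by exact: measurable_itv.
have mpsi2 n : measurable_fun `[0, L] (fun x => (psi n x ^+ 2)%:E).
  by apply/measurable_EFinP; apply: measurable_funX; exact: measurable_funS (mpsi n).
have := fatou leb mL mpsi2 (fun n x _ => sqr_ge0 (psi n x) : (0 <= (psi n x ^+ 2)%:E)%E).
have mf2 : measurable_fun `[0, L] (fun x => (f x ^+ 2)%:E).
  by apply/measurable_EFinP; apply: measurable_funX; case: f2.
rewrite -(ae_eq_integral_leb mL mf2 cvpsi).
move=> F.
rewrite -lee_fin -itg_EFin ?L2on_sqr//; apply: le_trans F _.
rewrite limn_einf_lim; apply: lime_le; first exact: is_cvg_einfs.
apply: nearW => n; apply: le_trans (_ : (\int[leb]_(x in `[0%R, L]) (psi n x ^+ 2)%:E <= _)%E).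
  by apply: ereal_inf_lbound; exists n => //=.
by rewrite itg_EFin ?L2on_sqr// lee_fin.
Qed.

End Riesz.

(** * Weak derivatives are primitives *)

Section WeakDerivative.
Context {R : realType}.
Local Notation leb := (@lebesgue_measure R).
Implicit Types (a b c d t s x L K : R) (f g p q : R -> R).

Lemma itg_sqr_eq0 a b f : L2on a b f -> itg a b (fun x => f x ^+ 2) <= 0 ->
  {ae leb, forall x, a <= x <= b -> f x = 0}.
Proof.
move=> f2 h; have mf : measurable_fun `[a, b] (fun x => (f x ^+ 2)%:E).
  by apply/measurable_EFinP; apply: measurable_funX; case: f2.
have := (ae_eq_integral_abs leb (measurable_itv _) mf).1.
have -> : (\int[leb]_(x in `[a, b]) `|(f x ^+ 2)%:E| = \int[leb]_(x in `[a, b]) (f x ^+ 2)%:E)%E.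
  by apply: eq_integral => x _; rewrite gee0_abs// lee_fin sqr_ge0.
rewrite itg_EFin ?L2on_sqr// => /(_ _)/wrap[|].
  by congr EFin; apply/le_anti; rewrite h itg_ge0// => x _; exact: sqr_ge0.
apply: aeS => x H xab; have := H; rewrite /= in_itv/= => /(_ xab) [] /eqP.
by rewrite sqrf_eq0 => /eqP.
Qed.

Lemma ae_zero_of_intervals L f : 0 < L -> L2on 0 L f ->
  (forall a b, 0 <= a -> a <= b -> b <= L -> itg a b f = 0) ->
  {ae leb, forall x, 0 <= x <= L -> f x = 0}.
Proof.
move=> L0 f2 H; apply: itg_sqr_eq0 => //; apply: riesz_sqr => // n n0.
rewrite big1// => i _; rewrite H ?expr0n ?mulr0// ?grid_ge0 ?le_grid ?grid_leL//.
Qed.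

(** The function y |y| / 2 is an antiderivative of |y| of class C^1; combinations of
    its translates are test functions with piecewise affine derivatives. *)
Lemma xabs_cvg x : (fun h => h^-1 *: (((fun y : R => y * `|y|) \o shift x) h%:A - x * `|x|))
  @ 0^' --> (2 * `|x| : R).
Proof.
apply/cvgrPdist_lt => e e0; apply/nbhs_ballP; exists e => //= h.
rewrite /ball/= sub0r normrN => he h0; rewrite /GRing.scale /= mulr1.
have h0' : 0 < `|h| by rewrite normr_gt0.
have E : `|(h + x) * `|h + x| - x * `|x| - 2 * `|x| * h| <= `|h| ^+ 2.
  rewrite real_normK ?num_real//; rewrite ler_norml.
  by have [hx|hx] := lerP 0 (h + x); have [xx|xx] := lerP 0 x;
    rewrite ?(ger0_norm hx) ?(ltr0_norm hx) ?(ger0_norm xx) ?(ltr0_norm xx); apply/andP; split; nra.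
have -> : 2 * `|x| - h^-1 * ((h + x) * `|h + x| - x * `|x|) =
    - (h^-1 * ((h + x) * `|h + x| - x * `|x| - 2 * `|x| * h)) by field.
rewrite normrN normrM normfV; apply: le_lt_trans he.
by rewrite mulrC ler_pdivrMr// -expr2.
Qed.

Lemma xabs_derive x : is_derive x 1 (fun y : R => y * `|y|) (2 * `|x|).
Proof.
apply: DeriveDef; last by apply: cvg_lim => //; exact: xabs_cvg.
by apply/cvg_ex; exists (2 * `|x|); exact: xabs_cvg.
Qed.

(** A trapezoid rising on [a, a + e] and falling on [b, b + e], written with absolute
    values to make its antiderivative itrap explicit; itrap is constant outside of
    [a, b + e], with opposite values on both sides. *)
Definition trap a b (e : R) x : R :=
  (2 * e)^-1 * (`|x - a| - `|x - (a + e)| - `|x - b| + `|x - (b + e)|).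
Definition itrap a b (e : R) x : R := let D y := 2^-1 * (y * `|y|) in
  (2 * e)^-1 * (D (x - a) - D (x - (a + e)) - D (x - b) + D (x - (b + e))).

Lemma itrap_derive a b (e : R) x : 0 < e -> is_derive x 1 (itrap a b e) (trap a b e x).
Proof.
move=> e0.
have H c : is_derive x 1 (fun y : R => 2^-1 * ((y - c) * `|y - c|)) `|x - c|.
  have d1 : is_derive x 1 (fun y : R => y - c) (1 : R).
    by apply: is_derive_eq; rewrite subr0.
  have d2 := @is_derive1_comp _ (fun y : R => y * `|y|) (fun y : R => y - c) x _ _ (xabs_derive (x - c)) d1.
  have d3 : is_derive x 1 (fun y : R => 2^-1 * ((y - c) * `|y - c|)) _ := is_deriveZ 2^-1 d2.
  by apply: (is_derive_eq d3); rewrite /GRing.scale/=; field.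
have d4 : is_derive x 1 (itrap a b e) _ :=
  is_deriveZ (2 * e)^-1 (is_deriveD (is_deriveB (is_deriveB (H a) (H (a + e))) (H b)) (H (b + e))).
exact: (is_derive_eq d4).
Qed.

Lemma trap_cont a b (e : R) : continuous (trap a b e).
Proof.
have H (c : R) : continuous (fun x : R => `|x - c|).
  by move=> x; apply: cvg_norm; apply: cvgB; [exact: cvg_id|exact: cvg_cst].
move=> x; apply: cvgM; first exact: cvg_cst.
have Ha := H a x; have Hae := H (a + e) x; have Hb := H b x; have Hbe := H (b + e) x.
apply: cvgD; last exact: Hbe.
apply: cvgB; last exact: Hb.
by apply: cvgB; [exact: Ha|exact: Hae].
Qed.

Lemma itrap_left a b (e x : R) : 0 < e -> a <= b -> x <= a -> itrap a b e x = - ((b - a) / 2).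
Proof.
by move=> e0 ab xa; rewrite /itrap !ler0_norm; [field; rewrite gt_eqF|lra..].
Qed.

Lemma itrap_right a b (e x : R) : 0 < e -> a <= b -> b + e <= x -> itrap a b e x = (b - a) / 2.
Proof.
by move=> e0 ab xa; rewrite /itrap !ger0_norm; [field; rewrite gt_eqF|lra..].
Qed.

Lemma trap_out a b (e x : R) : 0 < e -> a <= b -> x <= a \/ b + e <= x -> trap a b e x = 0.
Proof.
move=> e0 ab [xa|xa]; rewrite /trap.
- by rewrite !ler0_norm; [field; rewrite gt_eqF|lra..].
- by rewrite !ger0_norm; [field; rewrite gt_eqF|lra..].
Qed.

Lemma trap_in a b (e x : R) : 0 < e -> a + e <= x -> x <= b -> trap a b e x = 1.
Proof.
move=> e0 ax xb; rewrite /trap (ger0_norm (_ : 0 <= x - a)); last lra.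
rewrite (ger0_norm (_ : 0 <= x - (a + e))); last lra.
rewrite (ler0_norm (_ : x - b <= 0)); last lra.
rewrite (ler0_norm (_ : x - (b + e) <= 0)); last lra.
by field; rewrite gt_eqF.
Qed.

Lemma trap_bnd a b (e x : R) : 0 < e -> `|trap a b e x| <= 1.
Proof.
move=> e0; rewrite /trap normrM ger0_norm; last by rewrite invr_ge0; lra.
rewrite ler_pdivrMl; last lra; rewrite mulr1 ler_norml.
have h1 y : `|x - y| - `|x - (y + e)| <= e.
  have := ler_normD (x - (y + e)) e; rewrite (ger0_norm (ltW e0)).
  have -> : x - (y + e) + e = x - y by ring.
  by lra.
have h2 y : - e <= `|x - y| - `|x - (y + e)|.
  have := ler_normB (x - y) e; rewrite (ger0_norm (ltW e0)).
  have -> : x - y - e = x - (y + e) by ring.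
  by lra.
have := h1 a; have := h2 a; have := h1 b; have := h2 b => ? ? ? ?.
apply/andP; split; lra.
Qed.

(** As e tends to 0 the trapezoid tests f like the indicator of [a, b]; the error
    comes from the two ramps of width e. *)
Lemma trap_avg L a b (e : R) f : 0 < e -> 0 <= a -> a + e <= b -> b + e <= L -> L2on 0 L f ->
  `|itg 0 L (fun x => f x * trap a b e x) - itg a b f| <= 3 * (Num.sqrt e * nrm2 0 L f).
Proof.
move=> e0 a0 ab bL f2.
have ct : continuous_in absR `[0, L] (trap a b e).
  by apply/continuous_in_within; apply: continuous_subspaceT; exact: trap_cont.
have fi : intble 0 L f by exact: L2on_int.
have ft2 : L2on 0 L (fun x => f x * trap a b e x).
  by have := cont_L2mul ct f2; congr L2on; apply/funext => x; rewrite mulrC.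
have fti := L2on_int ft2.
have sub c d g : 0 <= c -> d <= L -> intble 0 L g -> intble c d g by exact: intble_sub.
rewrite (@itg_split _ 0 L a)//; [|lra..].
rewrite (@itg_split _ a L (a + e))//; [|lra|lra|by apply: sub => //; lra].
rewrite (@itg_split _ (a + e) L b)//; [|lra|by apply: sub => //; lra].
rewrite (@itg_split _ b L (b + e))//; [|lra|by apply: sub => //; lra].
have z c d : (forall x, c <= x <= d -> trap a b e x = 0) -> c <= d ->
    itg c d (fun x => f x * trap a b e x) = 0.
  move=> h cd; rewrite -(mul0r (d - c)) -(itg_cst 0 cd); apply: eq_itg => x xcd.
  by rewrite h// mulr0.
have y c : 0 <= c -> c + e <= L -> `|itg c (c + e) (fun x => f x * trap a b e x)| <= Num.sqrt e * nrm2 0 L f.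
  move=> c0 cL; apply: le_trans (itg_holder (_ : c <= c + e) _) _; [lra|exact: L2on_sub ft2|].
  rewrite addrAC subrr add0r ler_wpM2l ?sqrtr_ge0//.
  have fc2 : L2on c (c + e) f by exact: L2on_sub f2.
  apply: (@le_trans _ _ (nrm2 c (c + e) f)); last by apply: le_nrm2_sub f2; lra.
  apply: ler_wsqrtr; apply: le_itg; try exact: L2on_sqr.
    by apply: L2on_sqr; exact: L2on_sub ft2.
  move=> x _; rewrite exprMn ler_piMr ?sqr_ge0//.
  rewrite -(real_normK (num_real (trap a b e x))) expr_le1//; exact: trap_bnd.
rewrite z; [|by move=> x /andP[? ?]; apply: trap_out; [|lra|left; lra]|lra].
rewrite (z (b + e)); [|by move=> x /andP[? ?]; apply: trap_out; [|lra|right; lra]|lra].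
have -> : itg (a + e) b (fun x => f x * trap a b e x) = itg (a + e) b f.
  by apply: eq_itg => x /andP[? ?]; rewrite trap_in ?mulr1.
rewrite (@itg_split _ a b (a + e) f); [|lra|lra|by apply: sub => //; lra].
have y1 := y a ltac:(lra) ltac:(lra); have y2 := y b ltac:(lra) ltac:(lra).
have y3 : `|itg a (a + e) f| <= Num.sqrt e * nrm2 0 L f.
  apply: le_trans (itg_holder (_ : a <= a + e) _) _; [lra|by apply: L2on_sub f2; lra|].
  rewrite addrAC subrr add0r ler_wpM2l ?sqrtr_ge0//.
  by apply: le_nrm2_sub f2; lra.
rewrite add0r addr0.
set A := itg a (a + e) _ in y1 *; set B := itg b _ _ in y2 *; set C := itg a _ _ in y3 *.
have -> : A + (itg (a + e) b f + B) - (C + itg (a + e) b f) = A + B - C by ring.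
have := ler_normB (A + B) C; have := ler_normD A B; lra.
Qed.

(** The difference of two normalized trapezoids has mean zero, so its antiderivative
    is a test function: f has the same average on all intervals inside ]0, L[. *)
Lemma avg_eq L a b c d f : 0 < L -> 0 < a -> a < b -> b < L -> 0 < c -> c < d -> d < L ->
  L2on 0 L f ->
  (forall phi, test_function 0 L phi -> itg 0 L (fun x => f x * derive1 phi x) = 0) ->
  itg a b f / (b - a) = itg c d f / (d - c).
Proof.
move=> L0 a0 ab bL c0 cd dL f2 H.
pose M := 3 * nrm2 0 L f * ((b - a)^-1 + (d - c)^-1) + 1.
have ba0 : 0 < b - a by rewrite subr_gt0.
have dc0 : 0 < d - c by rewrite subr_gt0.
have M0 : 0 < M.
  by rewrite ltr_wpDl// mulr_ge0// ?mulr_ge0 ?nrm2_ge0// addr_ge0// invr_ge0 ltW.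
apply/eqP; rewrite -subr_eq0 -normr_le0; apply/ler_addgt0Pr => e0 e00; rewrite add0r.
pose e := Num.min ((e0 / M) ^+ 2) (Num.min (Num.min (b - a) (d - c)) (Num.min ((L - b) / 2) ((L - d) / 2))).
have e_gt0 : 0 < e.
  have hb : 0 < (L - b) / 2 by lra.
  have hd : 0 < (L - d) / 2 by lra.
  by rewrite /e !lt_min ba0 dc0 hb hd exprn_gt0// divr_gt0.
have [e1 e2 e3 e4 e5] : [/\ e <= (e0 / M) ^+ 2, e <= b - a, e <= d - c, e <= (L - b) / 2 & e <= (L - d) / 2].
  by split; rewrite /e !ge_min lexx ?orbT.
pose phi x := (b - a)^-1 * itrap a b e x - (d - c)^-1 * itrap c d e x.
have dphi x : is_derive x 1 phi ((b - a)^-1 * trap a b e x - (d - c)^-1 * trap c d e x).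
  exact: is_deriveB (is_deriveZ _ (itrap_derive a b x e_gt0)) (is_deriveZ _ (itrap_derive c d x e_gt0)).
have phi'E : derive1 phi = fun x => (b - a)^-1 * trap a b e x - (d - c)^-1 * trap c d e x.
  by apply/funext => x; rewrite derive1E; apply: derive_val.
have tphi : test_function 0 L phi.
  split.
  - by move=> x; apply: ex_derive.
  - rewrite phi'E => x; apply: cvgB; (apply: cvgM; first exact: cvg_cst); exact: trap_cont.
  - exists (Num.min a c), (Num.max (b + e) (d + e)); split.
    + by rewrite lt_min a0.
    + by rewrite gt_max; apply/andP; split; lra.
    + move=> x; rewrite in_itv/= negb_and -!ltNge => /orP[|]; rewrite ?lt_min ?gt_max => /andP[h1 h2].
        rewrite /phi !itrap_left// ?ltW//; field; apply/andP; split; rewrite gt_eqF//.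
      by rewrite /phi !itrap_right// ?ltW//; field; apply/andP; split; rewrite gt_eqF.
have t2 a' b' : L2on 0 L (fun x => f x * trap a' b' e x).
  have ct : continuous_in absR `[0, L] (trap a' b' e).
    by apply/continuous_in_within; apply: continuous_subspaceT; exact: trap_cont.
  by have := cont_L2mul ct f2; congr L2on; apply/funext => x; rewrite mulrC.
have := H _ tphi; rewrite phi'E.
have -> : itg 0 L (fun x => f x * ((b - a)^-1 * trap a b e x - (d - c)^-1 * trap c d e x)) =
  (b - a)^-1 * itg 0 L (fun x => f x * trap a b e x) - (d - c)^-1 * itg 0 L (fun x => f x * trap c d e x).
  rewrite -!itgZ -?itgB; try (by apply: L2on_int); try (by apply: L2on_int; exact: L2onZ).
  by apply: eq_itg => x _; ring.
have T1 := trap_avg e_gt0 (ltW a0) (_ : a + e <= b) (_ : b + e <= L) f2.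
have T2 := trap_avg e_gt0 (ltW c0) (_ : c + e <= d) (_ : d + e <= L) f2.
have {T1} := T1 ltac:(lra) ltac:(lra); have {T2} := T2 ltac:(lra) ltac:(lra).
set A := itg 0 L (fun x => f x * trap a b e x); set C := itg 0 L (fun x => f x * trap c d e x).
set N := nrm2 0 L f => T2 T1 E.
have -> : itg a b f / (b - a) - itg c d f / (d - c) =
   (d - c)^-1 * (C - itg c d f) - (b - a)^-1 * (A - itg a b f) by lra.
apply: le_trans (ler_normB _ _) _; rewrite !normrM !(ger0_norm (_ : 0 <= _^-1)) ?invr_ge0 ?(ltW ba0) ?(ltW dc0)//.
have s1 : Num.sqrt e <= e0 / M.
  rewrite -(ger0_norm (ltW (divr_gt0 e00 M0))) -sqrtr_sqr; exact: ler_wsqrtr.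
have N0 : 0 <= N by exact: nrm2_ge0.
apply: (@le_trans _ _ (((b - a)^-1 + (d - c)^-1) * (3 * (e0 / M * N)))).
  rewrite mulrDl addrC; apply: lerD; rewrite ler_wpM2l ?invr_ge0 ?(ltW ba0) ?(ltW dc0)//.
    by apply: le_trans T1 _; rewrite ler_pM2l// ler_wpM2r.
  by apply: le_trans T2 _; rewrite ler_pM2l// ler_wpM2r.
have -> : ((b - a)^-1 + (d - c)^-1) * (3 * (e0 / M * N)) = e0 * ((M - 1) / M).
  have -> : M - 1 = 3 * N * ((b - a)^-1 + (d - c)^-1) by rewrite /M /N; ring.
  by ring.
by rewrite ler_piMr ?ltW// ltr_pdivrMr// mul1r; lra.
Qed.

(** The du Bois-Reymond lemma: f minus its average c over the middle third has zero
    average on every interval. *)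
Lemma weak_const L f : 0 < L -> L2on 0 L f ->
  (forall phi, test_function 0 L phi -> itg 0 L (fun x => f x * derive1 phi x) = 0) ->
  exists c, {ae leb, forall x, 0 <= x <= L -> f x = c}.
Proof.
move=> L0 f2 H; pose c := itg (L / 3) (2 * L / 3) f / (2 * L / 3 - L / 3); exists c.
have f2c : L2on 0 L (fun x => f x - c) by apply: L2onB => //; exact: L2on_cst.
suff : {ae leb, forall x, 0 <= x <= L -> f x - c = 0}.
  by apply: aeS => x h xL; have := h xL; lra.
apply: ae_zero_of_intervals => // a b a0 ab bL.
have pr := is_primP (ltW L0) f2c; have cp := is_prim_cont (is_prim_sub a0 ab bL pr).
have int0 s t : 0 < s -> s < t -> t < L -> itg s t (fun x => f x - c) = 0.
  move=> s0 st tL; rewrite itgB ?itg_cst ?(ltW st)//; last exact: intble_cst.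
    rewrite /c -(@avg_eq L s t (L / 3) (2 * L / 3) f)//; try lra.
    by field; rewrite gt_eqF// subr_gt0.
  by apply: intble_sub (L2on_int f2); lra.
have {}int0 F : (F = (itg 0)^~ (fun x => f x - c) \/ F = \- (itg 0)^~ (fun x => f x - c)) -> F b - F a <= 0.
  move=> FE; rewrite -[leRHS](subrr 0).
  apply: (@growth R a b F (fun=> 0)) => //; first by case: FE => -> //; exact: cont_opp.
  move=> t at_ tb e e0; exists (L - t); first by lra.
  move=> s ts sL sb; have : (itg 0 s (fun x => f x - c)) - itg 0 t (fun x => f x - c) = 0.
    by rewrite (is_prim_diff pr); [apply: int0|..]; lra.
  have := mulr_gt0 e0 (_ : 0 < s - t); rewrite subr_gt0 => /(_ ts).
  by case: FE => -> /=; lra.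
rewrite -(is_prim_diff pr a0 ab bL).
have := int0 _ (or_introl erefl); have := int0 _ (or_intror erefl) => /= h1 h2.
by apply/le_anti; apply/andP; split; lra.
Qed.

Lemma test_prim L phi : 0 <= L -> test_function 0 L phi ->
  [/\ is_prim 0 L phi (derive1 phi), phi 0 = 0 & phi L = 0].
Proof.
move=> L0 [d1 d2 [c [d [c0 dL z]]]]; split.
- split; first by apply: cont_L2on; apply/continuous_in_within; exact: continuous_subspaceT.
  by move=> x /andP[x0 _]; rewrite (FTC2 x0 d1 d2); lra.
- by apply: z; rewrite in_itv/= negb_and -!ltNge c0.
- by apply: z; rewrite in_itv/= negb_and -!ltNge dL orbT.
Qed.

(** A weak derivative is a derivative in the sense of primitives: weak_const applies
    to f minus a primitive of g. *)
Lemma weak_prim L f g : 0 < L -> L2on 0 L f -> L2on 0 L g ->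
  (forall phi, test_function 0 L phi ->
     itg 0 L (fun x => f x * derive1 phi x) = - itg 0 L (fun x => g x * phi x)) ->
  exists2 F, is_prim 0 L F g & {ae leb, forall x, 0 <= x <= L -> f x = F x}.
Proof.
move=> L0 f2 g2 H; have pr := is_primP (ltW L0) g2.
have cG := cont_L2on (is_prim_cont pr).
suff [c hc] : exists c, {ae leb, forall x, 0 <= x <= L -> f x - itg 0 x g = c}.
  exists (fun x => itg 0 x g + c); last by apply: aeS hc => x h xL; have := h xL; lra.
  by split => // x xL; rewrite itg_pt; lra.
apply: weak_const => //; first exact: L2onB.
move=> phi tphi.
have [pp p0 pL] := test_prim (ltW L0) tphi.
have := is_prim_mul (ltW L0) pr pp; rewrite p0 pL !mulr0 subrr.
have p2 := cont_L2on (is_prim_cont pp); have p'2 := pp.1.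
rewrite itgD; [|exact: L2on_mul|exact: L2on_mul] => E.
have -> : itg 0 L (fun x => (f x - itg 0 x g) * derive1 phi x) =
   itg 0 L (fun x => f x * derive1 phi x - itg 0 x g * derive1 phi x).
  by apply: eq_itg => x _; ring.
rewrite itgB; [|exact: L2on_mul|exact: L2on_mul].
by rewrite H//; lra.
Qed.

Lemma prim_weak L f F g phi : 0 < L -> L2on 0 L f -> is_prim 0 L F g ->
  {ae leb, forall x, 0 <= x <= L -> f x = F x} -> test_function 0 L phi ->
  itg 0 L (fun x => f x * derive1 phi x) = - itg 0 L (fun x => g x * phi x).
Proof.
move=> L0 f2 pr fF tphi; have [pp p0 pL] := test_prim (ltW L0) tphi.
have := is_prim_mul (ltW L0) pr pp; rewrite p0 pL !mulr0 subrr.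
have p2 := cont_L2on (is_prim_cont pp); have p'2 := pp.1.
have F2 := cont_L2on (is_prim_cont pr); have g2 := pr.1.
rewrite itgD; [|exact: L2on_mul|exact: L2on_mul] => E.
rewrite (@ae_eq_itg _ _ _ _ (fun x => F x * derive1 phi x)); first lra.
  by apply: measurable_funM; [case: f2|case: p'2].
by apply: aeS fF => x h xL; rewrite h.
Qed.

End WeakDerivative.

(** * Sobolev spaces as chains of primitives *)

Section Sealed.
Context {R : realType}.
Local Notation Fn := (R -> R^o).

Lemma Dw_seal : {D : R -> nat -> Fn -> Fn | D = @wDn R}.
Proof. by exists (@wDn R). Qed.
(** An opaque copy of wDn, and below one of value: comparing the choice operators
    inside them by computation would never end. *)
Definition Dw := sval Dw_seal.
Lemma DwE : Dw = @wDn R. Proof. exact: (svalP Dw_seal). Qed.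

Lemma pv_seal : {D : R -> nat -> Fn -> R -> R | D = @value R}.
Proof. by exists (@value R). Qed.
Definition pv := sval pv_seal.
Lemma pvE : pv = @value R. Proof. exact: (svalP pv_seal). Qed.

Lemma Dw0 L f : Dw L 0 f = f. Proof. by rewrite DwE. Qed.
Lemma DwS L j f : Dw L j.+1 f = wD L (Dw L j f). Proof. by rewrite DwE. Qed.
Lemma pv_crep L j f : pv L j f = crep L (Dw L j f). Proof. by rewrite pvE DwE. Qed.

End Sealed.

Section SobolevChain.
Context {R : realType}.
Local Notation leb := (@lebesgue_measure R).
Implicit Types (a b c d t s x L K : R) (f g p q : R -> R).

Lemma cont_ae_eq L f g : 0 < L -> continuous_in absR `[0, L] f -> continuous_in absR `[0, L] g ->
  {ae leb, forall x, 0 <= x <= L -> f x = g x} -> forall x, 0 <= x <= L -> f x = g x.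
Proof.
move=> L0 cf cg fg x xL; apply/eqP; rewrite -subr_eq0; apply/negPn/negP => D0.
have cD : continuous_in absR `[0, L] (fun y => f y - g y) by apply: cont_add => //; exact: cont_opp.
pose D y := f y - g y; have D0' : 0 < `|D x| by rewrite normr_gt0.
have xi : `[0, L]%classic x by rewrite /= in_itv.
have := (continuous_in_epsP _ _ absR_ge0).1 cD x xi (`|D x| / 2) ltac:(lra).
move=> [d d0 H].
pose a := Num.max 0 (x - d / 2); pose b := Num.min L (x + d / 2).
have [x0 xl] := andP xL.
have ab : a < b by rewrite lt_min !gt_max L0 /=; apply/andP; split; [|apply/andP; split]; lra.
have a0 : 0 <= a by rewrite le_max lexx.
have ax : x - d / 2 <= a by rewrite le_max lexx orbT.
have bL : b <= L by rewrite ge_min lexx.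
have bx : b <= x + d / 2 by rewrite ge_min lexx orbT.
have D2 : L2on a b D by apply: L2on_sub (cont_L2on cD).
have z : itg a b (fun y => D y ^+ 2) = 0.
  rewrite (@ae_eq_itg _ _ _ _ (fun=> 0)) ?itg_cst ?mul0r ?ltW//.
    by apply: measurable_funX; case: D2.
  apply: aeS fg => y h yab; rewrite /D h ?subrr ?expr0n//.
  by case/andP: yab => ? ?; apply/andP; split; lra.
have : (`|D x| / 2) ^+ 2 * (b - a) <= 0.
  rewrite -z -itg_cst ?(ltW ab)//; apply: le_itg; [exact: intble_cst|exact: L2on_sqr|].
  move=> y /andP[ay yb]; rewrite -(real_normK (num_real (D y))) ler_sqr ?nnegrE ?divr_ge0//.
  have := H y; rewrite /= in_itv/= => /(_ ltac:(apply/andP; split; lra)).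
  move=> /(_ ltac:(rewrite ltr_norml; apply/andP; split; lra)); rewrite /absR -/(D y) -/(D x).
  have := ler_normB (D y) (D y - D x); rewrite opprB addrC subrK; lra.
rewrite leNgt => /negP; apply; rewrite mulr_gt0 ?exprn_gt0 ?subr_gt0//; lra.
Qed.

Lemma is_prim_ae a b F g g' : is_prim a b F g -> L2on a b g' ->
  {ae leb, forall x, a <= x <= b -> g x = g' x} -> is_prim a b F g'.
Proof.
move=> [g2 Fg] g'2 gg'; split => // x /andP[ax xb]; rewrite (Fg x) ?ax//.
congr (_ + _); apply: ae_eq_itg; first by case: (L2on_sub (lexx a) xb g2).
by apply: aeS gg' => y h /andP[ay yx]; apply: h; rewrite ay (le_trans yx).
Qed.

(** The integrals of g and g' over any interval are increments of F and F'. *)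
Lemma prim_unique L F F' g g' : 0 < L -> is_prim 0 L F g -> is_prim 0 L F' g' ->
  {ae leb, forall x, 0 <= x <= L -> F x = F' x} ->
  (forall x, 0 <= x <= L -> F x = F' x) /\ {ae leb, forall x, 0 <= x <= L -> g x = g' x}.
Proof.
move=> L0 pF pF' FF'.
have E := cont_ae_eq L0 (is_prim_cont pF) (is_prim_cont pF') FF'; split => //.
have g2 := pF.1; have g'2 := pF'.1.
suff : {ae leb, forall x, 0 <= x <= L -> g x - g' x = 0}.
  by apply: aeS => x h xL; have := h xL; lra.
apply: ae_zero_of_intervals => //; first exact: L2onB.
move=> a b a0 ab bL; rewrite itgB.
- by rewrite -(is_prim_diff pF a0 ab bL) -(is_prim_diff pF' a0 ab bL) !E; lra.
- by apply: intble_sub (L2on_int g2).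
- by apply: intble_sub (L2on_int g'2).
Qed.

Variable L : R.
Hypothesis L0 : 0 < L.

Lemma crep_eq (f F : R -> R^o) : continuous_in absR `[0, L] F ->
  {ae leb, forall x, 0 <= x <= L -> f x = F x} ->
  forall x, 0 <= x <= L -> crep L f x = F x.
Proof.
move=> cF fF; rewrite /crep; case: xgetP => [g _ [cg fg]|/(_ F) []]; last first.
  by split => //; apply: aeS fF => x h; rewrite in_itv.
apply: cont_ae_eq => //; apply: ae2 fg fF => x; rewrite in_itv/= => h1 h2 xL.
by rewrite -h1// h2.
Qed.

Lemma wD_spec (f g : R -> R^o) : L2 L g -> is_weak_derivative L f g ->
  L2 L (wD L f) /\ is_weak_derivative L f (wD L f).
Proof.
by move=> g2 fg; rewrite /wD; case: xgetP => [h _ []|/(_ g) []].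
Qed.

(** Whatever representative wD chooses, it agrees with g almost everywhere. *)
Lemma wD_prim (f F g : R -> R) : L2on 0 L f -> is_prim 0 L F g ->
  {ae leb, forall x, 0 <= x <= L -> f x = F x} ->
  L2on 0 L (wD L f) /\ {ae leb, forall x, 0 <= x <= L -> wD L f x = g x}.
Proof.
move=> f2 pF fF; have g2 := pF.1.
have [w2 fw] : L2 L (wD L f) /\ is_weak_derivative L f (wD L f).
  by apply: (@wD_spec f g) => // phi tphi; apply: prim_weak fF tphi.
split => //; have [F' pF' fF'] := weak_prim L0 f2 w2 fw.
suff FF' : {ae leb, forall x, 0 <= x <= L -> F' x = F x}.
  by case: (prim_unique L0 pF' pF FF').
by apply: ae2 fF fF' => x h1 h2 xL; rewrite -h1// h2.
Qed.

(** H^k seen through iterated primitives: F j stands for the derivative of order j,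
    continuous for j < k and square integrable for j = k. *)
Definition chain k (F : nat -> R -> R) :=
  (forall j, (j < k)%N -> is_prim 0 L (F j) (F j.+1)) /\ L2on 0 L (F k).

Lemma chain_L2 k F j : chain k F -> (j <= k)%N -> L2on 0 L (F j).
Proof.
move=> [H Hk]; rewrite leq_eqVlt => /predU1P[->//|jk].
by apply: cont_L2on; apply: is_prim_cont (H j jk).
Qed.

Lemma Hk_chain k (f : R -> R^o) : Hk L k f ->
  exists2 F, chain k F & {ae leb, forall x, 0 <= x <= L -> f x = F 0%N x}.
Proof.
elim: k f => [|k IH] f /=.
  by move=> f2; exists (fun=> f) => //; apply: aeW.
move=> [f2 [g [fg /[dup] hg /IH[G cG gG]]]].
have g2 : L2on 0 L g by case: k hg {IH cG} => [|k] //= [].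
have [F pF fF] := weak_prim L0 f2 g2 fg.
exists (fun j => if j is j'.+1 then G j' else F) => //; split; last by case: cG.
move=> [_|j jk]; last by case: cG => h _; apply: h.
by apply: is_prim_ae pF _ gG; apply: chain_L2 cG _.
Qed.

Lemma chain_Dw k F (f : R -> R^o) j : chain k F -> L2on 0 L f ->
  {ae leb, forall x, 0 <= x <= L -> f x = F 0%N x} -> (j <= k)%N ->
  L2on 0 L (Dw L j f) /\ {ae leb, forall x, 0 <= x <= L -> Dw L j f x = F j x}.
Proof.
move=> cF f2 fF; elim: j => [|j IH] jk; first by rewrite Dw0.
have [w2 wF] := IH (ltnW jk); have [h _] := cF; rewrite DwS.
by apply: wD_prim (h j jk) wF.
Qed.

Lemma chain_Hk k F (f : R -> R^o) : chain k F -> L2on 0 L f ->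
  {ae leb, forall x, 0 <= x <= L -> f x = F 0%N x} -> Hk L k f.
Proof.
elim: k F f => [|k IH] F f cF f2 fF //=; split => //.
exists (F 1%N); have [h ipHk] := cF; split.
  by move=> phi tphi; apply: prim_weak fF tphi => //; exact: h.
apply: (IH (fun j => F j.+1)) => //; last exact: aeW.
- by split => // j jk; apply: h.
- exact: (chain_L2 cF).
Qed.

Lemma chain_pv k F (f : R -> R^o) j : chain k F -> L2on 0 L f ->
  {ae leb, forall x, 0 <= x <= L -> f x = F 0%N x} -> (j < k)%N ->
  forall x, 0 <= x <= L -> pv L j f x = F j x.
Proof.
move=> cF f2 fF jk; rewrite pv_crep; apply: crep_eq; first by case: cF => h _; apply: is_prim_cont (h j jk).
by case: (chain_Dw cF f2 fF (ltnW jk)).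
Qed.

Lemma Hk_L2 k (f : R -> R^o) : Hk L k f -> L2on 0 L f.
Proof. by case: k => [|k] //= []. Qed.

Lemma Hk_Dw_L2 k (f : R -> R^o) j : Hk L k f -> (j <= k)%N -> L2on 0 L (Dw L j f).
Proof. by move=> hf jk; have [F cF fF] := Hk_chain hf; case: (chain_Dw cF (Hk_L2 hf) fF jk). Qed.

Lemma Hk_pv_ae k (f : R -> R^o) j : Hk L k f -> (j < k)%N ->
  {ae leb, forall x, 0 <= x <= L -> Dw L j f x = pv L j f x}.
Proof.
move=> hf jk; have [F cF fF] := Hk_chain hf.
have [_] := chain_Dw cF (Hk_L2 hf) fF (ltnW jk); apply: aeS => x h xL.
by rewrite h// (chain_pv cF (Hk_L2 hf) fF jk).
Qed.

Lemma Hk_pv_prim k (f : R -> R^o) j : Hk L k f -> (j < k)%N ->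
  is_prim 0 L (pv L j f) (Dw L j.+1 f).
Proof.
move=> hf jk; have [F cF fF] := Hk_chain hf; have f2 := Hk_L2 hf.
have [w2 wF] := chain_Dw cF f2 fF jk.
apply: (@is_prim_ae _ _ _ (F j.+1)) => //; last by apply: aeS wF => x h xL; rewrite h.
apply: (@eq_is_prim _ _ _ (F j)); last by case: cF => h _; exact: h.
  by move=> x xL; rewrite (chain_pv cF f2 fF jk).
exact: ltW.
Qed.

Lemma Hk_le k l (f : R -> R^o) : (l <= k)%N -> Hk L k f -> Hk L l f.
Proof.
move=> lk hf; have [F cF fF] := Hk_chain hf.
apply: (@chain_Hk l F) => //; last exact: Hk_L2 hf; split; last exact: chain_L2 cF _.
by move=> j jl; case: cF => h _; apply: h; apply: leq_trans lk.
Qed.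

Lemma chain_lin k F G a : chain k F -> chain k G ->
  chain k (fun j x => a * F j x + G j x).
Proof.
move=> [hF lF] [hG lG]; split; last by apply: L2onD => //; exact: L2onZ.
by move=> j jk; apply: is_prim_lin; [exact: hF|exact: hG].
Qed.

(** wDn and value involve choices, hence are not linear on the nose; they are up to
    null sets, and at every point, because chains can be combined linearly. *)
Lemma Hk_lin_full k a (f g : R -> R^o) : Hk L k f -> Hk L k g ->
  [/\ Hk L k (a *: f + g),
      forall j, (j <= k)%N -> {ae leb, forall x, 0 <= x <= L ->
         Dw L j (a *: f + g) x = a * Dw L j f x + Dw L j g x} &
      forall j x, (j < k)%N -> 0 <= x <= L ->
         pv L j (a *: f + g) x = a * pv L j f x + pv L j g x].
Proof.
move=> hf hg; have [F cF fF] := Hk_chain hf; have [G cG gG] := Hk_chain hg.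
have cH := chain_lin a cF cG.
have f2 := Hk_L2 hf; have g2 := Hk_L2 hg.
have h2 : L2on 0 L (a *: f + g).
  by have := L2onD (L2onZ a f2) g2.
have hH : {ae leb, forall x, 0 <= x <= L -> (a *: f + g) x = a * F 0%N x + G 0%N x}.
  by apply: ae2 fF gG => x h1 h2' xL; rewrite -h1// -h2'.
split.
- exact: chain_Hk cH h2 hH.
- move=> j jk; have [_ w1] := chain_Dw cF f2 fF jk; have [_ w2] := chain_Dw cG g2 gG jk.
  have [_ w3] := chain_Dw cH h2 hH jk.
  apply: ae2 w3 (aeI w1 w2) => x h3 [h1 h2'] xL.
  by rewrite h3// h1// h2'.
- move=> j x jk xL; rewrite (chain_pv cH h2 hH)// (chain_pv cF f2 fF)//.
  by rewrite (chain_pv cG g2 gG).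
Qed.

Lemma Hk_lin k a (f g : R -> R^o) : Hk L k f -> Hk L k g -> Hk L k (a *: f + g).
Proof. by move=> hf hg; case: (Hk_lin_full a hf hg). Qed.

Lemma Dw_lin k a (f g : R -> R^o) j : Hk L k f -> Hk L k g -> (j <= k)%N ->
  {ae leb, forall x, 0 <= x <= L -> Dw L j (a *: f + g) x = a * Dw L j f x + Dw L j g x}.
Proof. by move=> hf hg; case: (Hk_lin_full a hf hg) => _ + _; apply. Qed.

Lemma pv_lin k a (f g : R -> R^o) j x : Hk L k f -> Hk L k g -> (j < k)%N -> 0 <= x <= L ->
  pv L j (a *: f + g) x = a * pv L j f x + pv L j g x.
Proof. by move=> hf hg; case: (Hk_lin_full a hf hg) => _ _; apply. Qed.

Lemma Hk_zero k : Hk L k (0 : R -> R^o).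
Proof.
apply: (@chain_Hk k (fun _ _ => 0)); last by apply: aeW.
- by split; [move=> j _; exact: is_prim_cst|exact: L2on_cst].
- exact: L2on_cst.
Qed.

Lemma pv_zero k j x : (j < k)%N -> 0 <= x <= L -> pv L j (0 : R -> R^o) x = 0.
Proof.
move=> jk xL; have h := Hk_zero k; have := pv_lin (- 1) h h jk xL.
by rewrite scaler0 addr0; lra.
Qed.

Lemma Hk0P k (f : R -> R^o) : Hk0 L k f <-> [/\ Hk L k f, pv L 0 f 0 = 0 & pv L 1 f 0 = 0].
Proof. by rewrite pvE. Qed.

Lemma Hk0_lin k a (f g : R -> R^o) : (2 <= k)%N -> Hk0 L k f -> Hk0 L k g -> Hk0 L k (a *: f + g).
Proof.
move=> k2 /Hk0P[hf f0 f1] /Hk0P[hg g0 g1]; apply/Hk0P; split; first exact: Hk_lin.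
- by rewrite (pv_lin a hf hg) ?f0 ?g0 ?mulr0 ?addr0 ?lexx ?ltW// (ltn_trans _ k2).
- by rewrite (pv_lin a hf hg) ?f1 ?g1 ?mulr0 ?addr0 ?lexx ?ltW.
Qed.

Lemma Hk0_zero k : (2 <= k)%N -> Hk0 L k (0 : R -> R^o).
Proof.
move=> k2; apply/Hk0P; split; first exact: Hk_zero.
- by rewrite (@pv_zero k) ?lexx ?ltW// (ltn_trans _ k2).
- by rewrite (@pv_zero k) ?lexx ?ltW.
Qed.

End SobolevChain.

(** * Positive semidefinite forms *)

Section Forms.
Context {R : realType} {E : lmodType R}.
Variable X : set E.
Implicit Types (x y z : E) (b : E -> E -> R) (a c : R).

Definition lin_closed := X 0 /\ forall a x y, X x -> X y -> X (a *: x + y).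

(** Bilinearity is only required on X, since the derivatives of a representative
    outside of X are meaningless. *)
Record psd b : Prop := Psd {
  psd_lin : forall a x y z, X x -> X y -> X z -> b (a *: x + y) z = a * b x z + b y z;
  psd_sym : forall x y, X x -> X y -> b x y = b y x;
  psd_ge0 : forall x, X x -> 0 <= b x x }.

Definition snorm b x := Num.sqrt (b x x).

Hypothesis XL : lin_closed.

Lemma lcD x y : X x -> X y -> X (x + y).
Proof. by move=> hx hy; rewrite -[x]scale1r; apply: XL.2. Qed.
Lemma lcZ a x : X x -> X (a *: x).
Proof. by move=> hx; rewrite -[_ *: _]addr0; apply: XL.2 => //; exact: XL.1. Qed.
Lemma lcN x : X x -> X (- x).
Proof. by move=> hx; rewrite -scaleN1r; exact: lcZ. Qed.
Lemma lcB x y : X x -> X y -> X (x - y).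
Proof. by move=> hx hy; apply: lcD => //; exact: lcN. Qed.
Lemma lc_sum (I : Type) (s : seq I) (F : I -> E) :
  (forall i, X (F i)) -> X (\sum_(i <- s) F i).
Proof.
move=> XF; elim: s => [|i s IH]; first by rewrite big_nil; exact: XL.1.
by rewrite big_cons; exact: lcD.
Qed.

Section OneForm.
Variable b : E -> E -> R.
Hypothesis bP : psd b.

Lemma psdDl x y z : X x -> X y -> X z -> b (x + y) z = b x z + b y z.
Proof. by move=> hx hy hz; rewrite -[x in LHS]scale1r psd_lin// mul1r. Qed.
Lemma psdZl a x z : X x -> X z -> b (a *: x) z = a * b x z.
Proof.
move=> hx hz; have h0 := XL.1.
have z0 : b 0 z = 0.
  by have := psd_lin bP (-1) h0 h0 hz; rewrite scaler0 addr0; lra.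
by rewrite -[_ *: _]addr0 psd_lin// z0 addr0.
Qed.
Lemma psdBl x y z : X x -> X y -> X z -> b (x - y) z = b x z - b y z.
Proof.
move=> hx hy hz; rewrite -scaleN1r psdDl//; last exact: lcZ.
by rewrite psdZl// mulN1r.
Qed.
Lemma psdDr x y z : X x -> X y -> X z -> b x (y + z) = b x y + b x z.
Proof.
move=> hx hy hz; rewrite (psd_sym bP hx (lcD hy hz)) psdDl//.
by rewrite (psd_sym bP hy)// (psd_sym bP hz).
Qed.
Lemma psdZr a x y : X x -> X y -> b x (a *: y) = a * b x y.
Proof. by move=> hx hy; rewrite (psd_sym bP hx (lcZ a hy)) psdZl// (psd_sym bP hy). Qed.
Lemma psdBr x y z : X x -> X y -> X z -> b x (y - z) = b x y - b x z.
Proof.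
move=> hx hy hz; rewrite (psd_sym bP hx (lcB hy hz)) psdBl//.
by rewrite (psd_sym bP hy)// (psd_sym bP hz).
Qed.

Lemma snorm_ge0 x : 0 <= snorm b x. Proof. exact: sqrtr_ge0. Qed.
Lemma snorm_sqr x : X x -> snorm b x ^+ 2 = b x x.
Proof. by move=> hx; rewrite sqr_sqrtr// psd_ge0. Qed.

Lemma psd_CS x y : X x -> X y -> `|b x y| <= snorm b x * snorm b y.
Proof.
move=> hx hy; apply: le_sqrW; first by rewrite mulr_ge0 ?snorm_ge0.
rewrite exprMn !snorm_sqr//; apply: discriminant_le => [t|]; last exact: psd_ge0.
have := psd_ge0 bP (lcD hx (lcZ t hy)).
have hty := lcZ t hy; rewrite psdDl ?psdDr ?psdZl ?psdZr// ?(psd_sym bP hy hx); last exact: lcD.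
lra.
Qed.

Lemma snormD x y : X x -> X y -> snorm b (x + y) <= snorm b x + snorm b y.
Proof.
move=> hx hy; have hxy := lcD hx hy.
rewrite -ler_sqr ?nnegrE ?addr_ge0 ?snorm_ge0// snorm_sqr// psdDl ?psdDr//.
rewrite sqrrD !snorm_sqr// (psd_sym bP hy hx).
have := psd_CS hx hy; have := ler_norm (b x y); lra.
Qed.

Lemma snormZ a x : X x -> snorm b (a *: x) = `|a| * snorm b x.
Proof.
move=> hx; rewrite /snorm psdZl ?psdZr//; last exact: lcZ.
by rewrite mulrA -expr2 sqrtrM ?sqr_ge0// sqrtr_sqr.
Qed.

Lemma snormN x : X x -> snorm b (- x) = snorm b x.
Proof. by move=> hx; rewrite -scaleN1r snormZ// normrN1 mul1r. Qed.

Lemma snorm_dist x y : X x -> X y -> `|snorm b x - snorm b y| <= snorm b (x - y).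
Proof.
move=> hx hy; have h1 := snormD (lcB hx hy) hy; rewrite subrK in h1.
have h2 := snormD (lcB hy hx) hx; rewrite subrK in h2.
have h3 : snorm b (y - x) = snorm b (x - y) by rewrite -(snormN (lcB hx hy)) opprB.
by rewrite ler_norml; apply/andP; split; lra.
Qed.

Lemma snorm0 : snorm b 0 = 0.
Proof. by rewrite -(scale0r 0) snormZ ?normr0 ?mul0r//; exact: XL.1. Qed.

End OneForm.

Lemma psd_add b1 b2 : psd b1 -> psd b2 -> psd (fun x y => b1 x y + b2 x y).
Proof.
move=> h1 h2; split.
- by move=> a x y z hx hy hz; rewrite !psd_lin//; ring.
- by move=> x y hx hy; rewrite (psd_sym h1 hx)// (psd_sym h2 hx).
- by move=> x hx; rewrite addr_ge0 ?psd_ge0.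
Qed.

Lemma psd_scale b1 c : 0 <= c -> psd b1 -> psd (fun x y => c * b1 x y).
Proof.
move=> c0 h1; split.
- by move=> a x y z hx hy hz; rewrite !psd_lin//; ring.
- by move=> x y hx hy; rewrite (psd_sym h1 hx).
- by move=> x hx; rewrite mulr_ge0 ?psd_ge0.
Qed.

Lemma psd_rank1 (l : E -> R) : (forall a x y, X x -> X y -> l (a *: x + y) = a * l x + l y) ->
  psd (fun x y => l x * l y).
Proof.
move=> hl; split.
- by move=> a x y z hx hy hz; rewrite hl//; ring.
- by move=> x y _ _; rewrite mulrC.
- by move=> x _; rewrite -expr2 sqr_ge0.
Qed.

Definition bounded_by (N : E -> R) b c := forall x y, X x -> X y -> `|b x y| <= c * (N x * N y).

Lemma bounded_psd b b' c : psd b -> psd b' -> 0 <= c ->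
  (forall x, X x -> b x x <= c * b' x x) -> bounded_by (snorm b') b c.
Proof.
move=> hb hb' c0 H x y hx hy; apply: le_trans (psd_CS hb hx hy) _.
have k z : X z -> snorm b z <= Num.sqrt c * snorm b' z.
  by move=> hz; rewrite /snorm -sqrtrM//; apply: ler_wsqrtr; exact: H.
apply: le_trans (ler_pM (snorm_ge0 _ _) (snorm_ge0 _ _) (k x hx) (k y hy)) _.
by rewrite mulrACA -expr2 sqr_sqrtr.
Qed.

Section Limits.
Context {T : Type} (F : set_system T) {FF : Filter F}.

Definition cvg_semi (N : E -> R) (f : T -> E) (x : E) := (fun t => N (f t - x)) @ F --> (0 : R).

Lemma squeeze0 (f g : T -> R) : (\forall t \near F, `|f t| <= g t) -> g @ F --> (0 : R) ->
  f @ F --> (0 : R).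
Proof.
move=> fg g0; apply/cvgr0Pnorm_lt => e e0; move/cvgr0Pnorm_lt : g0 => /(_ e e0).
by apply: filterS2 fg => t h1 h2; apply: le_lt_trans h1 (le_lt_trans (ler_norm _) h2).
Qed.

Lemma cvg_form b' b c f g x y : psd b' -> psd b -> bounded_by (snorm b') b c ->
  X x -> X y -> (\forall t \near F, X (f t)) -> (\forall t \near F, X (g t)) ->
  cvg_semi (snorm b') f x -> cvg_semi (snorm b') g y -> (fun t => b (f t) (g t)) @ F --> b x y.
Proof.
move=> hb' hb bd Xx Xy Xf Xg fx gy.
apply/subr_cvg0 => /=.
pose N := snorm b'.
apply: (@squeeze0 _ (fun t => `|c| * (N (f t - x) * N (g t - y) + N (f t - x) * N y + N x * N (g t - y)))).
  apply: filterS2 Xf Xg => t Xft Xgt.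
  have h1 := lcB Xft Xx; have h2 := lcB Xgt Xy.
  have -> : b (f t) (g t) - b x y = b (f t - x) (g t - y) + b (f t - x) y + b x (g t - y).
    rewrite (psdBl hb Xft Xx h2) (psdBl hb Xft Xx Xy) (psdBr hb Xft Xgt Xy) (psdBr hb Xx Xgt Xy); ring.
  have k z w : X z -> X w -> `|b z w| <= `|c| * (N z * N w).
    move=> hz hw; apply: le_trans (bd z w hz hw) _.
    by rewrite ler_wpM2r ?mulr_ge0 ?snorm_ge0// ler_norm.
  rewrite !mulrDr; apply: le_trans (ler_normD _ _) _; apply: lerD; last exact: k.
  by apply: le_trans (ler_normD _ _) _; apply: lerD; exact: k.
rewrite -(mulr0 `|c|); apply: cvgM; first exact: cvg_cst.
rewrite -(addr0 0); apply: cvgD; last by rewrite -(mulr0 (N x)); apply: cvgM => //; exact: cvg_cst.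
rewrite -(addr0 0); apply: cvgD; last by rewrite -(mul0r (N y)); apply: cvgM => //; exact: cvg_cst.
by rewrite -(mulr0 0); apply: cvgM.
Qed.

Lemma cvg_semi_cst b x : psd b -> X x -> cvg_semi (snorm b) (fun=> x) x.
Proof. by move=> hb hx; rewrite /cvg_semi subrr snorm0//; exact: cvg_cst. Qed.

Lemma cvg_semi_lin b f g x y a : psd b -> X x -> X y -> (\forall t \near F, X (f t)) ->
  (\forall t \near F, X (g t)) -> cvg_semi (snorm b) f x -> cvg_semi (snorm b) g y ->
  cvg_semi (snorm b) (fun t => a *: f t + g t) (a *: x + y).
Proof.
move=> hb Xx Xy Xf Xg fx gy; apply: (@squeeze0 _ (fun t => `|a| * snorm b (f t - x) + snorm b (g t - y))).
  apply: filterS2 Xf Xg => t Xft Xgt; rewrite ger0_norm ?snorm_ge0//.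
  have -> : a *: f t + g t - (a *: x + y) = a *: (f t - x) + (g t - y).
    by rewrite scalerBr opprD addrACA.
  have h1 := lcB Xft Xx; have h2 := lcB Xgt Xy.
  by apply: le_trans (snormD hb (lcZ a h1) h2) _; rewrite snormZ.
rewrite -(addr0 0); apply: cvgD => //.
by rewrite -(mulr0 `|a|); apply: cvgM => //; exact: cvg_cst.
Qed.

End Limits.

End Forms.

(** * Forms and point values on Sobolev spaces *)

Section SobolevForms.
Context {R : realType}.
Local Notation leb := (@lebesgue_measure R).
Local Notation Fn := (R -> R^o).
Variable L : R.
Hypothesis L0 : 0 < L.
Implicit Types (f g : Fn).

Lemma lc_Hk k : lin_closed (Hk L k).
Proof. by split; [exact: Hk_zero|move=> a x y; exact: Hk_lin]. Qed.

Lemma lc_Hk0 k : (2 <= k)%N -> lin_closed (Hk0 L k).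
Proof. by move=> k2; split; [exact: Hk0_zero|move=> a x y; exact: Hk0_lin]. Qed.

Definition wtform (om : R -> R) j f g := itg 0 L (fun x => om x * Dw L j f x * Dw L j g x).

Lemma wtform_int (om : R -> R) j k f g : continuous_in absR `[0, L] om -> (j <= k)%N -> Hk L k f -> Hk L k g ->
  intble 0 L (fun x => om x * Dw L j f x * Dw L j g x).
Proof.
move=> com jk hf hg; apply: L2on_mul; last exact: Hk_Dw_L2 hg jk.
exact: cont_L2mul com (Hk_Dw_L2 L0 hf jk).
Qed.

Lemma psd_wtform (om : R -> R) j k : continuous_in absR `[0, L] om ->
  (forall x, 0 <= x <= L -> 0 <= om x) -> (j <= k)%N -> psd (Hk L k) (wtform om j).
Proof.
move=> com om0 jk; split.
- move=> a f g h hf hg hh; rewrite /wtform.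
  have i1 := wtform_int com jk hf hh; have i2 := wtform_int com jk hg hh.
  rewrite -itgZ// -itgD//; last exact: intbleZ.
  apply: ae_eq_itg.
    by apply: intble_meas; apply: wtform_int com jk _ hh; exact: Hk_lin.
  by apply: aeS (Dw_lin L0 a hf hg jk) => x E xL; rewrite E//; ring.
- by move=> f g hf hg; apply: eq_itg => x _; ring.
- move=> f hf; apply: itg_ge0 => x xL; rewrite -mulrA mulr_ge0 ?om0//.
  by rewrite -expr2 sqr_ge0.
Qed.

Lemma wtform_le (om : R -> R) K j f k : continuous_in absR `[0, L] om -> (j <= k)%N -> Hk L k f ->
  (forall x, 0 <= x <= L -> om x <= K) -> wtform om j f f <= K * nrm2 0 L (Dw L j f) ^+ 2.
Proof.
move=> com jk hf omK; rewrite nrm2_sqr -itgZ; last by apply: L2on_sqr; exact: Hk_Dw_L2 hf jk.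
apply: le_itg; first by apply: (wtform_int com jk).
  by apply: intbleZ; apply: L2on_sqr; exact: Hk_Dw_L2 hf jk.
by move=> x xL; rewrite -mulrA -expr2 ler_wpM2r ?sqr_ge0// omK.
Qed.

Definition ipHk k f g := \sum_(j < k.+1) itg 0 L (fun x => Dw L j f x * Dw L j g x).

Lemma psd_D j k : (j <= k)%N -> psd (Hk L k) (fun f g => itg 0 L (fun x => Dw L j f x * Dw L j g x)).
Proof.
move=> jk; have := psd_wtform (@cont_cst R 0 L 1) (fun _ _ => ler01) jk.
rewrite /wtform; congr psd; apply/funext => f; apply/funext => g; apply: eq_itg => x _.
by rewrite mul1r.
Qed.

Lemma psd_sum (E : lmodType R) (X : set E) (n : nat) (F : 'I_n -> E -> E -> R) :
  (forall i, psd X (F i)) -> psd X (fun x y => \sum_(i < n) F i x y).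
Proof.
move=> h; split.
- move=> a x y z hx hy hz; rewrite mulr_sumr -big_split; apply: eq_bigr => i _; exact: psd_lin.
- by move=> x y hx hy; apply: eq_bigr => i _; exact: psd_sym.
- by move=> x hx; apply: sumr_ge0 => i _; exact: psd_ge0.
Qed.

Lemma psd_ipHk k : psd (Hk L k) (ipHk k).
Proof. by apply: psd_sum => i; apply: psd_D; rewrite -ltnS. Qed.

Lemma psd_subset (E : lmodType R) (X Y : set E) b : Y `<=` X -> psd X b -> psd Y b.
Proof.
move=> YX [h1 h2 h3]; split.
- by move=> a x y z /YX hx /YX hy /YX hz; exact: h1.
- by move=> x y /YX hx /YX hy; exact: h2.
- by move=> x /YX; exact: h3.
Qed.

Lemma normHkE k : normHk L k = snorm (ipHk k).
Proof.
apply/funext => f; rewrite /normHk /snorm /ipHk DwE; by [].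
Qed.

Lemma normHk_ge0 k f : 0 <= normHk L k f. Proof. exact: sqrtr_ge0. Qed.

Lemma nrm2_le_normHk k j f : (j <= k)%N -> nrm2 0 L (Dw L j f) <= normHk L k f.
Proof.
move=> jk; rewrite DwE; apply: ler_wsqrtr; rewrite (bigD1 (Ordinal (jk : (j < k.+1)%N)))//= lerDl.
by apply: sumr_ge0 => i _; apply: itg_ge0 => x _; exact: sqr_ge0.
Qed.

Lemma normHk_le k l f : (l <= k)%N -> normHk L l f <= normHk L k f.
Proof.
move=> lk; apply: ler_wsqrtr.
rewrite -!(big_mkord xpredT (fun j => itg 0 L (fun x => wDn L j f x ^+ 2))).
rewrite (@big_cat_nat _ _ _ l.+1 0 k.+1)//= lerDl.
by apply: sumr_ge0 => i _; apply: itg_ge0 => x _; exact: sqr_ge0.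
Qed.

(** The one-dimensional Sobolev inequality: a value differs from the mean of |F| by at
    most the oscillation of F, which the Hoelder estimate bounds. *)
Lemma prim_sup (F g : R -> R) x : is_prim 0 L F g -> 0 <= x <= L ->
  `|F x| <= Num.sqrt L / L * nrm2 0 L F + Num.sqrt L * nrm2 0 L g.
Proof.
move=> pF /andP[x0 xL]; have cF := is_prim_cont pF; have F2 := cont_L2on cF.
have H y : 0 <= y <= L -> `|F x| <= `|F y| + Num.sqrt L * nrm2 0 L g.
  move=> /andP[y0 yL].
  have k s t : 0 <= s -> s <= t -> t <= L -> `|F t - F s| <= Num.sqrt L * nrm2 0 L g.
    move=> s0 st tL; apply: le_trans (is_prim_holder pF s0 st tL) _.
    by rewrite ler_wpM2r ?nrm2_ge0// ler_wsqrtr//; lra.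
  have : `|F x - F y| <= Num.sqrt L * nrm2 0 L g.
    by have [xy|/ltW yx] := leP x y; [rewrite distrC|]; apply: k.
  have := ler_normD (F x - F y) (F y); rewrite subrK; lra.
have : itg 0 L (fun=> `|F x|) <= itg 0 L (fun y => `|F y| + Num.sqrt L * nrm2 0 L g).
  apply: le_itg => //; first exact: intble_cst.
  by apply: intbleD; [apply: intble_norm; exact: L2on_int|exact: intble_cst].
rewrite itgD; [|by apply: intble_norm; exact: L2on_int|exact: intble_cst].
rewrite !itg_cst ?(ltW L0)// subr0 => h.
have := itg_L1L2 (ltW L0) F2; rewrite subr0 => h2.
rewrite -(ler_pM2r L0); apply: le_trans h _.
have -> : (Num.sqrt L / L * nrm2 0 L F + Num.sqrt L * nrm2 0 L g) * L =
   Num.sqrt L * nrm2 0 L F + Num.sqrt L * nrm2 0 L g * L by field; rewrite gt_eqF.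
by rewrite lerD2r.
Qed.

Lemma nrm2_ae a b f g : L2on a b f -> {ae leb, forall x, a <= x <= b -> f x = g x} ->
  nrm2 a b f = nrm2 a b g.
Proof.
move=> f2 fg; congr Num.sqrt; apply: ae_eq_itg; first by apply: measurable_funX; case: f2.
by apply: aeS fg => x h xab; rewrite h.
Qed.

Definition valbnd : R := Num.sqrt L / L + Num.sqrt L.
Lemma valbnd_ge0 : 0 <= valbnd.
Proof. by rewrite addr_ge0 ?divr_ge0 ?sqrtr_ge0// ltW. Qed.

(** Hence point values of derivatives are continuous functionals. *)
Lemma value_bnd k j f x : (j < k)%N -> Hk L k f -> 0 <= x <= L ->
  `|pv L j f x| <= valbnd * normHk L k f.
Proof.
move=> jk hf xL; apply: le_trans (prim_sup (Hk_pv_prim L0 hf jk) xL) _.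
rewrite -(nrm2_ae (Hk_Dw_L2 L0 hf (ltnW jk)) (Hk_pv_ae L0 hf jk)) mulrDl.
have s0 := sqrtr_ge0 L.
apply: lerD; (apply: ler_wpM2l; last by apply: nrm2_le_normHk => //; exact: ltnW).
  by rewrite divr_ge0// ltW.
by [].
Qed.

Lemma psd_value k j x : (j < k)%N -> 0 <= x <= L ->
  psd (Hk L k) (fun f g => pv L j f x * pv L j g x).
Proof. by move=> jk xL; apply: psd_rank1 => a f g hf hg; exact: (pv_lin L0 a hf hg jk xL). Qed.

End SobolevForms.

(** * Cubic Hermite interpolation *)

Section Hermite.
Context {R : realType}.
Local Notation leb := (@lebesgue_measure R).
Local Notation Fn := (R -> R^o).
Implicit Types (a b c d t s x : R) (f g : Fn) (p : {poly R}).

Lemma L2on_sum (I : Type) (l : seq I) a b (F : I -> R -> R) :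
  (forall i, L2on a b (F i)) -> L2on a b (fun x => \sum_(i <- l) F i x).
Proof.
move=> F2; elim: l => [|i l IH].
  by under eq_fun do rewrite big_nil; exact: L2on_cst.
by under eq_fun do rewrite big_cons; exact: L2onD.
Qed.

Lemma poly_prim a b p : a <= b -> is_prim a b (horner p) (horner p^`()).
Proof.
move=> ab; have cp : continuous (horner p^`()) by exact: continuous_horner.
split; first by apply: cont_L2on; apply/continuous_in_within; exact: continuous_subspaceT.
move=> x /andP[ax _]; rewrite derivE in cp *.
by rewrite (FTC2 ax (@derivable_horner R p) cp); lra.
Qed.

Lemma poly_diff_quot p t e : 0 < e -> exists2 d : R, 0 < d & forall s, s != t -> `|s - t| < d ->
  `|(s - t)^-1 * (p.[s] - p.[t]) - p^`().[t]| < e.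
Proof.
move=> e0; have dp := @derivable_horner R p t.
have : (fun h => h^-1 *: ((horner p \o shift t) (h *: 1) - p.[t])) @ 0^' --> p^`().[t].
  by rewrite derivE derive1E; exact: dp.
move=> /cvgrPdist_lt /(_ e e0) /nbhs_ballP[d /= d0 H]; exists d => // s st sd.
have := H (s - t); rewrite /ball/= sub0r normrN => /(_ sd); rewrite subr_eq0 => /(_ st).
by rewrite /GRing.scale/= mulr1 subrK distrC.
Qed.

(** The derivative on [0, L] is determined inside a single cell, from one side at
    its end points. *)
Lemma deriv_on_cell L a b (w w' : Fn) p : derivative_in absR `[0, L] w w' ->
  0 <= a -> a < b -> b <= L -> (forall x, a <= x <= b -> w x = p.[x]) ->
  forall x, a <= x <= b -> w' x = p^`().[x].
Proof.
move=> /(derivative_in_epsP _ _ _ absR_ge0) dw a0 ab bL wp t /andP[at_ tb].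
apply/eqP; rewrite -subr_eq0 -normr_le0; apply/ler_addgt0Pr => e e0; rewrite add0r.
have ti : `[0, L]%classic t by rewrite /= in_itv/=; apply/andP; split; lra.
have [d1 d10 H1] := dw t ti (e / 2) ltac:(lra).
have [d2 d20 H2] := @poly_diff_quot p t (e / 2) ltac:(lra).
pose d := Num.min (Num.min d1 d2) (b - a).
have d0 : 0 < d by rewrite !lt_min d10 d20 subr_gt0.
have [dd1 dd2 dba] : [/\ d <= d1, d <= d2 & d <= b - a] by split; rewrite /d !ge_min lexx ?orbT.
have [s [/andP[as_ sb] st sd]] : exists s, [/\ a <= s <= b, s != t & `|s - t| < d].
  have [tm|mt] := leP t ((a + b) / 2).
    exists (t + d / 2); split; first by apply/andP; split; lra.
      by rewrite -subr_eq0 addrAC subrr add0r gt_eqF//; lra.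
    by rewrite addrAC subrr add0r ger0_norm; lra.
  exists (t - d / 2); split; first by apply/andP; split; lra.
    by rewrite -subr_eq0 addrAC subrr add0r oppr_eq0 gt_eqF//; lra.
  by rewrite addrAC subrr add0r normrN ger0_norm; lra.
have h2 := H2 s st (lt_le_trans sd dd2).
have := H1 s; rewrite /= in_itv/= => /(_ ltac:(apply/andP; split; lra) st (lt_le_trans sd dd1)).
rewrite /absR /GRing.scale/= (wp s) ?as_// (wp t) ?at_// => h1.
have -> : w' t - p^`().[t] = ((s - t)^-1 * (p.[s] - p.[t]) - p^`().[t]) - ((s - t)^-1 * (p.[s] - p.[t]) - w' t) by ring.
by apply: le_trans (ler_normB _ _) _; lra.
Qed.

Variables (r : nat) (B : @beam R r) (P : nat).
Let L := bL B.
Hypothesis L0 : 0 < L.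
Hypothesis P0 : (0 < P)%N.
Let grid' := grid L P.
Let h := L / P%:R.

Lemma h_gt0 : 0 < h. Proof. by rewrite divr_gt0// ltr0n. Qed.
Lemma gridSh m : grid' m.+1 = grid' m + h. Proof. exact: gridS. Qed.
Lemma grid_lt m : grid' m < grid' m.+1. Proof. by rewrite gridSh ltrDl h_gt0. Qed.
Lemma grid_in m : (m <= P)%N -> 0 <= grid' m <= L.
Proof. by move=> mP; rewrite grid_ge0// grid_leL. Qed.

Lemma is_prim_glue (F G : R -> R) : L2on 0 L G ->
  (forall m, (m < P)%N -> is_prim (grid' m) (grid' m.+1) F G) -> is_prim 0 L F G.
Proof.
move=> G2 H; split => // x xL.
suff K m : (m <= P)%N -> forall x, 0 <= x <= grid' m -> F x = F 0 + itg 0 x G.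
  by apply: (K P) => //; rewrite /grid' gridn.
elim: m => [_ y yx|m IH mP y /andP[y0 ym]].
  move: yx.
  rewrite /grid' grid0 => /andP[y0 yy]; have -> : y = 0 by apply/le_anti; rewrite y0 yy.
  by rewrite itg_pt addr0.
have [ymm|/ltW my] := leP y (grid' m); first by apply: (IH (ltnW mP)); rewrite y0.
have m0 : 0 <= grid' m by exact: grid_ge0.
have [_ Hm] := H m mP; rewrite Hm ?my// (IH (ltnW mP)) ?m0 ?lexx//.
rewrite (@itg_split _ 0 y (grid' m))// ?addrA//.
by apply: intble_sub (L2on_int G2) => //; apply: le_trans ym _; exact: grid_leL.
Qed.

(** The piecewise second derivative is only defined up to the nodes, where w'' may
    jump; the half-open cells make the choice. *)
Lemma Wh_chain w : Wh B P w -> exists2 F : nat -> R -> R, chain L 2 F &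
  [/\ forall x, F 0%N x = w x, F 0%N 0 = 0, F 1%N 0 = 0 &
  forall m, (m < P)%N -> exists p, [/\ (size p <= 4)%N,
    forall x, grid' m <= x <= grid' m.+1 -> F 0%N x = p.[x],
    forall x, grid' m <= x <= grid' m.+1 -> F 1%N x = p^`().[x] &
    forall x, grid' m <= x < grid' m.+1 -> F 2%N x = p^`()^`().[x]]].
Proof.
move=> [[w' [dw cw' w0 w'0]] H].
have /choice[pm pmP] : forall m, exists p, (m < P)%N -> (size p <= 4)%N /\
    forall x, grid' m <= x <= grid' m.+1 -> w x = p.[x].
  move=> m; have [mP|] := boolP (m < P)%N; last by exists 0.
  have [p [ps pw]] := H m mP; exists p => _; split => // x xm; apply: pw; by rewrite in_itv.
have w'E m : (m < P)%N -> forall x, grid' m <= x <= grid' m.+1 -> w' x = (pm m)^`().[x].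
  move=> mP; have [_ wp] := pmP m mP; apply: (deriv_on_cell dw) wp.
  - exact: grid_ge0.
  - exact: grid_lt.
  - exact: grid_leL.
pose g x := \sum_(m < P) (pm m)^`()^`().[x] * \1_(`[grid' m, grid' m.+1[) x.
have gE m x : (m < P)%N -> grid' m <= x < grid' m.+1 -> g x = (pm m)^`()^`().[x].
  move=> mP xm; rewrite /g (bigD1 (Ordinal mP))//= big1 ?addr0.
    by rewrite indicE mem_set ?mulr1//= in_itv.
  move=> j ji; rewrite indicE memNset ?mulr0//= in_itv/= => /andP[h1 h2].
  case/andP: xm => h3 h4; have [ij|ij|ij] := ltngtP m j; last by move/eqP: ji; apply; apply/val_inj.
  - by have := le_grid P L0 ij; rewrite -!/(grid' _) => h5; have := lt_le_trans h4 h5; rewrite ltNge h1.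
  - by have := le_grid P L0 ij; rewrite -!/(grid' _) => h5; have := lt_le_trans h2 h5; rewrite ltNge h3.
have g2 : L2on 0 L g.
  have L2p p : L2on 0 L (horner p).
    by apply: cont_L2on; apply/continuous_in_within; apply: continuous_subspaceT; exact: continuous_horner.
  have L2t m : L2on 0 L (fun x => (pm m)^`()^`().[x] * \1_(`[grid' m, grid' m.+1[) x).
    have := @L2onMb R 0 L (\1_(`[grid' m, grid' m.+1[)) (horner (pm m)^`()^`()) 1.
    rewrite (_ : (fun x => _ * _) = (fun x => (pm m)^`()^`().[x] * \1_(`[grid' m, grid' m.+1[) x)); last first.
      by apply/funext => x; rewrite mulrC.
    apply; [exact: measurable_indic| |exact: L2p].
    by move=> x _; rewrite indicE; case: (_ \in _); rewrite ?normr1 ?normr0.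
  by apply: L2on_sum.
have c1 : is_prim 0 L w' g.
  apply: is_prim_glue => // m mP.
  have mm := ltW (grid_lt m).
  apply: (@eq_is_prim _ _ _ (horner (pm m)^`())) => //; first by move=> x xm; rewrite (w'E m).
  apply: is_prim_ae (poly_prim _ mm) _ _; first exact: (L2on_cell L0 mP g2).
  apply: aeS (ae_neq (grid' m.+1)) => x xn /andP[x1 x2]; rewrite (gE m)// x1.
  by rewrite lt_neqAle xn.
have w'2 : L2on 0 L w' by exact: cont_L2on.
have c0 : is_prim 0 L w w'.
  apply: is_prim_glue => // m mP; have mm := ltW (grid_lt m); have [_ wp] := pmP m mP.
  apply: (@eq_is_prim _ _ _ (horner (pm m))) => //; first by move=> x xm; rewrite wp.
  apply: is_prim_ae (poly_prim _ mm) _ _; first exact: (L2on_cell L0 mP w'2).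
  by apply: aeW => x xm; rewrite (w'E m).
exists (fun j => if j is 0%N then w else if j is 1%N then w' else g).
  by split => // -[|[|j]].
split => // m mP; have [ps wp] := pmP m mP; exists (pm m); split => //.
- by move=> x xm; rewrite (w'E m).
- by move=> x xm; rewrite (gE m).
Qed.

Lemma Wh_spec w : Wh B P w -> [/\ Hk0 L 2 w, forall x, 0 <= x <= L -> pv L 0 w x = w x &
  forall m, (m < P)%N -> exists p, [/\ (size p <= 4)%N,
    forall x, grid' m <= x <= grid' m.+1 -> pv L 0 w x = p.[x],
    forall x, grid' m <= x <= grid' m.+1 -> pv L 1 w x = p^`().[x] &
    {ae leb, forall x, grid' m <= x <= grid' m.+1 -> Dw L 2 w x = p^`()^`().[x]}]].
Proof.
move=> /Wh_chain[F cF [F0 F00 F10 Fp]].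
have FE : w = F 0%N by apply/funext => x; rewrite F0.
have w2 : L2on 0 L w by rewrite FE; exact: (chain_L2 cF).
have wF : {ae leb, forall x, 0 <= x <= L -> w x = F 0%N x} by apply: aeW => x _; rewrite F0.
have hw := chain_Hk L0 cF w2 wF.
have v0 := chain_pv L0 cF w2 wF (isT : (0 < 2)%N).
have v1 := chain_pv L0 cF w2 wF (isT : (1 < 2)%N).
have [_ d2] := chain_Dw L0 cF w2 wF (isT : (2 <= 2)%N).
split.
- by apply/Hk0P; split => //; rewrite ?v0 ?v1 ?lexx ?ltW.
- by move=> x xL; rewrite v0// F0.
move=> m mP; have [p [ps p0 p1 p2]] := Fp m mP; exists p.
have sub x : grid' m <= x <= grid' m.+1 -> 0 <= x <= L.
  have := grid_in (ltnW mP); have := grid_in mP => /andP[? ?] /andP[? ?] /andP[? ?].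
  by apply/andP; split; lra.
split => //.
- by move=> x xm; rewrite v0 ?sub// p0.
- by move=> x xm; rewrite v1 ?sub// p1.
- apply: ae2 d2 (ae_neq (grid' m.+1)) => x h1 xn xm; rewrite h1 ?sub// p2//.
  by case/andP: xm => -> x2 /=; rewrite lt_neqAle xn.
Qed.

Lemma Wh_lin a w1 w2 : Wh B P w1 -> Wh B P w2 -> Wh B P (a *: w1 + w2).
Proof.
move=> [[w1' [d1 c1 z1 z1']] H1] [[w2' [d2 c2 z2 z2']] H2]; split.
  exists (a *: w1' + w2'); split.
  - apply/(derivative_in_epsP _ _ _ absR_ge0) => t tL e e0.
    pose e' := e / (`|a| + 1) / 2; have a1 : 0 < `|a| + 1 by rewrite ltr_wpDl.
    have e'0 : 0 < e' by rewrite !divr_gt0.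
    move/(derivative_in_epsP _ _ _ absR_ge0) : d1 => /(_ t tL e' e'0) [d1 d10 K1].
    move/(derivative_in_epsP _ _ _ absR_ge0) : d2 => /(_ t tL (e / 2) ltac:(lra)) [d2 d20 K2].
    exists (Num.min d1 d2); first by rewrite lt_min d10.
    move=> s sL st; rewrite lt_min => /andP[sd1 sd2].
    have := K1 s sL st sd1; have := K2 s sL st sd2; rewrite /absR => k2 k1.
    have -> : (s - t)^-1 *: ((a *: w1 + w2) s - (a *: w1 + w2) t) - (a *: w1' + w2') t =
      a * ((s - t)^-1 *: (w1 s - w1 t) - w1' t) + ((s - t)^-1 *: (w2 s - w2 t) - w2' t).
      change ((s - t)^-1 * (a * w1 s + w2 s - (a * w1 t + w2 t)) - (a * w1' t + w2' t) =
        a * ((s - t)^-1 * (w1 s - w1 t) - w1' t) + ((s - t)^-1 * (w2 s - w2 t) - w2' t)).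
      by ring.
    apply: le_lt_trans (ler_normD _ _) _; rewrite normrM.
    set A := `|_ - w1' t| in k1 *.
    have : `|a| * A <= e / 2.
      apply: (@le_trans _ _ (`|a| * e')); first by rewrite ler_wpM2l// ltW.
      rewrite /e' mulrC -!mulrA ler_pM2l//.
      by rewrite mulrCA ler_piMr ?invr_ge0// ler_pdivrMl// mulr1; lra.
    by move: k2; lra.
  - apply: cont_add => //; apply: cont_mul => //; exact: cont_cst.
  - by change (a * w1 0 + w2 0 = 0); rewrite z1 z2 mulr0 addr0.
  - by change (a * w1' 0 + w2' 0 = 0); rewrite z1' z2' mulr0 addr0.
move=> m mP; have [p1 [s1 e1]] := H1 m mP; have [p2 [s2 e2]] := H2 m mP.
exists (a *: p1 + p2); split.
  apply: leq_trans (size_polyD _ _) _; rewrite geq_max s2 andbT.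
  exact: leq_trans (size_scale_leq _ _) s1.
by move=> x xm; rewrite hornerD hornerZ -e1// -e2.
Qed.

Lemma Wh_zero : Wh B P (0 : Fn).
Proof.
split.
  exists (0 : Fn); split => //.
  - apply/(derivative_in_epsP _ _ _ absR_ge0) => t tL e e0; exists 1 => // s _ _ _.
    by rewrite subrr scaler0 subrr /absR normr0.
  - exact: cont_cst.
by move=> m mP; exists 0; rewrite size_poly0; split => // x _; rewrite horner0.
Qed.

Lemma lc_Wh : lin_closed (Wh B P).
Proof. by split; [exact: Wh_zero|move=> a x y; exact: Wh_lin]. Qed.

Definition node0 g := forall m, (m <= P)%N -> pv L 0 g (grid' m) = 0 /\ pv L 1 g (grid' m) = 0.

Lemma cell_prim k f j m : Hk L k f -> (j < k)%N -> (m < P)%N ->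
  is_prim (grid' m) (grid' m.+1) (pv L j f) (Dw L j.+1 f).
Proof.
move=> hf jk mP; apply: is_prim_sub (Hk_pv_prim L0 hf jk).
- exact: grid_ge0.
- exact: ltW (grid_lt m).
- exact: grid_leL.
Qed.

Lemma ae_cell (Q : R -> Prop) m : (m < P)%N -> {ae leb, forall x, 0 <= x <= L -> Q x} ->
  {ae leb, forall x, grid' m <= x <= grid' m.+1 -> Q x}.
Proof.
move=> mP; apply: aeS => x H xm; apply: H.
have := grid_in (ltnW mP); have := grid_in mP; case/andP: xm => ? ? /andP[? ?] /andP[? ?].
by apply/andP; split; lra.
Qed.

(** On each cell integrate by parts once: the boundary terms vanish with g', and q'''
    is constant there, so that its product with g' integrates to an increment of g,
    which vanishes too. *)
Lemma wh_orth g q : Hk L 2 g -> node0 g -> Wh B P q ->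
  itg 0 L (fun x => Dw L 2 g x * Dw L 2 q x) = 0.
Proof.
move=> hg ng /[dup] /Wh_spec[[hq _ _] _ qp] _.
have g2 := Hk_Dw_L2 L0 hg (leqnn 2); have q2 := Hk_Dw_L2 L0 hq (leqnn 2).
rewrite (@itg_cells R L P)//; last exact: L2on_mul.
apply: big1 => m _; have mP := ltn_ord m; rewrite -!/(grid' _).
have [p [ps _ _ p2]] := qp m mP; have mm := ltW (grid_lt m).
have G2 := L2on_cell L0 mP g2; have Q2 := L2on_cell L0 mP q2.
pose p3 := p^`()^`()^`().
have p3c : p3 = (p3`_0)%:P.
  apply: size1_polyC.
  have sd (v : {poly R}) n : (size v <= n.+1)%N -> (size v^`() <= n)%N.
    by move=> sv; apply: leq_trans (size_poly _ _) _; rewrite -ltnS; case: (size v) sv.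
  exact: (sd _ _ (sd _ _ (sd _ _ ps))).
have := is_prim_mul mm (cell_prim hg (isT : (1 < 2)%N) mP) (poly_prim p^`()^`() mm).
have [_ n1] := ng m (ltnW mP); have [_ n1'] := ng m.+1 mP.
rewrite n1 n1' !mul0r subrr => E.
have v1 : L2on (grid' m) (grid' m.+1) (pv L 1 g).
  by apply: cont_L2on; exact: is_prim_cont (cell_prim hg (isT : (1 < 2)%N) mP).
have L2p v : L2on (grid' m) (grid' m.+1) (horner v).
  by apply: cont_L2on; exact: is_prim_cont (poly_prim v mm).
move: E; rewrite itgD; [|exact: (L2on_mul G2 (L2p _))|exact: (L2on_mul v1 (L2p _))].
have -> : itg (grid' m) (grid' m.+1) (fun x => pv L 1 g x * p^`()^`()^`().[x]) = 0.
  have -> : itg (grid' m) (grid' m.+1) (fun x => pv L 1 g x * p^`()^`()^`().[x]) =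
     itg (grid' m) (grid' m.+1) (fun x => p3`_0 * pv L 1 g x).
    by apply: eq_itg => x _; rewrite -/p3 p3c hornerC coefC eqxx mulrC.
  rewrite itgZ; last exact: L2on_int.
  have [_ c0] := cell_prim hg (isT : (0 < 2)%N) mP.
  have [n0 _] := ng m (ltnW mP); have [n0' _] := ng m.+1 mP.
  have ae1 := ae_cell mP (Hk_pv_ae L0 hg (isT : (1 < 2)%N)).
  have W1 := L2on_cell L0 mP (Hk_Dw_L2 L0 hg (isT : (1 <= 2)%N)).
  rewrite -(@ae_eq_itg _ _ _ (Dw L 1 g)) //; last by case: W1.
  have := c0 (grid' m.+1); rewrite n0 n0' mm lexx add0r => /(_ isT) <-.
  by rewrite mulr0.
rewrite addr0 => <-; apply: ae_eq_itg; first by apply: intble_meas; exact: (L2on_mul G2 Q2).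
by apply: aeS p2 => x hx xm; rewrite hx.
Qed.

Lemma poincare_cell (F G : R -> R) a b : a <= b -> is_prim a b F G -> F a = 0 ->
  nrm2 a b F <= (b - a) * nrm2 a b G.
Proof.
move=> ab pF F0; have ba0 : 0 <= b - a by lra.
have F2 := cont_L2on (is_prim_cont pF).
rewrite -ler_sqr ?nnegrE ?mulr_ge0 ?nrm2_ge0// nrm2_sqr.
have -> : ((b - a) * nrm2 a b G) ^+ 2 = (b - a) * nrm2 a b G ^+ 2 * (b - a) by ring.
rewrite -(@itg_cst _ a b)//; apply: le_itg; [exact: L2on_sqr|exact: intble_cst|].
move=> x /andP[ax xb]; have := is_prim_holder pF (lexx a) ax xb; rewrite F0 subr0 => H.
rewrite -(real_normK (num_real (F x))).
apply: (@le_trans _ _ ((Num.sqrt (x - a) * nrm2 a b G) ^+ 2)).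
  by rewrite ler_sqr ?nnegrE ?mulr_ge0 ?sqrtr_ge0 ?nrm2_ge0.
rewrite exprMn sqr_sqrtr ?subr_ge0// ler_wpM2r ?sqr_ge0//; lra.
Qed.

Lemma cells_le (F G : R -> R) (c : R) : 0 <= c -> L2on 0 L F -> L2on 0 L G ->
  (forall m, (m < P)%N -> nrm2 (grid' m) (grid' m.+1) F <= c * nrm2 (grid' m) (grid' m.+1) G) ->
  nrm2 0 L F <= c * nrm2 0 L G.
Proof.
move=> c0 F2 G2 H; rewrite -ler_sqr ?nnegrE ?mulr_ge0 ?nrm2_ge0// exprMn !nrm2_sqr.
rewrite (@itg_cells R L P)//; last exact: L2on_sqr.
rewrite (@itg_cells R L P _ L0 P0 (L2on_sqr G2)) mulr_sumr; apply: ler_sum => m _.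
rewrite -!/(grid' _) -!nrm2_sqr -exprMn ler_sqr ?nnegrE ?mulr_ge0 ?nrm2_ge0//; exact: H.
Qed.

Lemma poincare g : Hk L 2 g -> node0 g -> nrm2 0 L (Dw L 1 g) <= h * nrm2 0 L (Dw L 2 g) /\
  nrm2 0 L g <= h ^+ 2 * nrm2 0 L (Dw L 2 g).
Proof.
move=> hg ng.
have g2 := Hk_Dw_L2 L0 hg (leqnn 2); have g1 := Hk_Dw_L2 L0 hg (isT : (1 <= 2)%N).
have g0 := Hk_Dw_L2 L0 hg (isT : (0 <= 2)%N).
have step j : (j < 2)%N -> nrm2 0 L (Dw L j g) <= h * nrm2 0 L (Dw L j.+1 g).
  move=> j2; apply: cells_le; [exact: ltW h_gt0|exact: Hk_Dw_L2 hg (ltnW j2)|exact: Hk_Dw_L2 hg j2|].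
  move=> m mP; have mm := ltW (grid_lt m).
  have jL := L2on_cell L0 mP (Hk_Dw_L2 L0 hg (ltnW j2)).
  rewrite (nrm2_ae jL (ae_cell mP (Hk_pv_ae L0 hg j2))).
  have hE : grid' m.+1 - grid' m = h by rewrite gridSh; ring.
  have := poincare_cell mm (cell_prim hg j2 mP); rewrite hE; apply.
  by have [n0 n1] := ng m (ltnW mP); case: j j2 {jL} => [_|[_|j]]; [exact: n0|exact: n1|].
have s0 := step 0%N isT; rewrite Dw0 in s0; have s1 := step 1%N isT; split; first exact: s1.
apply: le_trans s0 _; rewrite expr2 -mulrA ler_wpM2l; [by []|exact: ltW h_gt0|exact: s1].
Qed.

Variable w : nat -> Fn.
Hypothesis wB : hermite_basis B P w.
Local Notation Pi := (nodal_projection B P w).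

Lemma nodal_projectionE f : Pi f =
  \sum_(1 <= m < P.+1) (pv L 0 f (grid' m) *: w (2 * m - 1)%N + pv L 1 f (grid' m) *: w (2 * m)%N).
Proof.
by rewrite pvE; apply/funext => x; rewrite fct_sumE -[LHS]big_split.
Qed.

Lemma basis_Wh m : (1 <= m < P.+1)%N -> Wh B P (w (2 * m - 1)%N) /\ Wh B P (w (2 * m)%N).
Proof.
by rewrite ltnS => /wB[].
Qed.

Lemma Pi_Wh f : Wh B P (Pi f).
Proof.
rewrite nodal_projectionE big_seq_cond.
elim/big_rec : _ => [|m y]; first exact: Wh_zero.
rewrite mem_index_iota andbT => /basis_Wh[h1 h2] hy.
by apply: (lcD lc_Wh) => //; apply: Wh_lin => //; apply: (lcZ lc_Wh).
Qed.

Lemma value_nat_sum (s : seq nat) (F : nat -> Fn) j x : (j < 2)%N -> 0 <= x <= L ->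
  {in s, forall m, Hk L 2 (F m)} ->
  pv L j (\sum_(m <- s) F m) x = \sum_(m <- s) pv L j (F m) x /\ Hk L 2 (\sum_(m <- s) F m).
Proof.
move=> j2 xL; elim: s => [|m s IH] HF.
  by rewrite !big_nil; split; [exact: (pv_zero L0 j2 xL)|exact: Hk_zero].
rewrite !big_cons; have [IH1 IH2] := IH (fun k ks => HF k (mem_behead (s := m :: s) ks)).
have hm := HF m (mem_head _ _); split; last exact: (lcD (lc_Hk L0 2)).
by have := pv_lin L0 1 hm IH2 j2 xL; rewrite scale1r mul1r IH1.
Qed.

(** The basis has no function for the node 0, where f and f' vanish. *)
Lemma Pi_value f j k : Hk0 L 2 f -> (j < 2)%N -> (k <= P)%N ->
  pv L j (Pi f) (grid' k) = pv L j f (grid' k).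
Proof.
move=> /Hk0P[hf f0 f1] j2 kP; have kL := grid_in kP; rewrite nodal_projectionE.
have hw m : m \in index_iota 1 P.+1 -> Hk L 2 (w (2 * m - 1)%N) /\ Hk L 2 (w (2 * m)%N).
  by rewrite mem_index_iota => /basis_Wh[/Wh_spec[[? _ _] _ _] /Wh_spec[[? _ _] _ _]].
have [-> _] := @value_nat_sum (index_iota 1 P.+1) (fun m => pv L 0 f (grid' m) *: w (2 * m - 1)%N + pv L 1 f (grid' m) *: w (2 * m)%N) j (grid' k) j2 kL
  (fun m mi => Hk_lin L0 _ (hw m mi).1 (lcZ (lc_Hk L0 2) _ (hw m mi).2)).
have E m : m \in index_iota 1 P.+1 ->
   pv L j (pv L 0 f (grid' m) *: w (2 * m - 1)%N + pv L 1 f (grid' m) *: w (2 * m)%N) (grid' k)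
   = if m == k then pv L j f (grid' k) else 0.
  move=> mi; have [h1 h2] := hw m mi.
  rewrite (pv_lin L0 _ h1 (lcZ (lc_Hk L0 2) _ h2) j2 kL).
  have := pv_lin L0 (pv L 1 f (grid' m)) h2 (Hk_zero L0 2) j2 kL.
  rewrite addr0 (pv_zero L0 j2 kL) addr0 => ->.
  move: mi; rewrite mem_index_iota ltnS => mP; have := wB mP; rewrite -pvE => -[W1 W2 /(_ k kP)[]].
  have [_ V1 _] := Wh_spec W1; have [_ V2 _] := Wh_spec W2.
  rewrite -V1// -V2// => e1 e2 e3 e4.
  by case: j j2 => [|[|j]]// _; rewrite -/grid' ?e1 ?e2 ?e3 ?e4; case: eqP => [->|_]; rewrite ?mulr1 ?mulr0 ?addr0 ?add0r.
rewrite big_seq (eq_bigr _ E) -big_seq -big_mkcond/=.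
case: (posnP k) => [k0|k0].
  rewrite k0 /grid' grid0; have -> : pv L j f 0 = 0 by case: j j2 {E} => [_|[_|j]]; [exact: f0|exact: f1|].
  by rewrite big1_seq// => m /andP[/eqP ->]; rewrite mem_index_iota.
rewrite -big_filter (@filter_pred1_uniq _ _ k) ?iota_uniq ?big_seq1//.
by rewrite mem_index_iota ltnS kP k0.
Qed.

Lemma Pi_Hk0 f : Hk0 L 2 (Pi f).
Proof. by have [] := Wh_spec (Pi_Wh f). Qed.

Lemma err_node0 f : Hk0 L 2 f -> node0 (f - Pi f).
Proof.
move=> hf m mP; have [h2 _ _] := hf; have [p2 _ _] := Pi_Hk0 f; have mL := grid_in mP.
have H j : (j < 2)%N -> pv L j (f - Pi f) (grid' m) = 0.
  move=> j2; rewrite addrC -scaleN1r (pv_lin L0 (-1) p2 h2 j2 mL) Pi_value//; lra.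
by split; apply: H.
Qed.

Lemma err_Hk f : Hk0 L 2 f -> Hk L 2 (f - Pi f).
Proof. by move=> [h2 _ _]; have [p2 _ _] := Pi_Hk0 f; exact: (lcB (lc_Hk L0 2)). Qed.

(** By wh_orth the error is the orthogonal projection of f for the form of second
    derivatives. *)
Lemma err_stab f : Hk0 L 2 f -> nrm2 0 L (Dw L 2 (f - Pi f)) <= nrm2 0 L (Dw L 2 f).
Proof.
move=> hf; have [h2 _ _] := hf; have [p2 _ _] := Pi_Hk0 f; have e2 := err_Hk hf.
set e := f - Pi f in e2 *.
have De := Hk_Dw_L2 L0 e2 (leqnn 2); have Df := Hk_Dw_L2 L0 h2 (leqnn 2).
have Dp := Hk_Dw_L2 L0 p2 (leqnn 2).
have E : nrm2 0 L (Dw L 2 e) ^+ 2 = itg 0 L (fun x => Dw L 2 e x * Dw L 2 f x).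
  rewrite nrm2_sqr; have := wh_orth e2 (err_node0 hf) (Pi_Wh f).
  move=> o; rewrite -[RHS]subr0 -[X in _ = _ - X]o -itgB; [|exact: (L2on_mul De Df)|exact: (L2on_mul De Dp)].
  apply: ae_eq_itg; first by apply: measurable_funX; case: De.
  have := Dw_lin L0 (-1) p2 h2 (leqnn 2); rewrite scaleN1r addrC -/e.
  apply: aeS => x hx xL; rewrite expr2 {2}(hx xL); ring.
have [z|nz] := eqVneq (nrm2 0 L (Dw L 2 e)) 0; first by rewrite z nrm2_ge0.
have p : 0 < nrm2 0 L (Dw L 2 e) by rewrite lt_def nz nrm2_ge0.
rewrite -(ler_pM2l p) -expr2 E; apply: le_trans (ler_norm _) _; exact: (itg_CSn De Df).
Qed.

Lemma interp_H2 f : Hk0 L 2 f -> nrm2 0 L (f - Pi f) <= h ^+ 2 * nrm2 0 L (Dw L 2 f).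
Proof.
move=> hf; have [_ H] := poincare (err_Hk hf) (err_node0 hf).
by apply: le_trans H _; apply: ler_wpM2l; [exact: sqr_ge0|exact: (err_stab hf)].
Qed.

Lemma Hk0_le k f : (2 <= k)%N -> Hk0 L k f -> Hk0 L 2 f.
Proof. by move=> k2 [hf f0 f1]; split => //; exact: Hk_le k2 hf. Qed.

(** Aubin-Nitsche duality, exact here: the projection is cubic on each cell, so two
    integrations by parts turn the square of the norm of e'' into the integral of
    e f'''', and the norm of e is at most h^2 times that of e''. *)
Lemma interp_H4 f : Hk0 L 4 f -> nrm2 0 L (Dw L 2 (f - Pi f)) <= h ^+ 2 * nrm2 0 L (Dw L 4 f).
Proof.
move=> hf4; have hf := Hk0_le (isT : (2 <= 4)%N) hf4; have [h4 _ _] := hf4.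
have [h2 _ _] := hf; have [p2 _ _] := Pi_Hk0 f; have e2 := err_Hk hf; have ne := err_node0 hf.
have [_ poi] := poincare e2 ne.
have Deq := Dw_lin L0 (-1) p2 h2 (leqnn 2).
rewrite scaleN1r addrC in Deq; set e := f - Pi f in e2 ne poi Deq *.
have De := Hk_Dw_L2 L0 e2 (leqnn 2); have D4 := Hk_Dw_L2 L0 h4 (leqnn 4).
have D0 := Hk_Dw_L2 L0 e2 (leq0n 2).
have E : nrm2 0 L (Dw L 2 e) ^+ 2 = itg 0 L (fun x => Dw L 0 e x * Dw L 4 f x).
  rewrite nrm2_sqr (@itg_cells R L P _ L0 P0 (L2on_sqr De)).
  rewrite [RHS](@itg_cells R L P _ L0 P0 (L2on_mul D0 D4)).
  apply: eq_bigr => m _; have mP := ltn_ord m; rewrite -!/(grid' _).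
  have mm := ltW (grid_lt m); have [_ _ pp] := Wh_spec (Pi_Wh f); have [p [ps _ _ pd]] := pp m mP.
  have [n0 n1] := ne m (ltnW mP); have [n0' n1'] := ne m.+1 mP.
  have c2 := is_prim_lin (-1) (poly_prim p^`()^`() mm) (cell_prim h4 (isT : (2 < 4)%N) mP).
  have c3 := is_prim_lin (-1) (poly_prim p^`()^`()^`() mm) (cell_prim h4 (isT : (3 < 4)%N) mP).
  have a3 := ae_cell mP (Hk_pv_ae L0 h4 (isT : (3 < 4)%N)).
  have c2' := is_prim_ae c2 (cont_L2on (is_prim_cont c3)) (aeS (fun x H xm => congr1 (+%R _) (H xm)) a3).
  have p4 : p^`()^`()^`()^`() = 0.
    by rewrite -[LHS]/(p^`(4)) derivn_poly0.
  have := is_prim_mul mm (cell_prim e2 (isT : (1 < 2)%N) mP) c2'.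
  have c0 := cell_prim e2 (isT : (0 < 2)%N) mP.
  have a1 := ae_cell mP (Hk_pv_ae L0 e2 (isT : (1 < 2)%N)).
  have c0' := is_prim_ae c0 (cont_L2on (is_prim_cont (cell_prim e2 (isT : (1 < 2)%N) mP))) a1.
  have := is_prim_mul mm c0' c3.
  rewrite n0 n0' n1 n1' !mul0r subrr.
  have V1 := cont_L2on (is_prim_cont (cell_prim e2 (isT : (1 < 2)%N) mP)).
  have V0 := cont_L2on (is_prim_cont c0).
  have W2 := L2on_cell L0 mP De.
  rewrite itgD; [|exact: L2on_mul V1 (cont_L2on (is_prim_cont c3))|exact: L2on_mul V0 c3.1].
  move=> I1.
  rewrite itgD; [|exact: L2on_mul W2 (cont_L2on (is_prim_cont c2))|exact: L2on_mul V1 c2'.1].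
  move=> I2.
  have J1 : itg (grid' m) (grid' m.+1) (fun x => Dw L 2 e x ^+ 2) =
     itg (grid' m) (grid' m.+1) (fun x => Dw L 2 e x * (-1 * p^`()^`().[x] + pv L 2 f x)).
    apply: ae_eq_itg; first by apply: measurable_funX; case: W2.
    have a2 := ae_cell mP (Hk_pv_ae L0 h4 (isT : (2 < 4)%N)).
    apply: ae2 (ae_cell mP Deq) (aeI a2 pd) => x hx [ha hb] xm.
    by rewrite expr2 {2}hx// ha// hb.
  have J2 : itg (grid' m) (grid' m.+1) (fun x => Dw L 0 e x * Dw L 4 f x) =
     itg (grid' m) (grid' m.+1) (fun x => pv L 0 e x * (-1 * p^`()^`()^`()^`().[x] + Dw L 4 f x)).
    apply: ae_eq_itg.
      by apply: measurable_funM; [case: (L2on_cell L0 mP D0)|case: (L2on_cell L0 mP D4)].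
    apply: aeS (ae_cell mP (Hk_pv_ae L0 e2 (isT : (0 < 2)%N))) => x hx xm.
    by rewrite hx// p4 horner0 mulr0 add0r.
  by rewrite J1 J2; move: I1 I2; lra.
have [z|nz] := eqVneq (nrm2 0 L (Dw L 2 e)) 0.
  by rewrite z mulr_ge0 ?sqr_ge0 ?nrm2_ge0.
have p : 0 < nrm2 0 L (Dw L 2 e) by rewrite lt_def nz nrm2_ge0.
rewrite -(ler_pM2l p) -expr2 E; apply: le_trans (ler_norm _) _.
apply: le_trans (itg_CSn D0 D4) _.
rewrite Dw0 mulrCA mulrA; apply: ler_wpM2r; [exact: nrm2_ge0|exact: poi].
Qed.

End Hermite.

(** * Paths in Sobolev spaces *)

Section BochnerScalar.
Context {R : realType}.
Local Notation leb := (@lebesgue_measure R).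

Lemma oo_ae (T : R) (Q : R -> Prop) : {ae leb, forall t, t \in `]0, T[ -> Q t} ->
  {ae leb, forall t, 0 <= t <= T -> Q t}.
Proof.
move=> H; apply: ae2 H (aeI (ae_neq 0) (ae_neq T)) => t h [t0 tT] /andP[h1 h2].
by apply: h; rewrite in_itv/= !lt_neqAle tT h1 h2 eq_sym t0.
Qed.

(** Times range over ]0, T[ in the Bochner spaces and over [0, T] in the estimates. *)
Lemma oo_integral (T : R) (F F' : R -> \bar R) : measurable_fun `[0, T] F' ->
  {ae leb, forall t, 0 <= t <= T -> F t = F' t} ->
  (\int[leb]_(t in `]0%R, T[) F t = \int[leb]_(t in `[0%R, T]) F' t)%E.
Proof.
move=> mF FF'; have mF'o : measurable_fun `]0, T[ F'.
  by apply: measurable_funS mF => //; apply: subset_itv; rewrite bnd_simp.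
rewrite -(ae_eq_integral_leb _ mF'o)//; last first.
  apply: aeS FF' => t h; rewrite /= in_itv/= => /andP[h1 h2]; rewrite h// (ltW h1) ltW//.
by rewrite -(@integral_itv_bndoo R 0 T F' true false).
Qed.

Lemma oo_itg (T : R) (F F' : R -> R) : measurable_fun `[0, T] F' ->
  {ae leb, forall t, 0 <= t <= T -> F t = F' t} ->
  \int[leb]_(t in `]0, T[) F t = itg 0 T F'.
Proof.
move=> mF FF'; congr fine; apply: oo_integral; first exact/measurable_EFinP.
by apply: aeS FF' => t h /h ->.
Qed.

(** This is weak_prim up to the end points and the choice of representatives. *)
Lemma time_prim (T : R) (F G G' : R -> R) : 0 < T -> continuous_in absR `[0, T] F ->
  L2on 0 T G' -> {ae leb, forall t, 0 <= t <= T -> G t = G' t} ->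
  (forall phi, test_function 0 T phi ->
    \int[leb]_(t in `]0, T[) (F t * derive1 phi t) = - \int[leb]_(t in `]0, T[) (G t * phi t)) ->
  is_prim 0 T F G'.
Proof.
move=> T0 cF G2 GG' H.
have [F' pF' FF'] : exists2 F', is_prim 0 T F' G' & {ae leb, forall x, 0 <= x <= T -> F x = F' x}.
  apply: (weak_prim T0 (cont_L2on cF) G2) => phi tphi.
  have [pp _ _] := test_prim (ltW T0) tphi.
  have p2 := cont_L2on (is_prim_cont pp).
  rewrite -(@oo_itg T (fun t => F t * derive1 phi t)); last by apply: aeW.
    rewrite H// (@oo_itg T _ (fun t => G' t * phi t))//.
      by apply: measurable_funM; [case: G2|case: p2].
    by apply: aeS GG' => t h tT; rewrite h.
  by apply: measurable_funM; [exact: cont_meas|case: (pp.1)].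
apply: (@eq_is_prim _ _ _ F') => //; last exact: ltW.
move=> x xT; apply/esym; exact: (cont_ae_eq T0 cF (is_prim_cont pF') FF' xT).
Qed.

Variables (E : lmodType R) (X : set E) (b : E -> E -> R) (T : R).
Hypothesis XL : lin_closed X.
Hypothesis bP : psd X b.
Hypothesis T0 : 0 < T.
Local Notation N := (snorm b).

(** Any function of a simple function is measurable, continuous or not; one set of the
    family is split off at a time. *)
Lemma simple_meas (s : R -> E) (psi : E -> R) : simple_function X s -> measurable_fun setT (psi \o s).
Proof.
move=> [k [A [x [Ax sE]]]].
have -> : psi \o s = fun t => psi (\sum_(i < k) (\1_(A i) t : R) *: x i).
  by apply/funext => t /=; rewrite sE.
have mA i : measurable (A i) by case: (Ax i).
elim: k A x psi mA {Ax sE} => [|k IH] A x psi mA.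
  rewrite [X in measurable_fun _ X](_ : _ = cst (psi 0)); first exact: measurable_cst.
  by apply/funext => t; rewrite big_ord0.
have -> : (fun t => psi (\sum_(i < k.+1) (\1_(A i) t : R) *: x i)) = fun t =>
   \1_(A ord0) t * psi (x ord0 + \sum_(i < k) (\1_(A (lift ord0 i)) t : R) *: x (lift ord0 i)) +
   (1 - \1_(A ord0) t) * psi (\sum_(i < k) (\1_(A (lift ord0 i)) t : R) *: x (lift ord0 i)).
  apply/funext => t; rewrite big_ord_recl indicE; case: (t \in A ord0).
    by rewrite scale1r mul1r subrr mul0r addr0.
  by rewrite scale0r add0r mul0r subr0 mul1r add0r.
have mi : measurable_fun setT (\1_(A ord0) : R -> R) by exact: measurable_indic.
apply: measurable_funD; apply: measurable_funM => //.
- exact: (IH _ _ (fun z => psi (x ord0 + z))).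
- exact: measurable_funB.
- exact: (IH _ _ psi).
Qed.

Lemma simple_in (s : R -> E) t : simple_function X s -> X (s t).
Proof.
move=> [k [A [x [Ax ->]]]]; apply: lc_sum => // i; apply: lcZ => //.
by case: (Ax i).
Qed.

Lemma L2_in_ae (V : R -> E) : L2_in X N T V -> {ae leb, forall t, 0 <= t <= T -> X (V t)}.
Proof. by move=> [h _ _]; exact: oo_ae. Qed.

(** A Lipschitz image of a strongly measurable path is the almost everywhere limit of
    measurable functions, hence has a measurable representative; the upper limit is
    one which is defined everywhere. *)
Lemma L2_in_scalar1 (V : R -> E) (phi : E -> R) : L2_in X N T V ->
  (forall x y, X x -> X y -> `|phi x - phi y| <= N (x - y)) ->
  (forall x, X x -> `|phi x| <= N x) ->
  exists2 f, L2on 0 T f & {ae leb, forall t, 0 <= t <= T -> phi (V t) = f t}.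
Proof.
move=> [XV [s [ss sV]] fin] lip bnd.
pose g t : \bar R := limn_esup (fun n => (phi (s n t))%:E).
have mg : measurable_fun setT g.
  apply: measurable_fun_limn_esup => n; apply/measurable_EFinP; exact: (simple_meas phi (ss n)).
pose f t := fine (g t).
have mf : measurable_fun setT f by apply: measurableT_comp.
have XV' := oo_ae XV; have sV' := oo_ae sV.
have ae : {ae leb, forall t, 0 <= t <= T -> phi (V t) = f t}.
  apply: ae2 XV' sV' => t h1 h2 tT; have XVt := h1 tT; have cv := h2 tT.
  have c : phi (s n t) @[n --> \oo] --> phi (V t).
    apply/subr_cvg0; apply: squeeze0 cv; apply: nearW => n /=.
    by rewrite distrC; apply: lip => //; exact: simple_in.
  have c' : (phi (s n t))%:E @[n --> \oo] --> (phi (V t))%:E.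
    by apply/cvg_EFin => //; exact: nearW.
  have [e1 e2] := cvg_limn_einf_sup c'.
  by rewrite /f /g e2.
exists f => //; split; first exact: measurable_funS mf.
have ms : measurable_fun `[0, T] (fun t => (f t ^+ 2)%:E).
  by apply/measurable_EFinP; apply: measurable_funX; exact: measurable_funS mf.
rewrite -(@oo_integral T (fun t => (f t ^+ 2)%:E))//; last exact: aeW.
apply: le_lt_trans fin; apply: nonneg_ae_le_integral_leb => //.
- by apply: measurable_funS ms => //; apply: subset_itv; rewrite bnd_simp.
- by move=> t _; rewrite lee_fin sqr_ge0.
- by move=> t _; rewrite lee_fin sqr_ge0.
- apply: ae2 ae XV' => t h1 h2; rewrite /= in_itv/= => /andP[t0 tT].
  have tt : 0 <= t <= T by rewrite !ltW.
  rewrite lee_fin -h1// -(real_normK (num_real (phi _))) ler_sqr ?nnegrE ?snorm_ge0//.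
  by apply: bnd; exact: h2.
Qed.

Lemma L2_in_scalar (V : R -> E) (phi : E -> R) c : L2_in X N T V ->
  (forall x y, X x -> X y -> `|phi x - phi y| <= c * N (x - y)) ->
  (forall x, X x -> `|phi x| <= c * N x) ->
  exists2 f, L2on 0 T f & {ae leb, forall t, 0 <= t <= T -> phi (V t) = f t}.
Proof.
(* dividing by a positive Lipschitz constant reduces to the constant 1 *)
move=> V2 lip bnd; pose d := `|c| + 1; have d0 : 0 < d by rewrite ltr_wpDl.
have cd y : c * N y <= d * N y.
  by rewrite ler_wpM2r ?snorm_ge0// /d; have := ler_norm c; lra.
have [||f f2 fE] := @L2_in_scalar1 V (fun x => d^-1 * phi x) V2.
- move=> x y Xx Xy; rewrite -mulrBr normrM (ger0_norm (_ : 0 <= d^-1)) ?invr_ge0 ?(ltW d0)// ler_pdivrMl//.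
  exact: le_trans (lip _ _ Xx Xy) (cd _).
- move=> x Xx; rewrite normrM (ger0_norm (_ : 0 <= d^-1)) ?invr_ge0 ?(ltW d0)// ler_pdivrMl//.
  exact: le_trans (bnd _ Xx) (cd _).
exists (fun t => d * f t); first exact: L2onZ.
by apply: aeS fE => t h tT; rewrite -h// mulrA mulfV ?mul1r// gt_eqF.
Qed.

Lemma L2_in_lin (V : R -> E) (l : E -> R) c : L2_in X N T V ->
  (forall a x y, X x -> X y -> l (a *: x + y) = a * l x + l y) ->
  (forall x, X x -> `|l x| <= c * N x) ->
  exists2 f, L2on 0 T f & {ae leb, forall t, 0 <= t <= T -> l (V t) = f t}.
Proof.
move=> V2 ll bnd; apply: (L2_in_scalar V2 _ bnd) => x y Xx Xy.
have -> : l x - l y = l (x - y).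
  by rewrite addrC -[in RHS]scaleN1r [in RHS]addrC ll// mulN1r.
by apply: bnd; exact: lcB.
Qed.

Lemma L2_in_norm (V : R -> E) : L2_in X N T V ->
  exists G, [/\ L2on 0 T G, {ae leb, forall t, 0 <= t <= T -> N (V t) = G t},
    (forall t, 0 <= G t) & nrm2 0 T G = normL2_in N T V].
Proof.
move=> V2; have [|x Xx|G G2 GE] := @L2_in_scalar1 V N V2.
- by move=> x y Xx Xy; exact: (snorm_dist XL bP).
- by rewrite ger0_norm ?snorm_ge0.
exists (fun t => `|G t|); split => //; first exact: L2on_norm.
- by apply: aeS GE => t h tT; rewrite -h// ger0_norm ?snorm_ge0.
- rewrite /nrm2 /normL2_in; congr Num.sqrt.
  rewrite (@oo_itg T _ (fun t => `|G t| ^+ 2))//.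
    by apply: measurable_funX; case: (L2on_norm G2).
  by apply: aeS GE => t h tT; rewrite h// real_normK ?num_real.
Qed.

End BochnerScalar.

Section Path.
Context {R : realType}.
Local Notation leb := (@lebesgue_measure R).
Local Notation Fn := (R -> R^o).
Variables (L T : R) (k : nat) (Y : set Fn).
Hypothesis L0 : 0 < L.
Hypothesis T0 : 0 < T.
Hypothesis YL : lin_closed Y.
Hypothesis YH : Y `<=` Hk L k.
Local Notation N := (normHk L k).
Variables U V : R -> Fn.
Hypothesis UY : forall t, 0 <= t <= T -> Y (U t).
Hypothesis V2 : L2_in Y N T V.
Hypothesis UV : forall y, L2on 0 L y -> exists2 G, L2on 0 T G &
  {ae leb, forall t, 0 <= t <= T -> ipL2 L (V t) y = G t} /\ is_prim 0 T (fun t => ipL2 L (U t) y) G.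

(** The functional l commutes with the time derivative. *)
Definition transports (l : Fn -> R) := exists2 G, L2on 0 T G &
  {ae leb, forall t, 0 <= t <= T -> l (V t) = G t} /\ is_prim 0 T (fun t => l (U t)) G.

Definition blin (l : Fn -> R) (c : R) :=
  (forall a x y, Y x -> Y y -> l (a *: x + y) = a * l x + l y) /\
  (forall x, Y x -> `|l x| <= c * N x).

Let bP : psd Y (ipHk L k). Proof. exact: psd_subset YH (psd_ipHk L0 k). Qed.

Let V2' : L2_in Y (snorm (ipHk L k)) T V. Proof. by rewrite -normHkE. Qed.

Let V_ae : {ae leb, forall t, 0 <= t <= T -> Y (V t)}.
Proof. exact: L2_in_ae V2'. Qed.

Lemma blin_meas l c : blin l c ->
  exists2 f, L2on 0 T f & {ae leb, forall t, 0 <= t <= T -> l (V t) = f t}.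
Proof.
move=> [ll lb]; have lb' x : Y x -> `|l x| <= c * snorm (ipHk L k) x by rewrite -normHkE; exact: lb.
exact: (L2_in_lin YL V2' ll lb').
Qed.

Lemma transports_ext l l' : (forall f, Y f -> l f = l' f) -> transports l -> transports l'.
Proof.
move=> ll' [G G2 [GE pG]]; exists G => //; split.
  by apply: ae2 V_ae GE => t h1 h2 tT; rewrite -h2// ll'//; exact: h1.
apply: (@eq_is_prim _ _ _ (fun t => l (U t))) => //; last exact: ltW.
by move=> t tT; apply: ll'; exact: UY.
Qed.

Lemma transports_lin l l' a : transports l -> transports l' -> transports (fun f => a * l f + l' f).
Proof.
move=> [G G2 [GE pG]] [G' G'2 [GE' pG']]; exists (fun t => a * G t + G' t).
  by apply: L2onD => //; exact: L2onZ.
split; last exact: is_prim_lin.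
by apply: ae2 GE GE' => t h1 h2 tT; rewrite h1// h2.
Qed.

Lemma transports_zero : transports (fun=> 0).
Proof.
exists (fun=> 0); first exact: L2on_cst.
by split; [exact: aeW|exact: is_prim_cst].
Qed.

Lemma transports_sum n (l : 'I_n -> Fn -> R) (a : 'I_n -> R) : (forall i, transports (l i)) ->
  transports (fun f => \sum_(i < n) a i * l i f).
Proof.
elim: n l a => [|n IH] l a H.
  by apply: transports_ext transports_zero => f _; rewrite big_ord0.
have := transports_lin (a ord0) (H ord0) (IH (fun i => l (lift ord0 i)) (fun i => a (lift ord0 i)) (fun i => H _)).
by apply: transports_ext => f _; rewrite big_ord_recl.
Qed.

(** The class is closed under limits of bounded functionals: the errors at the times 0
    and t and in the time integral are all controlled by the norm. *)
Lemma transports_lim l c : blin l c ->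
  (forall e, 0 < e -> exists2 l', transports l' & forall f, Y f -> `|l' f - l f| <= e * N f) ->
  transports l.
Proof.
move=> bl H; have [G G2 GE] := blin_meas bl; exists G => //; split => //; split => // t tT.
have [K [K2 KE K0 _]] := L2_in_norm YL bP V2'.
pose M := N (U t) + N (U 0) + itg 0 t K + 1.
have [t0 tT'] := andP tT.
have itK0 : 0 <= itg 0 t K by apply: itg_ge0.
have M0 : 0 < M by rewrite ltr_wpDl// !addr_ge0 ?normHk_ge0.
apply/eqP; rewrite -subr_eq0 -normr_le0; apply/ler_addgt0Pr => e e0; rewrite add0r.
have eM : 0 < e / M by rewrite divr_gt0.
have [l' [G' G'2 [G'E pG']] ll'] := H _ eM.
have Yt := UY tT; have Y0 := UY (_ : 0 <= 0 <= T); have {}Y0 := Y0 ltac:(by rewrite lexx ltW).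
have := is_prim_diff pG' (lexx 0) t0 tT' => E.
have i1 : L2on 0 t G by apply: L2on_sub G2.
have i2 : L2on 0 t G' by apply: L2on_sub G'2.
have i3 : L2on 0 t K by apply: L2on_sub K2.
have B : `|itg 0 t G' - itg 0 t G| <= e / M * itg 0 t K.
  rewrite -itgB; [|exact: L2on_int..].
  apply: le_trans (le_norm_itg _) _; first by apply: intbleB; exact: L2on_int.
  rewrite -itgZ; last exact: L2on_int.
  apply: ae_le_itg; [by apply: intble_norm; apply: intbleB; exact: L2on_int|by apply: intbleZ; exact: L2on_int|].
  apply: ae2 (aeI GE G'E) (aeI KE V_ae) => s [h1 h2] [h3 h4] /andP[s0 st].
  have sT : 0 <= s <= T by rewrite s0 (le_trans st).
  by rewrite -h1// -h2// -h3// -normHkE; apply: ll'; exact: h4.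
have -> : l (U t) - (l (U 0) + itg 0 t G) =
  - (l' (U t) - l (U t)) + (l' (U 0) - l (U 0)) + (itg 0 t G' - itg 0 t G) by rewrite -E; ring.
have b1 := ll' _ Yt; have b2 := ll' _ Y0.
apply: le_trans (ler_normD _ _) _; apply: (@le_trans _ _ (e / M * N (U t) + e / M * N (U 0) + e / M * itg 0 t K)).
  apply: lerD => //; apply: le_trans (ler_normD _ _) _; rewrite normrN; exact: lerD.
have ME : N (U t) + N (U 0) + itg 0 t K = M - 1 by rewrite /M; ring.
rewrite -!mulrDr ME mulrAC ler_pdivrMr// ler_wpM2l ?(ltW e0)//; lra.
Qed.

Lemma itgDw_lin j a b c (f g : Fn) : Hk L k f -> Hk L k g -> (j <= k)%N -> 0 <= a -> b <= L ->
  itg a b (Dw L j (c *: f + g)) = c * itg a b (Dw L j f) + itg a b (Dw L j g).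
Proof.
move=> hf hg jk a0 bL.
have f2 := L2on_sub a0 bL (Hk_Dw_L2 L0 hf jk); have g2 := L2on_sub a0 bL (Hk_Dw_L2 L0 hg jk).
have i1 : intble a b (fun x => c * Dw L j f x) by apply: intbleZ; exact: L2on_int.
rewrite -itgZ; last exact: L2on_int.
rewrite -itgD //; last exact: L2on_int.
apply: ae_eq_itg; first by case: (L2on_sub a0 bL (Hk_Dw_L2 L0 (Hk_lin L0 c hf hg) jk)).
apply: aeS (Dw_lin L0 c hf hg jk) => x h /andP[ax xb]; apply: h; apply/andP; split; lra.
Qed.

(** All functionals of interest commute with the time derivative, by induction on j.
    For j = 0 the integral over [a, b] is the pairing with an indicator function; an
    integral of a derivative of order j + 1 is a difference of point values; and a
    point value is a limit of averages over shrinking intervals. *)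
Lemma transports_itg_pv j : (j <= k)%N ->
  (forall a b, 0 <= a -> a <= b -> b <= L -> transports (fun f => itg a b (Dw L j f))) /\
  (forall x, (j < k)%N -> 0 <= x <= L -> transports (fun f => pv L j f x)).
Proof.
have step i : (i <= k)%N ->
   (forall a b, 0 <= a -> a <= b -> b <= L -> transports (fun f => itg a b (Dw L i f))) ->
   (forall x, (i < k)%N -> 0 <= x <= L -> transports (fun f => pv L i f x)).
  move=> ik H x ilk /andP[x0 xL].
  have bl : blin (fun f => pv L i f x) (valbnd L).
    split; first by move=> a f g /YH hf /YH hg; apply: (pv_lin L0 a hf hg ilk); rewrite x0.
    by move=> f /YH hf; apply: (value_bnd L0 ilk hf); rewrite x0.
  apply: (transports_lim bl) => e e0.
  (* [c, c + d] contains x and stays in [0, L]; on it a derivative of order i varies by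
     at most sqrt d times the norm, whence the choice d <= e^2 *)
  pose d := Num.min (e ^+ 2) (L / 2).
  have d0 : 0 < d by rewrite lt_min exprn_gt0//= divr_gt0.
  have de : d <= e ^+ 2 by rewrite ge_min lexx.
  have dL : d <= L / 2 by rewrite ge_min lexx orbT.
  have [c [c0 cx xc cL]] : exists c, [/\ 0 <= c, c <= x, x <= c + d & c + d <= L].
    by have [xm|mx] := leP x (L / 2); [exists x|exists (x - d)]; split; lra.
  exists (fun f => d^-1 * itg c (c + d) (Dw L i f) + 0).
    by apply: transports_lin; [apply: H; lra|exact: transports_zero].
  move=> f /YH hf; rewrite addr0.
  have pf := Hk_pv_prim L0 hf ilk.
  have cf := is_prim_cont (is_prim_sub c0 (_ : c <= c + d) cL pf); have {}cf := cf ltac:(lra).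
  have -> : itg c (c + d) (Dw L i f) = itg c (c + d) (pv L i f).
    apply: ae_eq_itg; first by case: (L2on_sub c0 cL (Hk_Dw_L2 L0 hf ik)).
    apply: aeS (Hk_pv_ae L0 hf ilk) => y h /andP[cy yc]; apply: h; apply/andP; split; lra.
  have -> : d^-1 * itg c (c + d) (pv L i f) - pv L i f x = d^-1 * itg c (c + d) (fun y => pv L i f y - pv L i f x).
    rewrite itgB; [|by apply: L2on_int; exact: cont_L2on|exact: intble_cst].
    rewrite itg_cst; last lra.
    by field; rewrite gt_eqF.
  rewrite normrM ger0_norm ?invr_ge0 ?(ltW d0)// ler_pdivrMl//.
  have -> : d * (e * N f) = (e * N f) * (c + d - c) by ring.
  rewrite -itg_cst; last lra.
  have ii : intble c (c + d) (fun y => pv L i f y - pv L i f x).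
    by apply: intbleB; [apply: L2on_int; exact: cont_L2on|exact: intble_cst].
  apply: le_trans (le_norm_itg ii) _; apply: le_itg; [exact: intble_norm|exact: intble_cst|].
  have hd s t : c <= s -> s <= t -> t <= c + d -> `|pv L i f t - pv L i f s| <= e * N f.
    move=> cs st td; apply: le_trans (is_prim_holder pf (_ : 0 <= s) st (_ : t <= L)) _; [lra|lra|].
    apply: ler_pM; [exact: sqrtr_ge0|exact: nrm2_ge0| |exact: nrm2_le_normHk].
    rewrite -(ger0_norm (ltW e0)) -sqrtr_sqr; apply: ler_wsqrtr; lra.
  move=> y /andP[cy yc]; have [xy|/ltW yx] := leP x y; first exact: hd.
  by rewrite distrC; exact: hd.
elim: j => [|j IH] jk.
  have H a b : 0 <= a -> a <= b -> b <= L -> transports (fun f => itg a b (Dw L 0 f)).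
    move=> a0 ab bL; pose y : R -> R := \1_(`[a, b]).
    have y2 : L2on 0 L y.
      apply: (@L2on_bnd _ _ _ _ 1); first exact: measurable_indic.
      by move=> x _; rewrite /y indicE; case: (_ \in _); rewrite ?normr1 ?normr0.
    have tr : transports (fun f => ipL2 L f y) := UV y2.
    apply: transports_ext tr => f /YH hf; rewrite Dw0.
    have f2 := Hk_L2 hf.
    have -> : ipL2 L f y = itg 0 L (fun x => f x * y x) by [].
    have i0 : intble 0 L (fun x => f x * y x) by exact: L2on_mul.
    rewrite (@itg_split _ 0 L a) //; last exact: le_trans bL.
    rewrite (@itg_split _ a L b)//; last exact: intble_sub i0.
    have yE (x : R) : y x = (if a <= x <= b then 1 else 0) by rewrite /y indicE/= mem_setE in_itv/=; case: ifP.
    have -> : itg a b (fun x => f x * y x) = itg a b f.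
      by apply: eq_itg => x xab; rewrite yE xab mulr1.
    have z c d : 0 <= c -> c <= d -> d <= L -> {ae leb, forall x, c <= x <= d -> y x = 0} ->
        itg c d (fun x => f x * y x) = 0.
      move=> c0 cd dL yz; rewrite -(mul0r (d - c)) -(itg_cst 0 cd); apply: ae_eq_itg.
        by apply: intble_meas; exact: intble_sub i0.
      by apply: aeS yz => x h xcd; rewrite h// mulr0.
    rewrite (z 0 a)// ?(z b L)//; first by rewrite add0r addr0.
    - exact: le_trans ab.
    - apply: aeS (ae_neq b) => x xb /andP[bx _]; rewrite yE.
      have -> : (x <= b) = false by apply/negbTE; rewrite -ltNge lt_neqAle eq_sym xb.
      by rewrite andbF.
    - exact: le_trans bL.
    - apply: aeS (ae_neq a) => x xa /andP[_ ax]; rewrite yE.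
      by have -> : (a <= x) = false by apply/negbTE; rewrite -ltNge lt_neqAle xa.
  by split => //; exact: step.
have [_ Hp] := IH (ltnW jk).
have H a b : 0 <= a -> a <= b -> b <= L -> transports (fun f => itg a b (Dw L j.+1 f)).
  move=> a0 ab bL.
  have h1 := transports_lin (-1) (Hp a jk (_ : 0 <= a <= L)) (Hp b jk (_ : 0 <= b <= L)).
  apply: transports_ext (h1 _ _); last 2 first.
  - by apply/andP; split; lra.
  - by apply/andP; split; lra.
  move=> f /YH hf; rewrite -(is_prim_diff (Hk_pv_prim L0 hf jk) a0 ab bL); ring.
by split => //; exact: step.
Qed.

Lemma finite_CS n (x y : 'I_n -> R) :
  (\sum_(i < n) x i * y i) ^+ 2 <= (\sum_(i < n) x i ^+ 2) * (\sum_(i < n) y i ^+ 2).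
Proof.
apply: discriminant_le => [t|]; last by apply: sumr_ge0 => i _; exact: sqr_ge0.
have -> : \sum_(i < n) x i ^+ 2 + 2 * t * (\sum_(i < n) x i * y i) + t ^+ 2 * (\sum_(i < n) y i ^+ 2)
   = \sum_(i < n) (x i + t * y i) ^+ 2.
  rewrite !mulr_sumr -!big_split; apply: eq_bigr => i _ /=; ring.
by apply: sumr_ge0 => i _; exact: sqr_ge0.
Qed.

(** Minkowski's inequality for an integral of vectors, obtained from scalar
    functionals. The increment f is tested against the functional l made of its own
    averages over the cells of a grid: l (f) is the sum S of riesz_sqr, while
    Cauchy-Schwarz bounds l by sqrt S times the norm, so sqrt S is at most the
    integral of the rate. *)
Lemma path_bound j G s t : (j <= k)%N -> 0 <= s -> s <= t -> t <= T -> L2on 0 T G ->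
  {ae leb, forall t, 0 <= t <= T -> nrm2 0 L (Dw L j (V t)) <= G t} ->
  nrm2 0 L (Dw L j (U t - U s)) <= itg s t G.
Proof.
move=> jk s0 st tT G2 VG.
have Yt : Y (U t) by apply: UY; apply/andP; split; lra.
have Ys : Y (U s) by apply: UY; apply/andP; split; lra.
have YUU : Y (U t - U s) by exact: lcB.
have HU := YH YUU; have D2 := Hk_Dw_L2 L0 HU jk.
have Gi : intble s t G by apply: intble_sub s0 tT (L2on_int G2).
have K0 : 0 <= itg s t G.
  rewrite -(mul0r (t - s)) -(itg_cst 0 st); apply: ae_le_itg => //; first exact: intble_cst.
  apply: aeS VG => x h /andP[sx xt]; apply: le_trans (nrm2_ge0 _ _ _) (h _); apply/andP; split; lra.
rewrite -ler_sqr ?nnegrE ?nrm2_ge0// nrm2_sqr; apply: riesz_sqr => // n n0.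
have n0' : 0 < n%:R :> R by rewrite ltr0n.
have w0 : 0 < n%:R / L by rewrite divr_gt0.
pose I (i : 'I_n) (f : Fn) := itg (grid L n i) (grid L n i.+1) (Dw L j f).
pose f := U t - U s; set S := \sum_(i < n) _.
have ci i : [/\ 0 <= grid L n i, grid L n i <= grid L n i.+1 & (i < n)%N -> grid L n i.+1 <= L].
  by split; [exact: grid_ge0|exact: le_grid|move=> ?; exact: grid_leL].
have S0 : 0 <= S by apply: sumr_ge0 => i _; rewrite mulr_ge0 ?sqr_ge0// ltW.
pose l g := \sum_(i < n) (n%:R / L * I i f) * I i g.
have Tl : transports l.
  apply: (@transports_sum n (fun i g => I i g)) => i; have [h1 h2 h3] := ci i.
  by have [+ _] := transports_itg_pv jk; apply => //; apply: h3; exact: ltn_ord.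
have lf : l (U t) - l (U s) = S.
  rewrite /l /S -sumrB; apply: eq_bigr => i _; rewrite -mulrBr.
  have [h1 h2 h3] := ci i.
  have -> : I i (U t) - I i (U s) = I i f.
    rewrite /f addrC -[in RHS]scaleN1r [in RHS]addrC /I.
    by rewrite (itgDw_lin (-1) (YH Ys) (YH Yt) jk h1 (h3 (ltn_ord i))); ring.
  by rewrite /I -/f; ring.
have lb g : Y g -> l g <= Num.sqrt S * nrm2 0 L (Dw L j g).
  move=> /YH hg; have g2 := Hk_Dw_L2 L0 hg jk.
  apply: le_trans (ler_norm _) _; apply: le_sqrW; first by rewrite mulr_ge0 ?sqrtr_ge0 ?nrm2_ge0.
  rewrite exprMn sqr_sqrtr// nrm2_sqr.
  pose q := Num.sqrt (n%:R / L); have qq : q * q = n%:R / L by rewrite -expr2 sqr_sqrtr// ltW.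
  have -> : l g = \sum_(i < n) (q * I i f) * (q * I i g).
    by apply: eq_bigr => i _; rewrite -qq; ring.
  apply: le_trans (finite_CS _ _) _.
  have -> : \sum_(i < n) (q * I i f) ^+ 2 = S.
    by apply: eq_bigr => i _; rewrite exprMn expr2 qq.
  rewrite ler_wpM2l// (@itg_cells R L n)//; last exact: L2on_sqr.
  apply: ler_sum => i _; rewrite exprMn expr2 qq; have [h1 h2 h3] := ci i.
  have c2 := L2on_cell L0 (ltn_ord i) g2.
  rewrite -nrm2_sqr mulrC; have := itg_holder h2 c2.
  have -> : grid L n i.+1 - grid L n i = L / n%:R by rewrite gridS; ring.
  set Ng := nrm2 _ _ _ => hh; have Ln0 : 0 < L / n%:R by rewrite divr_gt0.
  have I2 : I i g ^+ 2 <= L / n%:R * Ng ^+ 2.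
    rewrite -(real_normK (num_real (I i g))) -[X in X * _](sqr_sqrtr (ltW Ln0)) -exprMn.
    by rewrite ler_sqr ?nnegrE ?mulr_ge0 ?sqrtr_ge0 ?nrm2_ge0.
  apply: (@le_trans _ _ ((L / n%:R * Ng ^+ 2) * (n%:R / L))); first exact: ler_wpM2r (ltW w0) _ _ I2.
  rewrite le_eqVlt; apply/orP; left; apply/eqP; field.
  by rewrite !gt_eqF.
have [Gl Gl2 [GlE pGl]] := Tl.
have main : S <= Num.sqrt S * itg s t G.
  rewrite -[leLHS]lf (is_prim_diff pGl s0 st tT) -itgZ//; apply: ae_le_itg.
  - by apply: intble_sub s0 tT (L2on_int Gl2).
  - exact: intbleZ.
  apply: ae2 (aeI GlE VG) V_ae => x [h1 h2] h3 /andP[sx xt].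
  have xT : 0 <= x <= T by apply/andP; split; lra.
  rewrite -h1//; apply: le_trans (lb _ (h3 xT)) _.
  by apply: ler_wpM2l; [exact: sqrtr_ge0|exact: h2].
have [->|Sn0] := eqVneq S 0; first exact: sqr_ge0.
have Sp : 0 < Num.sqrt S by rewrite sqrtr_gt0 lt_def Sn0.
have E : S = Num.sqrt S * Num.sqrt S by rewrite -expr2 sqr_sqrtr.
have : Num.sqrt S <= itg s t G by rewrite -(ler_pM2l Sp) -E.
by move=> hs; rewrite -[leLHS](sqr_sqrtr S0) ler_sqr ?nnegrE ?sqrtr_ge0.
Qed.

End Path.

(** * Kinetic and elastic forms of the beam *)

Section ContinuousPaths.
Context {R : realType}.
Local Notation leb := (@lebesgue_measure R).
Local Notation Fn := (R -> R^o).

Lemma C_in_comp (E : lmodType R) (Y : set E) (N : E -> R) T (U : R -> E) (l : E -> R) c :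
  lin_closed Y -> (forall x, 0 <= N x) -> C_in Y N T U ->
  (forall a x y, Y x -> Y y -> l (a *: x + y) = a * l x + l y) ->
  (forall x, Y x -> `|l x| <= c * N x) -> continuous_in absR `[0, T] (fun t => l (U t)).
Proof.
move=> YL N0 [YU /(continuous_in_epsP _ _ N0) cU] ll lb.
apply/(continuous_in_epsP _ _ absR_ge0) => t tT e e0.
pose c' := `|c| + 1; have c'0 : 0 < c' by rewrite ltr_wpDl.
have [d d0 H] := cU t tT (e / c') (divr_gt0 e0 c'0); exists d => // s sT sd.
have Ys := YU s sT; have Yt := YU t tT; have := H s sT sd.
rewrite ltr_pdivlMr// mulrC => h; rewrite /absR.
have -> : l (U s) - l (U t) = l (U s - U t).
  by rewrite addrC -[in RHS]scaleN1r [in RHS]addrC ll// mulN1r.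
apply: le_lt_trans (lb _ (lcB YL Ys Yt)) (le_lt_trans _ h).
by rewrite ler_wpM2r// /c'; have := ler_norm c; lra.
Qed.

Lemma UV_of (L T : R) k (Y : set Fn) (U V : R -> Fn) : 0 < L -> 0 < T -> lin_closed Y ->
  Y `<=` Hk L k -> C_in Y (normHk L k) T U -> L2_in Y (normHk L k) T V ->
  is_time_derivative T (L2 L) (ipL2 L) U V ->
  forall y, L2on 0 L y -> exists2 G, L2on 0 T G &
  {ae leb, forall t, 0 <= t <= T -> ipL2 L (V t) y = G t} /\ is_prim 0 T (fun t => ipL2 L (U t) y) G.
Proof.
move=> L0 T0 YL YH CU V2 UV y y2.
have ll (a : R) (f g : Fn) : Y f -> Y g -> ipL2 L (a *: f + g) y = a * ipL2 L f y + ipL2 L g y.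
  move=> /YH/Hk_L2 f2 /YH/Hk_L2 g2.
  have i1 : intble 0 L (fun x => f x * y x) by exact: L2on_mul.
  have i2 : intble 0 L (fun x => g x * y x) by exact: L2on_mul.
  have := itgD (intbleZ a i1) i2; rewrite itgZ// => <-.
  by apply: eq_itg => x _; change ((a * f x + g x) * y x = a * (f x * y x) + g x * y x); ring.
have lb (f : Fn) : Y f -> `|ipL2 L f y| <= nrm2 0 L y * normHk L k f.
  move=> /YH hf; have f2 := Hk_L2 hf; have h := itg_CSn f2 y2.
  apply: (le_trans h); rewrite mulrC; apply: ler_wpM2l; first exact: nrm2_ge0.
  by have := nrm2_le_normHk L f (leq0n k); rewrite Dw0.
have V2' : L2_in Y (snorm (ipHk L k)) T V by rewrite -normHkE.
have lb' (f : Fn) : Y f -> `|ipL2 L f y| <= nrm2 0 L y * snorm (ipHk L k) f by rewrite -normHkE; exact: lb.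
have [G G2 GE] := L2_in_lin YL V2' ll lb'.
exists G => //; split => //; apply: (time_prim T0 _ G2 GE) => [|phi tphi]; last exact: UV.
exact: (C_in_comp YL (normHk_ge0 L k) CU ll lb).
Qed.

Lemma is_prim_diff_cont T (F G : R -> R) t e : continuous_in absR `[0, T] G -> is_prim 0 T F G ->
  0 <= t <= T -> 0 < e -> exists2 d, 0 < d & forall s, t < s -> s < t + d -> s <= T ->
  `|F s - F t - (s - t) * G t| <= e * (s - t).
Proof.
move=> /(continuous_in_epsP _ _ absR_ge0) cG pF /andP[t0 tT] e0.
have ti : `[0, T]%classic t by rewrite /= in_itv/= t0.
have [d d0 H] := cG t ti e e0; exists d => // s ts sd sT.
have G2 := L2on_sub t0 sT pF.1.
rewrite (is_prim_diff pF t0 (ltW ts) sT) mulrC -(itg_cst (G t) (ltW ts)).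
rewrite -itgB; [|exact: L2on_int|exact: intble_cst].
have ii : intble t s (fun x => G x - G t) by apply: intbleB; [exact: L2on_int|exact: intble_cst].
apply: le_trans (le_norm_itg ii) _; rewrite -(itg_cst e (ltW ts)); apply: le_itg.
- exact: intble_norm.
- exact: intble_cst.
- move=> x /andP[tx xs]; apply/ltW/H; first by rewrite /= in_itv/=; apply/andP; split; lra.
  by rewrite ger0_norm; lra.
Qed.

End ContinuousPaths.

Section BeamForms.
Context {R : realType}.
Local Notation leb := (@lebesgue_measure R).
Local Notation Fn := (R -> R^o).
Variables (r : nat) (B : @beam R r).
Let L := bL B.
Hypothesis L0 : 0 < L.
Hypothesis cmu : continuous_in absR `[0, L] (bmu B).
Hypothesis cLam : continuous_in absR `[0, L] (bLam B).
Hypothesis mu0 : forall x, 0 <= x <= L -> 0 <= bmu B x.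
Hypothesis Lam0 : forall x, 0 <= x <= L -> 0 <= bLam B x.

Definition muf (f g : Fn) := wtform L (bmu B) 0 f g.
Definition lamf (f g : Fn) := wtform L (bLam B) 2 f g.
Definition pvf j (f g : Fn) := pv L j f L * pv L j g L.
(** mform is the kinetic form, including the mass and inertia attached to the free end;
    aform is the elastic form, including the springs; bform collects all terms of the
    variational equation other than inertia. *)
Definition mform f g := muf f g + (bM B * pvf 0 f g + bJ B * pvf 1 f g).
Definition aform f g := lamf f g + (bk1 B * pvf 1 f g + bk2 B * pvf 0 f g).

Definition bform (f g : Fn) (x1 x2 : 'cV[R]_r) q :=
  aform f q + cd (ctr1 B) * pv L 1 g L * pv L 1 q L + cd (ctr2 B) * pv L 0 g L * pv L 0 q L
  + dotv (cc (ctr1 B)) x1 * pv L 1 q L + dotv (cc (ctr2 B)) x2 * pv L 0 q L.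

Hypothesis M0 : 0 <= bM B.
Hypothesis J0 : 0 <= bJ B.
Hypothesis k10 : 0 <= bk1 B.
Hypothesis k20 : 0 <= bk2 B.

Local Notation H2 := (Hk L 2).

Lemma LL : 0 <= L <= L. Proof. by rewrite lexx ltW. Qed.

Lemma psd_muf : psd H2 muf. Proof. exact: psd_wtform. Qed.
Lemma psd_lamf : psd H2 lamf. Proof. exact: psd_wtform. Qed.
Lemma psd_pvf j : (j < 2)%N -> psd H2 (pvf j).
Proof. by move=> j2; apply: psd_value => //; exact: LL. Qed.
Lemma psd_mform : psd H2 mform.
Proof. by apply: psd_add; [exact: psd_muf|apply: psd_add; apply: psd_scale => //; exact: psd_pvf]. Qed.
Lemma psd_aform : psd H2 aform.
Proof. by apply: psd_add; [exact: psd_lamf|apply: psd_add; apply: psd_scale => //; exact: psd_pvf]. Qed.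

Local Notation N2 := (snorm (ipHk L 2)).

Definition h2bounded b := exists2 c : R, 0 <= c & forall f, H2 f -> b f f <= c * ipHk L 2 f f.

Lemma h2b_add b1 b2 : h2bounded b1 -> h2bounded b2 -> h2bounded (fun f g => b1 f g + b2 f g).
Proof.
move=> [c1 c10 H1] [c2 c20 H2']; exists (c1 + c2); first exact: addr_ge0.
by move=> f hf; rewrite mulrDl lerD ?H1 ?H2'.
Qed.

Lemma h2b_scale b k : 0 <= k -> h2bounded b -> h2bounded (fun f g => k * b f g).
Proof.
move=> k0 [c c0 H]; exists (k * c); first exact: mulr_ge0.
by move=> f hf; rewrite -mulrA ler_wpM2l ?H.
Qed.

Lemma ipHk_ge_sqr j f : (j <= 2)%N -> nrm2 0 L (Dw L j f) ^+ 2 <= ipHk L 2 f f.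
Proof.
move=> j2; rewrite nrm2_sqr /ipHk (bigD1 (Ordinal (j2 : (j < 3)%N)))//=.
rewrite (_ : itg 0 L (fun x => Dw L j f x ^+ 2) = itg 0 L (fun x => Dw L j f x * Dw L j f x)); last first.
  by apply: eq_itg => x _; rewrite expr2.
rewrite lerDl; apply: sumr_ge0 => i _; apply: itg_ge0 => x _; rewrite -expr2; exact: sqr_ge0.
Qed.

Lemma h2b_wt (om : R -> R) j : continuous_in absR `[0, L] om -> (j <= 2)%N ->
  h2bounded (wtform L om j).
Proof.
move=> com j2; have [K K0 omK] := cont_bnd com; exists K => // f hf.
apply: (@le_trans _ _ (K * nrm2 0 L (Dw L j f) ^+ 2)).
  apply: (wtform_le L0 com j2 hf) => x xL; apply: le_trans (ler_norm _) (omK x xL).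
by apply: ler_wpM2l => //; exact: ipHk_ge_sqr.
Qed.

Lemma h2b_pvf j : (j < 2)%N -> h2bounded (pvf j).
Proof.
move=> j2; exists (valbnd L ^+ 2); first exact: sqr_ge0.
move=> f hf; rewrite /pvf -expr2 -(real_normK (num_real _)) -(snorm_sqr (psd_ipHk L0 2) hf) -exprMn.
have := value_bnd L0 j2 hf LL; rewrite normHkE => h.
by rewrite ler_sqr ?nnegrE ?mulr_ge0 ?snorm_ge0 ?valbnd_ge0.
Qed.

Lemma h2b_muf : h2bounded muf. Proof. exact: h2b_wt. Qed.
Lemma h2b_lamf : h2bounded lamf. Proof. exact: h2b_wt. Qed.
Lemma h2b_mform : h2bounded mform.
Proof. by apply: h2b_add; [exact: h2b_muf|apply: h2b_add; apply: h2b_scale => //; exact: h2b_pvf]. Qed.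
Lemma h2b_aform : h2bounded aform.
Proof. by apply: h2b_add; [exact: h2b_lamf|apply: h2b_add; apply: h2b_scale => //; exact: h2b_pvf]. Qed.

Lemma h2b_bounded b : psd H2 b -> h2bounded b -> exists2 c : R, 0 <= c & bounded_by H2 N2 b c.
Proof.
move=> pb [c c0 H]; exists c => //; apply: bounded_psd => //; [exact: lc_Hk|exact: psd_ipHk].
Qed.

End BeamForms.

(** * The weak solution tested with fixed functions *)

Section Vectors.
Context {R : realType} {r : nat}.
Local Notation vec := 'cV[R]_r.

Lemma dotv_lin (a : R) (x y z : vec) : dotv (a *: x + y) z = a * dotv x z + dotv y z.
Proof.
rewrite /dotv mulr_sumr -big_split; apply: eq_bigr => i _; rewrite !mxE/=; ring.
Qed.

Lemma dotvC (x y : vec) : dotv x y = dotv y x.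
Proof. by apply: eq_bigr => i _; rewrite mulrC. Qed.

Lemma psd_dotv : psd setT (@dotv R r).
Proof.
split; [by move=> a x y z _ _ _; exact: dotv_lin|by move=> x y _ _; exact: dotvC|].
by move=> x _; apply: sumr_ge0 => i _; rewrite -expr2 sqr_ge0.
Qed.

Lemma lc_setT (E : lmodType R) : lin_closed (setT : set E). Proof. by []. Qed.

Lemma normvE : @normv R r = snorm (@dotv R r). Proof. by []. Qed.

Lemma dotv_mul (A : 'M[R]_r) (x y : vec) : dotv (A *m x) y = dotv x (A^T *m y).
Proof.
rewrite /dotv; under eq_bigr => i _ do rewrite mxE mulr_suml.
rewrite exchange_big; apply: eq_bigr => j _; rewrite mxE mulr_sumr; apply: eq_bigr => i _.
by rewrite mxE; ring.
Qed.

Lemma dotv_CS (x y : vec) : `|dotv x y| <= normv x * normv y.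
Proof. exact: (psd_CS (lc_setT _) psd_dotv). Qed.

End Vectors.

Section WeakIdentity.
Context {R : realType}.
Local Notation leb := (@lebesgue_measure R).
Local Notation Fn := (R -> R^o).
Variables (r : nat) (B : @beam R r) (T : R).
Local Notation vec := 'cV[R]_r.
Let L := bL B.
Hypothesis L0 : 0 < L.
Hypothesis T0 : 0 < T.
Hypothesis cmu : continuous_in absR `[0, L] (bmu B).
Hypothesis cLam : continuous_in absR `[0, L] (bLam B).
Hypothesis mu0 : forall x, 0 <= x <= L -> 0 <= bmu B x.
Hypothesis Lam0 : forall x, 0 <= x <= L -> 0 <= bLam B x.
Hypothesis M0 : 0 < bM B.
Hypothesis J0 : 0 < bJ B.
Hypothesis k10 : 0 <= bk1 B.
Hypothesis k20 : 0 <= bk2 B.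

Lemma muL2 (f g : Fn) : L2on 0 L f -> L2on 0 L g -> intble 0 L (fun x => bmu B x * f x * g x).
Proof. by move=> f2 g2; apply: L2on_mul => //; exact: cont_L2mul. Qed.

Lemma lc_Hsp : lin_closed (@Hsp R r B).
Proof.
split; first exact: (@L2on_cst R 0 L 0).
move=> a x y hx hy.
exact: (L2onD (L2onZ a (hx : L2on 0 L x.2)) (hy : L2on 0 L y.2)).
Qed.

Lemma psd_ipH : psd (@Hsp R r B) (ipH B).
Proof.
split.
- move=> a x y z hx hy hz; rewrite /ipH.
  have i1 := muL2 (hx : L2on 0 L x.2) (hz : L2on 0 L z.2).
  have i2 := muL2 (hy : L2on 0 L y.2) (hz : L2on 0 L z.2).
  have -> : \int[leb]_(t in `[0, L]) (bmu B t * (a *: x + y).2 t * z.2 t) =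
     a * itg 0 L (fun t => bmu B t * x.2 t * z.2 t) + itg 0 L (fun t => bmu B t * y.2 t * z.2 t).
    rewrite -itgZ// -itgD//; last exact: intbleZ.
    apply: eq_itg => t _; change (bmu B t * (a * x.2 t + y.2 t) * z.2 t = a * (bmu B t * x.2 t * z.2 t) + bmu B t * y.2 t * z.2 t).
    ring.
  rewrite /itg; set I1 := \int[_]_(_ in _) _; set I2 := \int[_]_(_ in _) _.
  change (bJ B * (a * x.1.1 + y.1.1) * z.1.1 + bM B * (a * x.1.2 + y.1.2) * z.1.2 + (a * I1 + I2) =
   a * (bJ B * x.1.1 * z.1.1 + bM B * x.1.2 * z.1.2 + I1) + (bJ B * y.1.1 * z.1.1 + bM B * y.1.2 * z.1.2 + I2)).
  ring.
- move=> x y hx hy; rewrite /ipH; congr (_ + _ + _); [ring|ring|].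
  by apply: eq_itg => t _; ring.
- move=> x hx; rewrite /ipH -!mulrA -!expr2 !addr_ge0//.
  + by rewrite mulr_ge0 ?sqr_ge0// ltW.
  + by rewrite mulr_ge0 ?sqr_ge0// ltW.
  + by apply: itg_ge0 => t tL; rewrite -mulrA -expr2 mulr_ge0 ?mu0 ?sqr_ge0.
Qed.

Lemma hatE (w : Fn) : hat B w = (pv L 1 w L, pv L 0 w L, w).
Proof. by rewrite pvE. Qed.

Lemma ipH_hat (f w : Fn) : ipH B (hat B f) (hat B w) = mform B f w.
Proof.
rewrite hatE hatE /ipH /mform /muf /wtform /pvf !Dw0 -/L.
set I := \int[_]_(_ in _) _.
change (bJ B * pv L 1 f L * pv L 1 w L + bM B * pv L 0 f L * pv L 0 w L + I =
  I + (bM B * (pv L 0 f L * pv L 0 w L) + bJ B * (pv L 1 f L * pv L 1 w L))).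
ring.
Qed.

Variables u v : R -> Fn.
Hypothesis uv : is_time_derivative T (L2 L) (ipL2 L) u v.
Hypothesis Cu : C_in (Hk0 L 4) (normHk L 4) T u.
Hypothesis Lv : L2_in (Hk0 L 4) (normHk L 4) T v.
Hypothesis Cv : C_in (Hk0 L 2) (normHk L 2) T v.

Lemma Hk0_Hk k : Hk0 L k `<=` Hk L k. Proof. by move=> f []. Qed.
Let Y4 := lc_Hk0 L0 (isT : (2 <= 4)%N).
Let Y2 := lc_Hk0 L0 (isT : (2 <= 2)%N).

Lemma u_in t : 0 <= t <= T -> Hk0 L 4 (u t).
Proof. by move=> tT; apply: Cu.1; rewrite in_itv. Qed.
Lemma v_in t : 0 <= t <= T -> Hk0 L 2 (v t).
Proof. by move=> tT; apply: Cv.1; rewrite in_itv. Qed.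

Lemma v_cont (l : Fn -> R) c :
  (forall a x y, Hk0 L 2 x -> Hk0 L 2 y -> l (a *: x + y) = a * l x + l y) ->
  (forall x, Hk0 L 2 x -> `|l x| <= c * normHk L 2 x) -> continuous_in absR `[0, T] (fun t => l (v t)).
Proof. exact: (C_in_comp Y2 (normHk_ge0 L 2) Cv). Qed.

Lemma v_cont_pv j : (j < 2)%N -> continuous_in absR `[0, T] (fun t => pv L j (v t) L).
Proof.
move=> j2; apply: (@v_cont (fun f => pv L j f L) (valbnd L)).
- by move=> a x y /Hk0_Hk hx /Hk0_Hk hy; apply: (pv_lin L0 a hx hy j2); exact: LL.
- by move=> x /Hk0_Hk hx; apply: (value_bnd L0 j2 hx); exact: LL.
Qed.

Lemma ip_lin (y : R -> R) (a : R) (f g : Fn) : L2on 0 L y -> L2on 0 L f -> L2on 0 L g ->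
  ipL2 L (a *: f + g) y = a * ipL2 L f y + ipL2 L g y.
Proof.
move=> y2 f2 g2.
have := itgD (intbleZ a (L2on_mul f2 y2)) (L2on_mul g2 y2); rewrite itgZ; last exact: L2on_mul.
move=> <-; apply: eq_itg => x _.
by change ((a * f x + g x) * y x = a * (f x * y x) + g x * y x); ring.
Qed.

Lemma ip_bnd (y : R -> R) (f : Fn) k : L2on 0 L y -> Hk L k f ->
  `|ipL2 L f y| <= nrm2 0 L y * normHk L k f.
Proof.
move=> y2 hf; have f2 := Hk_L2 hf; have h := itg_CSn f2 y2.
apply: (le_trans h); rewrite mulrC; apply: ler_wpM2l; first exact: nrm2_ge0.
by have := nrm2_le_normHk L f (leq0n k); rewrite Dw0.
Qed.

Lemma v_cont_ip (y : R -> R) : L2on 0 L y -> continuous_in absR `[0, T] (fun t => ipL2 L (v t) y).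
Proof.
move=> y2; apply: (@v_cont (fun f => ipL2 L f y) (nrm2 0 L y)).
- by move=> a f g /Hk0_Hk/Hk_L2 hf /Hk0_Hk/Hk_L2 hg; exact: ip_lin.
- by move=> f /Hk0_Hk hf; exact: ip_bnd.
Qed.

Let UV := UV_of L0 T0 Y4 (@Hk0_Hk 4) Cu Lv uv.

Lemma prim_of_cont (F : R -> R) (g : R -> R) (G : R -> R) : is_prim 0 T F G ->
  continuous_in absR `[0, T] g -> {ae leb, forall t, 0 <= t <= T -> g t = G t} -> is_prim 0 T F g.
Proof.
move=> pF cg gG; apply: is_prim_ae pF (cont_L2on cg) _.
by apply: aeS gG => t h tT; rewrite h.
Qed.

Lemma u_prim_pv j x : (j < 2)%N -> 0 <= x <= L ->
  is_prim 0 T (fun t => pv L j (u t) x) (fun t => pv L j (v t) x).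
Proof.
move=> j2 xL; have j4 : (j < 4)%N by exact: leq_trans j2 _.
have [_ H] := transports_itg_pv L0 T0 Y4 (@Hk0_Hk 4) u_in Lv UV (ltnW j4).
have [G G2 [GE pG]] := H x j4 xL; apply: (prim_of_cont pG _ GE).
apply: (@v_cont (fun f => pv L j f x) (valbnd L)).
- by move=> a f g /Hk0_Hk hf /Hk0_Hk hg; exact: (pv_lin L0 a hf hg j2 xL).
- by move=> f /Hk0_Hk hf; exact: (value_bnd L0 j2 hf xL).
Qed.

Lemma u_prim_ip y : L2on 0 L y -> is_prim 0 T (fun t => ipL2 L (u t) y) (fun t => ipL2 L (v t) y).
Proof.
move=> y2; have [G G2 [GE pG]] := UV y2; exact: (prim_of_cont pG (v_cont_ip y2) GE).
Qed.

Definition hpair (f : Fn) (y : triple) : R :=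
  bJ B * y.1.1 * pv L 1 f L + (bM B * y.1.2 * pv L 0 f L + ipL2 L f (fun x => bmu B x * y.2 x)).

Lemma hpairE f y : ipH B (hat B f) y = hpair f y.
Proof.
rewrite hatE /ipH /hpair.
have -> : ipL2 L f (fun x => bmu B x * y.2 x) = \int[leb]_(x in `[0, L]) (bmu B x * f x * y.2 x).
  by apply: eq_itg => x _; ring.
change (bJ B * pv L 1 f L * y.1.1 + bM B * pv L 0 f L * y.1.2 + \int[leb]_(x in `[0, L]) (bmu B x * f x * y.2 x) =
  bJ B * y.1.1 * pv L 1 f L + (bM B * y.1.2 * pv L 0 f L + \int[leb]_(x in `[0, L]) (bmu B x * f x * y.2 x))).
ring.
Qed.

Lemma muy_L2 (y : triple) : Hsp B y -> L2on 0 L (fun x => bmu B x * y.2 x).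
Proof. by move=> hy; apply: cont_L2mul cmu _; exact: hy. Qed.

Lemma u_prim_hpair y : Hsp B y -> is_prim 0 T (fun t => hpair (u t) y) (fun t => hpair (v t) y).
Proof.
move=> hy; apply: is_prim_lin; first by apply: u_prim_pv => //; exact: LL.
apply: is_prim_lin; first by apply: u_prim_pv => //; exact: LL.
by apply: u_prim_ip; exact: muy_L2.
Qed.

(** The velocity of the weak formulation is the continuous representative v: paired
    with any element of H both are rates of the same scalar function. *)
Lemma ut_ident (ut : R -> triple) : L2_in (@Hsp R r B) (normH B) T ut ->
  is_time_derivative T (@Hsp R r B) (ipH B) (fun t => hat B (u t)) ut ->
  forall y, Hsp B y -> {ae leb, forall t, 0 <= t <= T -> ipH B (ut t) y = hpair (v t) y}.
Proof.
move=> ut2 H y hy.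
have ll (a : R) z z' : Hsp B z -> Hsp B z' -> ipH B (a *: z + z') y = a * ipH B z y + ipH B z' y.
  by move=> hz hz'; exact: (psd_lin psd_ipH a hz hz' hy).
have lb z : Hsp B z -> `|ipH B z y| <= snorm (ipH B) y * snorm (ipH B) z.
  by move=> hz; rewrite mulrC; exact: (psd_CS lc_Hsp psd_ipH hz hy).
have [G G2 GE] := L2_in_lin lc_Hsp ut2 ll lb.
have pu := u_prim_hpair hy.
have pG : is_prim 0 T (fun t => hpair (u t) y) G.
  apply: (time_prim T0 (is_prim_cont pu) G2 GE) => phi tphi.
  by have := H phi tphi y hy; under eq_Rintegral do rewrite hpairE.
have [_ E] := prim_unique T0 pG pu (aeW _ (fun x _ => erefl)).
by apply: ae2 E GE => t h1 h2 tT; rewrite h2// h1.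
Qed.

Variables z1 z2 : R -> vec.
Variables (u0 v0 : @triple R) (z10 z20 : vec).
Hypothesis weak : weak_solution B T u z1 z2 u0 v0 z10 z20.

Definition gform t := bform B (u t) (v t) (z1 t) (z2 t).

Lemma z_cont (z : R -> vec) c : C_in setT normv T z -> continuous_in absR `[0, T] (fun t => dotv c (z t)).
Proof.
move=> Cz.
have := @C_in_comp R _ setT (@normv R r) T z (dotv c) (normv c) (lc_setT _) (fun x => sqrtr_ge0 _) Cz.
apply; first by move=> a x y _ _; rewrite !(dotvC c) dotv_lin.
by move=> x _; exact: dotv_CS.
Qed.

Lemma z_cont_r (z : R -> vec) c : C_in setT normv T z -> continuous_in absR `[0, T] (fun t => dotv (z t) c).
Proof.
have -> : (fun t => dotv (z t) c) = (fun t => dotv c (z t)) by apply/funext => t; exact: dotvC.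
exact: z_cont.
Qed.

Lemma ode_cont (k : @controller R r) (z : R -> vec) (g : R -> R) y : C_in setT normv T z ->
  continuous_in absR `[0, T] g -> continuous_in absR `[0, T] (fun t => dotv (cA k *m z t + g t *: cb k) y).
Proof.
move=> Cz cg.
have -> : (fun t => dotv (cA k *m z t + g t *: cb k) y) =
    (fun t => g t * dotv (cb k) y + dotv (z t) ((cA k)^T *m y)).
  by apply/funext => t; rewrite addrC dotv_lin dotv_mul.
apply: cont_add; first by apply: cont_mul; [exact: cg|exact: cont_cst].
exact: z_cont_r.
Qed.

Lemma ode_prim (k : @controller R r) (z zt : R -> vec) (g : R -> R) : C_in setT normv T z ->
  is_time_derivative T setT dotv z zt -> continuous_in absR `[0, T] g ->
  {ae leb, forall t, 0 <= t <= T -> zt t = cA k *m z t + g t *: cb k} ->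
  forall y, is_prim 0 T (fun t => dotv (z t) y) (fun t => dotv (cA k *m z t + g t *: cb k) y).
Proof.
move=> Cz dz cg E y; apply: (time_prim T0 (z_cont_r y Cz) (cont_L2on (ode_cont k y Cz cg)) (G := fun t => dotv (zt t) y)).
  by apply: aeS E => t h tT; rewrite h.
by move=> phi tphi; exact: (dz phi tphi y I).
Qed.

Lemma aform_u_cont w : Hk L 2 w -> continuous_in absR `[0, T] (fun t => aform B (u t) w).
Proof.
move=> hw.
have pa := psd_aform L0 cLam Lam0 k10 k20.
have [c c0 bc] := h2b_bounded L0 pa (h2b_aform L0 cLam k10 k20).
apply: (@C_in_comp R _ (Hk0 L 4) (normHk L 4) T u (fun f => aform B f w) (c * normHk L 2 w) Y4 (normHk_ge0 L 4) Cu).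
- move=> a f g /Hk0_Hk/(Hk_le L0 (isT : (2 <= 4)%N)) hf /Hk0_Hk/(Hk_le L0 (isT : (2 <= 4)%N)) hg.
  exact: (psd_lin pa a hf hg hw).
- move=> f /Hk0_Hk/(Hk_le L0 (isT : (2 <= 4)%N)) hf; apply: le_trans (bc f w hf hw) _.
  rewrite -normHkE -mulrA; apply: ler_wpM2l => //; rewrite mulrC; apply: ler_wpM2l; first exact: normHk_ge0.
  exact: normHk_le.
Qed.

Lemma gform_cont w : C_in setT normv T z1 -> C_in setT normv T z2 -> Hk L 2 w ->
  continuous_in absR `[0, T] (fun t => - gform t w).
Proof.
move=> Cz1 Cz2 hw; apply: cont_opp; rewrite /gform /bform.
apply: cont_add; last by apply: cont_mul; [exact: z_cont|exact: cont_cst].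
apply: cont_add; last by apply: cont_mul; [exact: z_cont|exact: cont_cst].
apply: cont_add; last first.
  by apply: cont_mul; [apply: cont_mul; [exact: cont_cst|exact: v_cont_pv]|exact: cont_cst].
apply: cont_add; last first.
  by apply: cont_mul; [apply: cont_mul; [exact: cont_cst|exact: v_cont_pv]|exact: cont_cst].
exact: aform_u_cont.
Qed.

(** Against a fixed w, the weak equation says that the momentum of v is absolutely
    continuous, and its rate is continuous because u, v, z1 and z2 are. *)
Lemma weak_facts : [/\ C_in setT normv T z1, C_in setT normv T z2,
  (forall w, Hk0 L 2 w -> is_prim 0 T (fun t => mform B (v t) w) (fun t => - gform t w)),
  (forall y, is_prim 0 T (fun t => dotv (z1 t) y)
     (fun t => dotv (cA (ctr1 B) *m z1 t + pv L 1 (v t) L *: cb (ctr1 B)) y)) &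
  (forall y, is_prim 0 T (fun t => dotv (z2 t) y)
     (fun t => dotv (cA (ctr2 B) *m z2 t + pv L 0 (v t) L *: cb (ctr2 B)) y))].
Proof.
have [ut [utt [z1t [z2t [[_ ut2 dut utt2 dutt] [Cz1 Cz2 _ dz1 dz2] eqn ode _]]]]] := weak.
have id_ut := ut_ident ut2 dut.
(* triples with a vanishing third component isolate the boundary velocities *)
have id_tr (x y : R) : {ae leb, forall t, 0 <= t <= T ->
    bJ B * (ut t).1.1 * x + bM B * (ut t).1.2 * y = bJ B * x * pv L 1 (v t) L + bM B * y * pv L 0 (v t) L}.
  have := id_ut (x, y, 0 : Fn) (@L2on_cst R 0 L 0); apply: aeS => t h tT; have := h tT.
  rewrite /ipH /hpair/=.
  have -> : \int[leb]_(x in `[0, bL B]) (bmu B x * (ut t).2 x * (0 : Fn) x) = itg 0 L (fun=> 0).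
    by apply: eq_itg => s _; rewrite mulr0.
  have -> : ipL2 L (v t) (fun x => bmu B x * (0 : Fn) x) = itg 0 L (fun=> 0).
    by apply: eq_itg => s _; rewrite !mulr0.
  by rewrite itg_cst ?mul0r ?addr0 ?(ltW L0).
have ut11 : {ae leb, forall t, 0 <= t <= T -> (ut t).1.1 = pv L 1 (v t) L}.
  apply: aeS (id_tr 1 0) => t h /h E; apply: (mulfI (lt0r_neq0 J0)); move: E.
  by rewrite !mulr1 !mulr0 mul0r !addr0.
have ut12 : {ae leb, forall t, 0 <= t <= T -> (ut t).1.2 = pv L 0 (v t) L}.
  apply: aeS (id_tr 0 1) => t h /h E; apply: (mulfI (lt0r_neq0 M0)); move: E.
  by rewrite !mulr1 !mulr0 mul0r !add0r.
split => //.
- move=> w hw0; have hw := Hk0_Hk hw0.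
  have cg := gform_cont Cz1 Cz2 hw.
  have hHw : Hsp B (hat B w) := Hk_L2 hw.
  have cm : continuous_in absR `[0, T] (fun t => mform B (v t) w).
    have := is_prim_cont (u_prim_hpair hHw).
    move=> _; have -> : (fun t => mform B (v t) w) = (fun t => hpair (v t) (hat B w)).
      by apply/funext => t; rewrite -hpairE ipH_hat.
    apply: cont_add; first by apply: cont_mul; [exact: cont_cst|exact: v_cont_pv].
    apply: cont_add; first by apply: cont_mul; [exact: cont_cst|exact: v_cont_pv].
    by apply: v_cont_ip; exact: muy_L2.
  have idm : {ae leb, forall t, 0 <= t <= T -> ipH B (ut t) (hat B w) = mform B (v t) w}.
    by apply: aeS (id_ut _ hHw) => t h tT; rewrite h// -hpairE ipH_hat.
  have ideq : {ae leb, forall t, 0 <= t <= T -> utt t (hat B w) = - gform t w}.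
    apply: ae2 (oo_ae eqn) (aeI ut11 ut12) => t h [h1 h2] tT.
    have := h tT w hw0; rewrite /duality h1// h2// -pvE -/L /gform /bform.
    have -> : ipV B (hat B (u t)) (hat B w) = lamf B (u t) w by rewrite /lamf /wtform DwE.
    rewrite /aform /pvf => E; move: E; lra.
  apply: (time_prim T0 cm (cont_L2on cg) ideq) => phi tphi.
  have [pp _ _] := test_prim (ltW T0) tphi.
  have p2 := cont_L2on (is_prim_cont pp).
  have := dutt phi tphi (hat B w) (ex_intro2 _ _ w hw0 erefl).
  rewrite /duality /embed => <-.
  have mm : measurable_fun `[0, T] (fun t => mform B (v t) w * derive1 phi t).
    by apply: measurable_funM; [exact: cont_meas|case: (pp.1)].
  rewrite (oo_itg mm); last by apply: aeW.
  by apply/esym; apply: (oo_itg mm); apply: aeS idm => t h tT; rewrite h.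
- apply: (ode_prim Cz1 dz1 (v_cont_pv (isT : (1 < 2)%N))); apply: ae2 (oo_ae ode) ut11 => t h1 h2 tT.
  by have [-> _] := h1 tT; rewrite h2.
- apply: (ode_prim Cz2 dz2 (v_cont_pv (isT : (0 < 2)%N))); apply: ae2 (oo_ae ode) ut12 => t h1 h2 tT.
  by have [_ ->] := h1 tT; rewrite h2.
Qed.

End WeakIdentity.

(** * One-sided limits and dissipation in the controllers *)

Section OneSided.
Context {R : realType}.
Implicit Types (t T : R).

Lemma right_within T t : 0 <= t -> t < T -> t^'+ `=>` within `[0, T] (nbhs t).
Proof.
move=> t0 tT A /within_ball[d d0 H]; rewrite /at_right.
apply/nbhs_ballP; exists (Num.min d (T - t)); first by rewrite /= lt_min d0 subr_gt0.
move=> s; rewrite /ball/= lt_min distrC => /andP[sd sT] ts; apply: H => //.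
have st : 0 < s - t by rewrite subr_gt0.
by move: sT; rewrite (ger0_norm (ltW st)) /= in_itv/= => sT; apply/andP; split; lra.
Qed.

Lemma right_dwithin t : 0 <= t -> t^'+ `=>` within `[0, +oo[ (dnbhs t).
Proof.
move=> t0 A /within_dball[d d0 H]; rewrite /at_right.
apply/nbhs_ballP; exists d => //= s; rewrite /ball/= distrC => st ts; apply: H => //.
- by rewrite /= in_itv/= andbT; lra.
- by rewrite gt_eqF.
Qed.

Lemma near_right t (Q : R -> Prop) : (\forall s \near t^'+, Q s) ->
  exists2 d, 0 < d & forall s, t < s -> s < t + d -> Q s.
Proof.
move=> /nbhs_ballP[d /= d0 H]; exists d => // s ts sd; apply: H => //.
by rewrite /ball/= distrC ger0_norm; lra.
Qed.

Lemma cvg_finer (F F' : set_system R) (f : R -> R) (l : R) : F' `=>` F -> f @ F --> l -> f @ F' --> l.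
Proof. by move=> FF' H A /H; exact: FF'. Qed.

Lemma is_prim_right T (F G : R -> R) t : continuous_in absR `[0, T] G -> is_prim 0 T F G ->
  0 <= t -> t < T -> (fun s => (s - t)^-1 * (F s - F t)) @ t^'+ --> G t.
Proof.
move=> cG pF t0 tT; apply/subr_cvg0; apply/cvgr0Pnorm_lt => e e0.
have tT' : 0 <= t <= T by rewrite t0 ltW.
have [d d0 H] := is_prim_diff_cont cG pF tT' (ltac:(lra) : 0 < e / 2).
apply/nbhs_ballP; exists (Num.min d (T - t)); first by rewrite /= lt_min d0 subr_gt0.
move=> s; rewrite /ball/= lt_min distrC => /andP[sd sT] ts.
have st : 0 < s - t by rewrite subr_gt0.
move: sd sT; rewrite (ger0_norm (ltW st)) => sd sT.
have := H s ts ltac:(lra) ltac:(lra).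
have -> : F s - F t - (s - t) * G t = (s - t) * ((s - t)^-1 * (F s - F t) - G t).
  by field; rewrite gt_eqF.
rewrite normrM (ger0_norm (ltW st)) mulrC ler_pM2r// => h.
by apply: le_lt_trans h _; lra.
Qed.

Lemma cont_in_cvg (E : lmodType R) (N : E -> R) T (f : R -> E) t :
  continuous_in N `[0, T] f -> 0 <= t <= T -> cvg_semi (within `[0, T] (nbhs t)) N f (f t).
Proof. by move=> cf tT; apply: cf; rewrite /= in_itv. Qed.

Section SemiNorm.
Context {E : lmodType R}.
Variables (X : set E) (b : E -> E -> R).
Hypothesis XL : lin_closed X.
Hypothesis bP : psd X b.
Local Notation N := (snorm b).

Lemma derivative_right (f f' : R -> E) t : derivative_in N `[0, +oo[ f f' -> 0 <= t ->
  cvg_semi t^'+ N (fun s => (s - t)^-1 *: (f s - f t)) (f' t).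
Proof.
move=> df t0; apply: cvg_finer (right_dwithin t0) _; apply: df.
by rewrite /= in_itv/= t0.
Qed.

Lemma derivative_cvg T (f f' : R -> E) t : derivative_in N `[0, +oo[ f f' ->
  (forall s, 0 <= s -> X (f s) /\ X (f' s)) -> 0 <= t <= T ->
  cvg_semi (within `[0, T] (nbhs t)) N f (f t).
Proof.
move=> /(derivative_in_epsP _ _ _ (snorm_ge0 b)) df Xf /andP[t0 tT].
have ti : `[0, +oo[%classic t by rewrite /= in_itv/= t0.
have [d d0 H] := df t ti 1 ltr01; have [Xft Xft'] := Xf t t0.
apply/cvgr0Pnorm_lt => e e0; apply/within_ball.
have N1 : 0 < 1 + N (f' t) by rewrite ltr_pwDl ?snorm_ge0.
exists (Num.min d (e / (1 + N (f' t)))); first by rewrite lt_min d0 divr_gt0.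
move=> s; rewrite /= in_itv/= lt_min => /andP[s0 sT] /andP[sd se].
rewrite ger0_norm ?snorm_ge0//; have [->|sn] := eqVneq s t; first by rewrite subrr (snorm0 XL bP).
have [Xfs _] := Xf s s0; have st : s - t != 0 by rewrite subr_eq0.
have Xd := lcB XL Xfs Xft; have Xq := lcZ XL (s - t)^-1 Xd.
have h1 : N ((s - t)^-1 *: (f s - f t)) <= 1 + N (f' t).
  have si : `[0, +oo[%classic s by rewrite /= in_itv/= s0.
  have := snormD XL bP (lcB XL Xq Xft') Xft'; rewrite subrK.
  by have := H s si sn sd; lra.
have -> : f s - f t = (s - t) *: ((s - t)^-1 *: (f s - f t)) by rewrite scalerA mulfV// scale1r.
rewrite (snormZ XL bP)//; move: se; rewrite ltr_pdivlMr// => se; apply: le_lt_trans se.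
exact: ler_wpM2l.
Qed.

Lemma cvg_semi_finer (F F' : set_system R) f x : F' `=>` F -> cvg_semi F N f x -> cvg_semi F' N f x.
Proof. exact: cvg_finer. Qed.

End SemiNorm.

Section VectorLimits.
Context {r : nat}.
Local Notation vec := 'cV[R]_r.
Variables (F : set_system R).
Context {FF : Filter F}.

Lemma cvg_sum0 n (f : 'I_n -> R -> R) : (forall i, f i @ F --> (0 : R)) ->
  (fun t => \sum_(i < n) f i t) @ F --> (0 : R).
Proof.
elim: n f => [|n IH] f H.
  by under eq_fun do rewrite big_ord0; exact: cvg_cst.
under eq_fun do rewrite big_ord_recl.
have h : (f ord0 t + \sum_(i < n) f (lift ord0 i) t) @[t --> F] --> (0 + 0 : R).
  by apply: cvgD; [exact: H|apply: (IH (fun i => f (lift ord0 i))) => i; exact: H].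
by rewrite addr0 in h.
Qed.

(** In finite dimension weak and strong convergence agree. *)
Lemma cvg_vec (f : R -> vec) x : (forall y, (fun s => dotv (f s) y) @ F --> dotv x y) <->
  cvg_semi F (@normv R r) f x.
Proof.
split => H; last first.
  move=> y; apply/subr_cvg0.
  apply: (@squeeze0 _ _ _ _ _ (fun s => normv (f s - x) * normv y)).
    apply: nearW => s; rewrite -(psdBl (lc_setT _) (@psd_dotv R r) I I I).
    exact: dotv_CS.
  by rewrite -(mul0r (normv y)); apply: cvgM => //; exact: cvg_cst.
have d0 : (fun s => dotv (f s - x) (f s - x)) @ F --> (0 : R).
  apply: cvg_sum0 => i.
  have c0 : (fun s => (f s - x) i 0) @ F --> (0 : R).
    have := H (delta_mx i 0).
    have E y : dotv y (delta_mx i 0) = y i 0.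
      rewrite /dotv (bigD1 i)//= mxE !eqxx mulr1 big1 ?addr0// => j ji.
      by rewrite mxE (negbTE ji) mulr0.
    under eq_fun do rewrite E.
    rewrite E => /subr_cvg0; apply: cvg_trans; apply: near_eq_cvg; apply: nearW => s.
    by rewrite /= !mxE.
  by rewrite -(mul0r 0); apply: cvgM.
rewrite /cvg_semi /normv -sqrtr0; apply: cvg_comp d0 _; exact: sqrt_continuous.
Qed.

End VectorLimits.

(** The Kalman-Yakubovich-Popov identities make the controller dissipative: the
    power drawn from the boundary velocity y pays for the growth of the storage
    function, up to nonnegative terms. *)
Lemma kyp_dissipation r (k : @controller R r) (z : 'cV[R]_r) (y : R) : controller_ok k ->
  2 * dotv (cA k *m z + y *: cb k) (cP k *m z)
    <= 2 * cd k * y ^+ 2 + 2 * dotv (cc k) z * y.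
Proof.
move=> [_ /andP[d0 dd] _ [[PT Ppos] e0] [E1 E2]].
have dl (x y0 z0 : 'cV[R]_r) : dotv (x + y0) z0 = dotv x z0 + dotv y0 z0.
  exact: (psdDl psd_dotv).
have dz a (x z0 : 'cV[R]_r) : dotv (a *: x) z0 = a * dotv x z0.
  exact: (psdZl (lc_setT _) psd_dotv).
pose q := dotv (cq k) z.
have h1 : 2 * dotv (cA k *m z) (cP k *m z) = - q ^+ 2 - ceps k * dotv z (cP k *m z).
  have e1 : dotv (cA k *m z) (cP k *m z) = dotv ((cP k *m cA k) *m z) z.
    by rewrite -mulmxA [RHS]dotv_mul PT.
  have e2 : dotv (cA k *m z) (cP k *m z) = dotv (((cA k)^T *m cP k) *m z) z.
    by rewrite dotv_mul mulmxA dotvC.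
  have -> : 2 * dotv (cA k *m z) (cP k *m z) = dotv ((cP k *m cA k + (cA k)^T *m cP k) *m z) z.
    by rewrite mulmxDl dl -e1 -e2; ring.
  rewrite E1 mulmxBl mulNmx -scaleN1r -[- (_ *m z)]scaleN1r -scalemxAl.
  rewrite dl !dz [dotv (cP k *m z) z]dotvC.
  have -> : dotv (cq k *m (cq k)^T *m z) z = q ^+ 2.
    rewrite -mulmxA; set v := (cq k)^T *m z.
    have vE : v 0 0 = q by rewrite /v mxE /q /dotv; apply: eq_bigr => i _; rewrite mxE.
    by rewrite [v]mx11_scalar mul_mx_scalar dz vE expr2.
  ring.
have h2 : dotv (cb k) (cP k *m z) = dotv (cc k) z - Num.sqrt (2 * (cd k - cdelta k)) * q.
  have -> : dotv (cb k) (cP k *m z) = dotv (cP k *m cb k) z by rewrite dotv_mul PT.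
  by rewrite E2 -scaleNr dl dz mulNr.
have h3 : 0 <= dotv z (cP k *m z).
  have [->|/Ppos/ltW//] := eqVneq z 0.
  by rewrite /dotv sumr_ge0// => i _; rewrite mxE mul0r.
rewrite dl dz h2 mulrDr h1.
have ks : Num.sqrt (2 * (cd k - cdelta k)) ^+ 2 = 2 * (cd k - cdelta k).
  by rewrite sqr_sqrtr// mulr_ge0// subr_ge0.
set s := Num.sqrt _ in ks *; set c := dotv (cc k) z.
have := mulr_ge0 (ltW e0) h3; have := mulr_ge0 (ltW d0) (sqr_ge0 y); have := sqr_ge0 (q + s * y).
rewrite sqrrD exprMn ks; lra.
Qed.

End OneSided.

(** * Energy of the error *)

Section LinearIdentities.
Context {R : pzRingType} {E : lmodType R}.
Implicit Types x y z : E.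

Lemma subDr x y z : x + z - (y + z) = x - y.
Proof. by rewrite opprD addrACA subrr addr0. Qed.

Lemma subBB x y z t : (x - y) - (z - t) = (x - z) - (y - t).
Proof. by rewrite !opprB addrACA [RHS]addrACA [- y + _]addrC. Qed.

Lemma subBr x y z : (x - z) - (y - z) = x - y.
Proof. exact: subDr. Qed.

Lemma subDB x y z : (x - y) + (y - z) = x - z.
Proof. by rewrite addrA subrK. Qed.

Lemma split_sum x y : x + y = (y + y) + (x - y).
Proof. by rewrite addrACA subrr addr0 addrC. Qed.

Lemma quot_split (c m1 m2 m3 m4 m5 m6 : R) : m6 = m5 + m3 -> m5 = m2 - m4 ->
  c * m1 - (c * (m2 - m4) + c * m3) = c * (m1 - m6).
Proof. by move=> -> ->; rewrite -mulrDr -mulrBr. Qed.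

End LinearIdentities.

Section RealIdentities.
Context {R : realFieldType}.

Lemma rate_sum (a1 a2 a3 b1 b2 l1 l2 l3 q1 q1' q2 q2' ds zm za z1 z2 zl : R) :
  a1 - a2 = - a3 + ds * zm -> b1 - b2 = ds * za -> l1 - l2 = l3 + ds * zl ->
  q1 - q1' = ds * z1 -> q2 - q2' = ds * z2 ->
  a1 + b1 + q1 + q2 + 2 * l1 - (a2 + b2 + q1' + q2' + 2 * l2) =
  - a3 + 2 * l3 + ds * (zm + za + z1 + z2 + 2 * zl).
Proof. lra. Qed.

Lemma power_balance (a l d1 d2 n1 n2 x1 x2 k1 k2 : R) :
  2 * k1 <= 2 * d1 * n1 ^+ 2 + 2 * x1 * n1 -> 2 * k2 <= 2 * d2 * n2 ^+ 2 + 2 * x2 * n2 ->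
  - 2 * (a + l + d1 * n1 * n1 + d2 * n2 * n2 + x1 * n1 + x2 * n2) + (a + a) + 2 * k1 + 2 * k2 + 2 * l <= 0.
Proof. lra. Qed.

Lemma drop_cross (qs q x1 x2 k k0 kk b g : R) : qs + 2 * x1 - (q + 2 * x2) <= k - k0 -> k0 = 0 ->
  k <= kk -> `|x1| <= b -> `|x2| <= b -> kk + 4 * b = g -> qs <= q + g.
Proof. move=> h1 h2 h3; rewrite !ler_norml => /andP[a1 a2] /andP[a3 a4] h4; lra. Qed.

Lemma half_sum (m1 m2 m3 a1 a2 a3 q1 q2 : R) : m1 <= 2 * m2 + 2 * m3 -> a1 <= 2 * a2 + 2 * a3 ->
  0 <= q2 -> 0 <= q1 -> 2^-1 * (m1 + a1 + q1 + q2) <= m2 + a2 + q1 + q2 + m3 + a3.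
Proof. lra. Qed.

End RealIdentities.

(** This resolves S^2 <= q + g S. *)
Lemma absorb_sup (R : rcfType) (S q g : R) : 0 <= S -> 0 <= g -> 0 <= q ->
  S <= Num.sqrt (q + g * S) -> S <= Num.sqrt q + g.
Proof.
move=> S0 g0 q0 hS; have gS : 0 <= q + g * S by rewrite addr_ge0// mulr_ge0.
have S2 : S ^+ 2 <= Num.sqrt q ^+ 2 + g * S.
  by rewrite (sqr_sqrtr q0) -[leRHS](sqr_sqrtr gS) ler_sqr ?nnegrE ?sqrtr_ge0.
have := sqrtr_ge0 q; move: S2; move: (Num.sqrt q) => x S2 x0.
rewrite leNgt; apply/negP => hlt; nra.
Qed.

Section ErrorEquation.
Context {R : realType}.
Local Notation leb := (@lebesgue_measure R).
Local Notation Fn := (R -> R^o).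
Variables (r : nat) (B : @beam R r) (T : R).
Local Notation vec := 'cV[R]_r.
Let L := bL B.
Hypothesis L0 : 0 < L.
Hypothesis T0 : 0 < T.
Hypothesis cmu : continuous_in absR `[0, L] (bmu B).
Hypothesis cLam : continuous_in absR `[0, L] (bLam B).
Hypothesis mu0 : forall x, 0 <= x <= L -> 0 <= bmu B x.
Hypothesis Lam0 : forall x, 0 <= x <= L -> 0 <= bLam B x.
Hypothesis M0 : 0 < bM B.
Hypothesis J0 : 0 < bJ B.
Hypothesis k10 : 0 <= bk1 B.
Hypothesis k20 : 0 <= bk2 B.
Hypothesis ok1 : controller_ok (ctr1 B).
Hypothesis ok2 : controller_ok (ctr2 B).
Variables u v : R -> Fn.
Hypothesis uv : is_time_derivative T (L2 L) (ipL2 L) u v.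
Hypothesis Cu : C_in (Hk0 L 4) (normHk L 4) T u.
Hypothesis Lv : L2_in (Hk0 L 4) (normHk L 4) T v.
Hypothesis Cv : C_in (Hk0 L 2) (normHk L 2) T v.
Variables z1 z2 : R -> vec.
Variables (u0 v0 : @triple R) (z10 z20 : vec).
Hypothesis weak : weak_solution B T u z1 z2 u0 v0 z10 z20.
Variables (P : nat) (w : nat -> Fn).
Hypothesis P0 : (0 < P)%N.
Hypothesis wB : hermite_basis B P w.
Variables (uh vh ah : R -> Fn) (zh1 zh2 : R -> vec) (uh0 vh0 : Fn).
Hypothesis semi : semidiscrete_solution B P uh vh ah zh1 zh2 uh0 vh0 z10 z20.

Local Notation H2 := (Hk L 2).
Local Notation N2 := (snorm (ipHk L 2)).
Local Notation Pi := (nodal_projection B P w).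
Local Notation pv1 f := (pv L 1 f L).
Local Notation pv0 f := (pv L 0 f L).
Definition win t := within `[0, T] (nbhs (t : R)).
#[local] Instance win_filter t : Filter (win t) := within_filter _ _.
Let HL := lc_Hk L0 2.
Let hP := psd_ipHk L0 2.
Let XL := LL L0 : 0 <= L <= L.
Let u4 := u_in Cu.
Let v2 := v_in Cv.

Let wf := weak_facts L0 T0 cmu cLam mu0 Lam0 M0 J0 k10 k20 uv Cu Lv Cv weak.

Let u2 t : 0 <= t <= T -> Hk0 L 2 (u t).
Proof. by move=> tT; apply: (Hk0_le L0 (isT : (2 <= 4)%N)); exact: u4. Qed.

(** The discrete errors e, p of displacement and velocity, and the interpolation
    errors sg, rh: thus uh - u = e + sg and vh - v = p + rh. *)
Let e t : Fn := uh t - Pi (u t).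
Let p t : Fn := vh t - Pi (v t).
Let sg t : Fn := Pi (u t) - u t.
Let rh t : Fn := Pi (v t) - v t.
Let y1 t : vec := zh1 t - z1 t.
Let y2 t : vec := zh2 t - z2 t.

Local Notation bform := (bform B).

Lemma semi_facts : [/\ forall t, 0 <= t -> [/\ Wh B P (uh t), Wh B P (vh t) & Wh B P (ah t)],
  derivative_in N2 `[0, +oo[ uh vh /\ derivative_in N2 `[0, +oo[ vh ah,
  forall t q, 0 < t -> Wh B P q -> mform B (ah t) q = - bform (uh t) (vh t) (zh1 t) (zh2 t) q,
  forall t, 0 < t ->
    cvg_semi t^'+ (@normv R r) (fun s => (s - t)^-1 *: (zh1 s - zh1 t))
      (cA (ctr1 B) *m zh1 t + pv1 (vh t) *: cb (ctr1 B)) /\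
    cvg_semi t^'+ (@normv R r) (fun s => (s - t)^-1 *: (zh2 s - zh2 t))
      (cA (ctr2 B) *m zh2 t + pv0 (vh t) *: cb (ctr2 B)) &
  forall t, 0 <= t <= T -> cvg_semi (win t) (@normv R r) zh1 (zh1 t) /\ cvg_semi (win t) (@normv R r) zh2 (zh2 t)].
Proof.
have [z1t [z2t [[hW duh dvh _] [dz1 dz2 _ _] eqn ode _]]] := semi.
split => //.
- by rewrite -normHkE.
- move=> t q t0 hq; have := eqn t q t0 hq.
  rewrite -pvE -DwE /bform /aform /mform /muf /lamf /wtform /pvf !Dw0 /itg -/L.
  set I1 := \int[_]_(_ in _) _; set I2 := \int[_]_(_ in _) _ => E.
  by apply/eqP; rewrite -subr_eq0 -E; apply/eqP; ring.
- move=> t t0; have [E1 E2] := ode t t0; rewrite -pvE in E1 E2; rewrite -E1 -E2 !normvE.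
  by split; apply: derivative_right => //; exact: ltW.
- move=> t tT; rewrite !normvE.
  by split; [apply: (derivative_cvg (lc_setT _) psd_dotv dz1)|apply: (derivative_cvg (lc_setT _) psd_dotv dz2)].
Qed.

Let uhW t : 0 <= t -> Wh B P (uh t). Proof. by have [H _ _ _ _] := semi_facts; move=> /H[]. Qed.
Let vhW t : 0 <= t -> Wh B P (vh t). Proof. by have [H _ _ _ _] := semi_facts; move=> /H[]. Qed.
Let ahW t : 0 <= t -> Wh B P (ah t). Proof. by have [H _ _ _ _] := semi_facts; move=> /H[]. Qed.
Let WhH2 f : Wh B P f -> H2 f. Proof. by move=> /(Wh_spec L0 P0)[[]]. Qed.
Let Hk0H2 f : Hk0 L 2 f -> H2 f. Proof. by case. Qed.
Let PiH2 f : H2 (Pi f). Proof. exact: (WhH2 (Pi_Wh wB f)). Qed.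

Let eW t : 0 <= t -> Wh B P (e t).
Proof. by move=> t0; apply: (lcB (lc_Wh B P)); [exact: uhW|exact: Pi_Wh]. Qed.
Let pW t : 0 <= t -> Wh B P (p t).
Proof. by move=> t0; apply: (lcB (lc_Wh B P)); [exact: vhW|exact: Pi_Wh]. Qed.
Let eH t : 0 <= t -> H2 (e t). Proof. by move=> /eW/WhH2. Qed.
Let pH t : 0 <= t -> H2 (p t). Proof. by move=> /pW/WhH2. Qed.
Let sgH t : 0 <= t <= T -> H2 (sg t).
Proof. by move=> tT; apply: (lcB HL); [exact: PiH2|exact: Hk0H2 (u2 tT)]. Qed.
Let rhH t : 0 <= t <= T -> H2 (rh t).
Proof. by move=> tT; apply: (lcB HL); [exact: PiH2|exact: Hk0H2 (v2 tT)]. Qed.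

Lemma pvB j (f g : Fn) x : (j < 2)%N -> 0 <= x <= L -> H2 f -> H2 g ->
  pv L j (f - g) x = pv L j f x - pv L j g x.
Proof.
move=> j2 xL hf hg; rewrite addrC -scaleN1r (pv_lin L0 (-1) hg hf j2 xL) mulN1r addrC //.
Qed.

Lemma pvZ j c (f : Fn) x : (j < 2)%N -> 0 <= x <= L -> H2 f ->
  pv L j (c *: f) x = c * pv L j f x.
Proof.
move=> j2 xL hf; rewrite -[c *: f]addr0 (pv_lin L0 c hf HL.1 j2 xL).
by rewrite -(subrr (0 : Fn)) (pvB j2 xL HL.1 HL.1) subrr addr0.
Qed.

(** The free end of the beam is a node. *)
Lemma err_end j (f : Fn) : (j < 2)%N -> Hk0 L 2 f -> pv L j (Pi f - f) L = 0.
Proof.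
move=> j2 hf; rewrite (pvB j2 XL (PiH2 f) (Hk0H2 hf)).
have := Pi_value L0 P0 wB hf j2 (leqnn P); rewrite gridn// => ->.
by rewrite subrr.
Qed.

(** By err_end, interpolation errors only enter through the distributed mass and
    stiffness. *)
Lemma mform_noend f q : (forall j, (j < 2)%N -> pv L j f L = 0) -> mform B f q = muf B f q.
Proof. by move=> f0; rewrite /mform /pvf -/L !f0// !mul0r !mulr0 !addr0. Qed.

Lemma aform_noend f q : (forall j, (j < 2)%N -> pv L j f L = 0) -> aform B f q = lamf B f q.
Proof. by move=> f0; rewrite /aform /pvf -/L !f0// !mul0r !mulr0 !addr0. Qed.

Lemma Pi_lin c (f g : Fn) : Hk0 L 2 f -> Hk0 L 2 g -> Pi (c *: f + g) = c *: Pi f + Pi g.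
Proof.
move=> hf hg; rewrite !nodal_projectionE scaler_sumr -big_split big_seq [RHS]big_seq; apply: eq_bigr => m.
rewrite mem_index_iota ltnS => /andP[_ mP] /=; have mL := grid_in L0 mP.
rewrite !(pv_lin L0 c (Hk0H2 hf) (Hk0H2 hg))// !scalerDl !scalerDr !scalerA.
by rewrite addrACA.
Qed.

Lemma Pi_sub (f g : Fn) : Hk0 L 2 f -> Hk0 L 2 g -> Pi (f - g) = Pi f - Pi g.
Proof. by move=> hf hg; rewrite addrC -scaleN1r Pi_lin// scaleN1r addrC. Qed.

Lemma Pi0 : Pi 0 = 0.
Proof.
have h := (lc_Hk0 L0 (isT : (2 <= 2)%N)).1 : Hk0 L 2 (0 : Fn).
by have := Pi_sub h h; rewrite !subrr.
Qed.

Section PathLimits.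
Variable F : set_system R.
Context {FF : Filter F}.

Lemma cvg_scale (c : R -> R) (c0 : R) (f : Fn) : H2 f -> c @ F --> c0 ->
  cvg_semi F N2 (fun s => c s *: f) (c0 *: f).
Proof.
move=> hf cc0; apply: (@squeeze0 _ _ _ _ _ (fun s => `|c s - c0| * N2 f)).
  by apply: nearW => s; rewrite -scalerBl (snormZ HL hP)// normrM normr_id (ger0_norm (snorm_ge0 _ _)).
rewrite -(mul0r (N2 f)); apply: cvgM; last exact: cvg_cst.
by rewrite -(normr0 R); apply: cvg_norm; apply/subr_cvg0.
Qed.

Lemma cvg_semi_sum (l : seq nat) (f g : nat -> Fn) (c d : nat -> R -> R) (c0 d0 : nat -> R) :
  {in l, forall m, [/\ H2 (f m), H2 (g m), c m @ F --> c0 m & d m @ F --> d0 m]} ->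
  cvg_semi F N2 (fun s => \sum_(m <- l) (c m s *: f m + d m s *: g m)) (\sum_(m <- l) (c0 m *: f m + d0 m *: g m)).
Proof.
elim: l => [|m l IH] H.
  have := @cvg_semi_cst R _ H2 HL R F FF _ _ hP HL.1; rewrite /cvg_semi.
  rewrite big_nil => c1; apply: cvg_trans c1; apply: near_eq_cvg; apply: nearW => s /=.
  by rewrite big_nil.
have [hf hg cf cg] := H m (mem_head _ _).
have Hl : {in l, forall m, [/\ H2 (f m), H2 (g m), c m @ F --> c0 m & d m @ F --> d0 m]}.
  by move=> i il; apply: H; rewrite inE il orbT.
have HS (c' d' : nat -> R) : H2 (\sum_(m <- l) (c' m *: f m + d' m *: g m)).
  rewrite big_seq; elim/big_rec : _ => [|i x il hx]; first exact: HL.1.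
  have [hi gi _ _] := Hl i il; apply: (lcD HL) => //.
  by apply: (lcD HL); exact: (lcZ HL).
have lin (x y : R -> Fn) (x0 y0 : Fn) : H2 x0 -> H2 y0 -> (forall s, H2 (x s)) -> (forall s, H2 (y s)) ->
    cvg_semi F N2 x x0 -> cvg_semi F N2 y y0 -> cvg_semi F N2 (fun s => 1 *: x s + y s) (1 *: x0 + y0).
  by move=> hx0 hy0 hx hy; apply: (cvg_semi_lin HL 1 hP) => //; exact: nearW.
have c1 := lin _ _ _ _ (lcZ HL _ hf) (lcZ HL _ hg) (fun s => lcZ HL (c m s) hf)
   (fun s => lcZ HL (d m s) hg) (cvg_scale hf cf) (cvg_scale hg cg).
have c2 := lin _ _ _ _ (lcD HL (lcZ HL 1 (lcZ HL _ hf)) (lcZ HL _ hg)) (HS c0 d0)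
   (fun s => lcD HL (lcZ HL 1 (lcZ HL (c m s) hf)) (lcZ HL (d m s) hg))
   (fun s => HS (c^~ s) (d^~ s)) c1 (IH Hl).
move: c2; rewrite /cvg_semi big_cons !scale1r.
apply: cvg_trans; apply: near_eq_cvg; apply: nearW => s /=.
by rewrite big_cons !scale1r.
Qed.

(** Pi f depends on finitely many point values of f only, so no bound on its norm is
    involved. *)
Lemma Pi_cvg (f : R -> Fn) (g : Fn) :
  (forall j x, (j < 2)%N -> 0 <= x <= L -> (fun s => pv L j (f s) x) @ F --> pv L j g x) ->
  cvg_semi F N2 (fun s => Pi (f s)) (Pi g).
Proof.
move=> H; rewrite nodal_projectionE.
have -> : (fun s => Pi (f s)) = (fun s => \sum_(1 <= m < P.+1) (pv L 0 (f s) (grid L P m) *: w (2 * m - 1)%N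
   + pv L 1 (f s) (grid L P m) *: w (2 * m)%N)) by apply/funext => s; rewrite nodal_projectionE.
apply: (cvg_semi_sum (l := index_iota 1 P.+1) (f := fun m => w (2 * m - 1)%N) (g := fun m => w (2 * m)%N)
  (c := fun m s => pv L 0 (f s) (grid L P m)) (d := fun m s => pv L 1 (f s) (grid L P m))
  (c0 := fun m => pv L 0 g (grid L P m)) (d0 := fun m => pv L 1 g (grid L P m))) => m.
rewrite mem_index_iota => mP; have [h1 h2] := basis_Wh wB mP.
have mL : 0 <= grid L P m <= L by apply: (grid_in L0); case/andP: mP.
by split; [exact: WhH2|exact: WhH2|exact: H|exact: H].
Qed.

End PathLimits.

Lemma near_win t (Q : R -> Prop) : (forall s, 0 <= s <= T -> Q s) -> \forall s \near win t, Q s.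
Proof. by move=> H; apply/within_ball; exists 1 => // s; rewrite /= in_itv => /H. Qed.

Lemma near_rt t (Q : R -> Prop) : 0 <= t -> t < T -> (forall s, 0 <= s <= T -> Q s) -> \forall s \near t^'+, Q s.
Proof. by move=> t0 tT H; apply: (right_within t0 tT); exact: near_win. Qed.

Lemma cont_win (f : R -> R) t : continuous_in absR `[0, T] f -> 0 <= t <= T -> f @ win t --> f t.
Proof.
move=> cf tT; apply/subr_cvg0; have := cf t; rewrite /= in_itv => /(_ tT) H.
by apply: (squeeze0 _ H); apply: nearW => s; exact: lexx.
Qed.

Lemma win_cont (f : R -> R) : (forall t, 0 <= t <= T -> f @ win t --> f t) -> continuous_in absR `[0, T] f.
Proof.
move=> H t; rewrite /= in_itv => tT; have /subr_cvg0 h := H t tT.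
apply: (squeeze0 _ (_ : (fun s => `|f s - f t|) @ win t --> (0 : R))).
  by apply: nearW => s; rewrite /absR normr_id.
by rewrite -(normr0 R); exact: cvg_norm.
Qed.

Let v_pv_cont j x : (j < 2)%N -> 0 <= x <= L -> continuous_in absR `[0, T] (fun t => pv L j (v t) x).
Proof.
move=> j2 xL; apply: (v_cont L0 Cv (l := fun f => pv L j f x) (c := valbnd L)).
- by move=> c f g /Hk0H2 hf /Hk0H2 hg; exact: (pv_lin L0 c hf hg j2 xL).
- by move=> f /Hk0H2 hf; exact: (value_bnd L0 j2 hf xL).
Qed.

Let cvg_sub (F : set_system R) (FF : Filter F) (f g : R -> Fn) x y : H2 x -> H2 y ->
  (\forall s \near F, H2 (f s)) -> (\forall s \near F, H2 (g s)) ->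
  cvg_semi F N2 f x -> cvg_semi F N2 g y -> cvg_semi F N2 (fun s => f s - g s) (x - y).
Proof.
move=> hx hy hf hg cf cg.
have : cvg_semi F N2 (fun s => -1 *: g s + f s) (-1 *: y + x) by exact: (cvg_semi_lin HL (-1) hP).
rewrite /cvg_semi; apply: cvg_trans; apply: near_eq_cvg; apply: nearW => s /=.
by rewrite !scaleN1r ![- _ + _]addrC.
Qed.

Section AtTime.
Variable t : R.
Hypothesis tT : 0 <= t <= T.

Let t0 : 0 <= t. Proof. by case/andP: tT. Qed.

Lemma cvg_u : cvg_semi (win t) N2 u (u t).
Proof.
have := cont_in_cvg Cu.2 tT; rewrite /cvg_semi => H; apply: (squeeze0 _ H).
apply: nearW => s; rewrite ger0_norm ?snorm_ge0// -normHkE.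
exact: normHk_le.
Qed.

Lemma cvg_Piu : cvg_semi (win t) N2 (fun s => Pi (u s)) (Pi (u t)).
Proof.
apply: Pi_cvg => j x j2 xL; apply: cont_win tT.
exact: is_prim_cont (u_prim_pv L0 T0 uv Cu Lv Cv j2 xL).
Qed.

Lemma cvg_Piv : cvg_semi (win t) N2 (fun s => Pi (v s)) (Pi (v t)).
Proof. by apply: Pi_cvg => j x j2 xL; apply: cont_win tT; exact: v_pv_cont. Qed.

Lemma cvg_e : cvg_semi (win t) N2 e (e t).
Proof.
have [_ [duh _] _ _ _] := semi_facts.
have hU s : 0 <= s -> H2 (uh s) /\ H2 (vh s) by move=> s0; split; apply: WhH2; [exact: uhW|exact: vhW].
apply: cvg_sub; [exact: (hU t t0).1|exact: PiH2| | | |exact: cvg_Piu].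
- by apply: near_win => s /andP[s0 _]; exact: (hU s s0).1.
- by apply: near_win => s _; exact: PiH2.
- exact: (derivative_cvg HL hP duh hU tT).
Qed.

Lemma cvg_p : cvg_semi (win t) N2 p (p t).
Proof.
have [_ [_ dvh] _ _ _] := semi_facts.
have hV s : 0 <= s -> H2 (vh s) /\ H2 (ah s) by move=> s0; split; apply: WhH2; [exact: vhW|exact: ahW].
apply: cvg_sub; [exact: (hV t t0).1|exact: PiH2| | | |exact: cvg_Piv].
- by apply: near_win => s /andP[s0 _]; exact: (hV s s0).1.
- by apply: near_win => s _; exact: PiH2.
- exact: (derivative_cvg HL hP dvh hV tT).
Qed.

Lemma cvg_sg : cvg_semi (win t) N2 sg (sg t).
Proof.
apply: cvg_sub; [exact: PiH2|exact: Hk0H2 (u2 tT)| | |exact: cvg_Piu|exact: cvg_u].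
- by apply: near_win => s _; exact: PiH2.
- by apply: near_win => s sT; exact: Hk0H2 (u2 sT).
Qed.

Lemma cvg_y : cvg_semi (win t) (@normv R r) y1 (y1 t) /\ cvg_semi (win t) (@normv R r) y2 (y2 t).
Proof.
have [_ _ _ _ H] := semi_facts; have [h1 h2] := H t tT.
have [Cz1 Cz2 _ _ _] := wf.
split; apply/cvg_vec => q.
- under eq_fun do rewrite (psdBl (lc_setT _) (@psd_dotv R r) I I I).
  rewrite (psdBl (lc_setT _) (@psd_dotv R r) I I I); apply: cvgB; first by apply/cvg_vec : q.
  by apply: cont_win tT; exact: z_cont_r.
- under eq_fun do rewrite (psdBl (lc_setT _) (@psd_dotv R r) I I I).
  rewrite (psdBl (lc_setT _) (@psd_dotv R r) I I I); apply: cvgB; first by apply/cvg_vec : q.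
  by apply: cont_win tT; exact: z_cont_r.
Qed.

End AtTime.

Lemma snorm_bounded (E : lmodType R) (X : set E) (b : E -> E -> R) (f : R -> E) : lin_closed X -> psd X b ->
  (forall t, 0 <= t <= T -> X (f t)) -> continuous_in (snorm b) `[0, T] f ->
  exists2 K : R, 0 <= K & forall t, 0 <= t <= T -> snorm b (f t) <= K.
Proof.
move=> XL' bP Xf cf; have [|K K0 H] := @cont_bnd R 0 T (fun t => snorm b (f t)).
  apply: win_cont => t tT; apply/subr_cvg0; apply: (squeeze0 _ (cont_in_cvg cf tT)).
  by apply: near_win => s sT; apply: (snorm_dist XL' bP); exact: Xf.
by exists K => // t tT; apply: le_trans (ler_norm _) (H t tT).
Qed.

Let pm := psd_mform L0 cmu mu0 (ltW M0) (ltW J0).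
Let pa := psd_aform L0 cLam Lam0 k10 k20.
Let pl := psd_lamf L0 cLam Lam0.
Let pmu := psd_muf L0 cmu mu0.

(** Uniformity in the test function makes the momentum of v Lipschitz in time for the
    dual norm. *)
Lemma gform_bnd : exists2 K : R, 0 <= K & forall s q, 0 <= s <= T -> H2 q ->
  `|gform B u v z1 z2 s q| <= K * N2 q.
Proof.
have [c c0 bc] := h2b_bounded L0 pa (h2b_aform L0 cLam k10 k20).
have [Ku Ku0 uK] : exists2 K : R, 0 <= K & forall s, 0 <= s <= T -> N2 (u s) <= K.
  apply: (snorm_bounded HL hP); first by move=> s sT; exact: Hk0H2 (u2 sT).
  by move=> s; rewrite /= in_itv => sT; exact: (cvg_u sT).
have [K1 K10 H1] := cont_bnd (v_pv_cont (isT : (1 < 2)%N) XL).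
have [K2 K20 H2'] := cont_bnd (v_pv_cont (isT : (0 < 2)%N) XL).
have [Cz1 Cz2 _ _ _] := wf.
have [K3 K30 H3] := cont_bnd (z_cont (cc (ctr1 B)) Cz1).
have [K4 K40 H4] := cont_bnd (z_cont (cc (ctr2 B)) Cz2).
have V0 := valbnd_ge0 L0.
exists (c * Ku + `|cd (ctr1 B)| * K1 * valbnd L + `|cd (ctr2 B)| * K2 * valbnd L + K3 * valbnd L + K4 * valbnd L).
  by rewrite !addr_ge0 ?mulr_ge0.
move=> s q sT hq.
have q1 : `|pv1 q| <= valbnd L * N2 q by rewrite -normHkE; exact: (value_bnd L0 (isT : (1 < 2)%N) hq XL).
have q0 : `|pv0 q| <= valbnd L * N2 q by rewrite -normHkE; exact: (value_bnd L0 (isT : (0 < 2)%N) hq XL).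
have N0 := snorm_ge0 (ipHk L 2) q.
have ha : `|aform B (u s) q| <= c * Ku * N2 q.
  apply: le_trans (bc _ _ (Hk0H2 (u2 sT)) hq) _; rewrite -mulrA; apply: ler_wpM2l => //.
  by apply: ler_wpM2r => //; exact: uK.
have hb (d x y K : R) : 0 <= K -> `|x| <= K -> `|y| <= valbnd L * N2 q -> `|d * x * y| <= `|d| * K * valbnd L * N2 q.
  move=> K0 hx hy; rewrite !normrM -mulrA -[leRHS]mulrA -[leRHS]mulrA; apply: ler_wpM2l => //.
  by apply: ler_pM.
have hc (x y K : R) : 0 <= K -> `|x| <= K -> `|y| <= valbnd L * N2 q -> `|x * y| <= K * valbnd L * N2 q.
  by move=> K0 hx hy; rewrite normrM -mulrA; apply: ler_pM.
have h1 := hb (cd (ctr1 B)) _ _ _ K10 (H1 s sT) q1.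
have h2 := hb (cd (ctr2 B)) _ _ _ K20 (H2' s sT) q0.
have h3 := hc _ _ _ K30 (H3 s sT) q1.
have h4 := hc _ _ _ K40 (H4 s sT) q0.
rewrite /gform /bform !mulrDl; do 4 (apply: le_trans (ler_normD _ _) _; apply: lerD => //).
Qed.

Lemma bform_sub (f f' g g' : Fn) x x' y y' q : H2 f -> H2 f' -> H2 g -> H2 g' -> H2 q ->
  bform f g x y q - bform f' g' x' y' q = bform (f - f') (g - g') (x - x') (y - y') q.
Proof.
move=> hf hf' hg hg' hq; rewrite /bform (psdBl HL pa hf hf' hq) !pvB//.
rewrite ![dotv _ (_ - _)]dotvC !(psdBl (lc_setT _) (@psd_dotv R r) I I I).
rewrite ![dotv _ (cc _)]dotvC; ring.
Qed.

Lemma bform_dbl (f g : Fn) x y q : H2 f -> H2 q -> bform f g x y (q + q) = 2 * bform f g x y q.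
Proof.
move=> hf hq; rewrite /bform (psdDr HL pa hf hq hq).
have E j : (j < 2)%N -> pv L j (q + q) L = 2 * pv L j q L.
  by move=> j2; rewrite -{1}[q]scale1r (pv_lin L0 1 hq hq j2 XL); ring.
rewrite !E//; ring.
Qed.

Lemma psd_quad (k : @controller R r) : controller_ok k -> psd setT (fun x y => dotv x (cP k *m y)).
Proof.
move=> [_ _ _ [[PT Pp] _] _]; split.
- by move=> a x y z _ _ _; exact: dotv_lin.
- by move=> x y _ _; rewrite -{2}PT -dotv_mul dotvC.
- move=> x _; have [->|/Pp/ltW//] := eqVneq x 0.
  by rewrite /dotv sumr_ge0// => i _; rewrite mxE mul0r.
Qed.

Lemma psd_diff_sqr (E : lmodType R) (X : set E) (b : E -> E -> R) x y : lin_closed X -> psd X b ->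
  X x -> X y -> b x x - b y y = b (x - y) (x + y).
Proof.
move=> XL' bP hx hy; have hxy := lcD XL' hx hy.
rewrite (psdBl XL' bP hx hy hxy) (psdDr XL' bP hx hx hy) (psdDr XL' bP hy hx hy).
by rewrite (psd_sym bP hy hx); ring.
Qed.

Let Qen s := mform B (p s) (p s) + aform B (e s) (e s) + dotv (y1 s) (cP (ctr1 B) *m y1 s)
  + dotv (y2 s) (cP (ctr2 B) *m y2 s).
Let Fen s := Qen s + 2 * lamf B (sg s) (e s).

Section RightLimits.
Variable t : R.
Hypothesis t0 : 0 < t.
Hypothesis tT : t < T.

Let tT' : 0 <= t <= T. Proof. by rewrite !ltW. Qed.
Let rw := right_within (ltW t0) tT.

Let vt_pv j : (j < 2)%N -> pv L j (vh t) L - pv L j (v t) L = pv L j (p t) L.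
Proof.
move=> j2; rewrite (pvB j2 XL (WhH2 (vhW (ltW t0))) (PiH2 _)); congr (_ - _).
have := err_end j2 (v2 tT'); rewrite (pvB j2 XL (PiH2 _) (Hk0H2 (v2 tT'))); lra.
Qed.

Lemma cvg_quot_e : cvg_semi t^'+ N2 (fun s => (s - t)^-1 *: (e s - e t)) (p t).
Proof.
have [_ [duh _] _ _ _] := semi_facts.
have c1 : cvg_semi t^'+ N2 (fun s => (s - t)^-1 *: (uh s - uh t)) (vh t).
  exact: (derivative_right duh (ltW t0)).
have c2 : cvg_semi t^'+ N2 (fun s => Pi ((s - t)^-1 *: (u s - u t))) (Pi (v t)).
  apply: Pi_cvg => j x j2 xL.
  have pp := u_prim_pv L0 T0 uv Cu Lv Cv j2 xL.
  have c := is_prim_right (v_pv_cont j2 xL) pp (ltW t0) tT.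
  apply: cvg_trans c; apply: near_eq_cvg; apply: (near_rt (ltW t0) tT) => s sT.
  have hs := Hk0H2 (u2 sT); have ht := Hk0H2 (u2 tT').
  by rewrite (pvZ _ j2 xL (lcB HL hs ht)) pvB.
have c3 : cvg_semi t^'+ N2 (fun s => (s - t)^-1 *: (uh s - uh t) - Pi ((s - t)^-1 *: (u s - u t))) (p t).
  apply: cvg_sub c1 c2; [exact: WhH2 (vhW (ltW t0))|exact: PiH2| |].
    apply: (near_rt (ltW t0) tT) => s /andP[s0 _]; apply: (lcZ HL); apply: (lcB HL); apply: WhH2; apply: uhW => //; exact: ltW.
  by apply: (near_rt (ltW t0) tT) => s _; exact: PiH2.
rewrite /cvg_semi; apply: cvg_trans c3; apply: near_eq_cvg; apply: (near_rt (ltW t0) tT) => s sT.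
have hs := u2 sT; have ht := u2 tT'.
have E : Pi ((s - t)^-1 *: (u s - u t)) = (s - t)^-1 *: (Pi (u s) - Pi (u t)).
  have Y2 := lc_Hk0 L0 (isT : (2 <= 2)%N).
  rewrite -[(s - t)^-1 *: (u s - u t)]addr0 (Pi_lin _ (lcB Y2 hs ht) Y2.1) (Pi_sub hs ht).
  by rewrite Pi0 addr0.
by rewrite E -scalerBr (subBB (uh s) (uh t)).
Qed.

(** The balance of momentum of the error, as a right limit. The test function p s + p t
    varies with s, while the weak equation is known for fixed test functions only:
    it is replaced by p t + p t at the expense of a term that gform_bnd bounds by a
    multiple of the norm of p s - p t. *)
Lemma cvg_mform : (fun s => (s - t)^-1 * mform B ((vh s - v s) - (vh t - v t)) (p s + p t)) @ t^'+ -->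
  - 2 * bform (uh t - u t) (vh t - v t) (y1 t) (y2 t) (p t).
Proof.
have [_ [_ dvh] eqn _ _] := semi_facts.
have [Cz1 Cz2 wk _ _] := wf.
have [c c0 bc] := h2b_bounded L0 pm (h2b_mform L0 cmu (ltW M0) (ltW J0)).
have hp := pH (ltW t0); have hpp := lcD HL hp hp.
have hvh s : 0 <= s <= T -> H2 (vh s) by move=> /andP[s0 _]; exact: WhH2 (vhW s0).
have hv s : 0 <= s <= T -> H2 (v s) by move=> sT; exact: Hk0H2 (v2 sT).
have hpw s : 0 <= s <= T -> H2 (p s + p t) by move=> /andP[s0 _]; exact: (lcD HL (pH s0) hp).
have cw : cvg_semi t^'+ N2 (fun s => p s + p t) (p t + p t).
  have cp := cvg_semi_finer rw (cvg_p tT').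
  apply: (squeeze0 _ cp); apply: nearW => s; rewrite ger0_norm ?snorm_ge0//.
  by rewrite (subDr (p s) (p t) (p t)); exact: lexx.

have c1 : (fun s => mform B ((s - t)^-1 *: (vh s - vh t)) (p s + p t)) @ t^'+ --> mform B (ah t) (p t + p t).
  apply: (cvg_form HL hP pm bc) (derivative_right dvh (ltW t0)) cw => //.
  - exact: WhH2 (ahW (ltW t0)).
  - by apply: (near_rt (ltW t0) tT) => s sT; apply: (lcZ HL); apply: (lcB HL); exact: hvh.
  - exact: (near_rt (ltW t0) tT).

have c2 : (fun s => (s - t)^-1 * (mform B (v s) (p t + p t) - mform B (v t) (p t + p t))) @ t^'+ -->
    - gform B u v z1 z2 t (p t + p t).
  have hW0 : Hk0 L 2 (p t + p t).
    by have [h _ _] := Wh_spec L0 P0 (lcD (lc_Wh B P) (pW (ltW t0)) (pW (ltW t0))).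
  apply: is_prim_right (wk _ hW0) (ltW t0) tT.
  by apply: (gform_cont L0 cLam Lam0 k10 k20 Cu Cv) => //; exact: Hk0H2 hW0.
have [K K0 gK] := gform_bnd.
(* the cost of freezing the test function *)
have c3 : (fun s => (s - t)^-1 * mform B (v s - v t) (p s - p t)) @ t^'+ --> (0 : R).
  have cp := cvg_semi_finer rw (cvg_p tT').
  apply: (@squeeze0 _ _ _ _ _ (fun s => K * N2 (p s - p t))).
    have h : \forall s \near t^'+, t < s <= T.
      apply: filterS2 (near_rt (ltW t0) tT (fun s (sT : 0 <= s <= T) => sT)) (nbhs_right_gt t) => s /andP[_ sT] ts.
      by rewrite ts.
    apply: filterS h => s /andP[ts sT].
    have st : 0 < s - t by rewrite subr_gt0.
    have sT2 : 0 <= s <= T by rewrite sT andbT ltW// (lt_trans t0).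
    have hq : Hk0 L 2 (p s - p t).
      have [h _ _] := Wh_spec L0 P0 (lcB (lc_Wh B P) (pW (andP sT2).1) (pW (ltW t0))); exact: h.
    rewrite (psdBl HL pm (hv s sT2) (hv t tT') (Hk0H2 hq)).
    rewrite (is_prim_diff (wk _ hq) (ltW t0) (ltW ts) sT) normrM ger0_norm ?invr_ge0 ?(ltW st)//.
    rewrite ler_pdivrMl// mulrC.
    have i0 : intble t s (fun x => - gform B u v z1 z2 x (p s - p t)).
      exact: (L2on_int (L2on_sub (ltW t0) sT (wk _ hq).1)).
    apply: le_trans (le_norm_itg i0) _; rewrite -(itg_cst _ (ltW ts)); apply: le_itg.
    - exact: intble_norm.
    - exact: intble_cst.
    - move=> x /andP[tx xs]; rewrite normrN; apply: gK; last exact: Hk0H2 hq.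
      by rewrite (le_trans (ltW t0) tx) (le_trans xs sT).
  by rewrite -(mulr0 K); apply: cvgM => //; exact: cvg_cst.
have hWpp : Wh B P (p t + p t) by exact: (lcD (lc_Wh B P) (pW (ltW t0)) (pW (ltW t0))).
have -> : - 2 * bform (uh t - u t) (vh t - v t) (y1 t) (y2 t) (p t) =
   mform B (ah t) (p t + p t) - (- gform B u v z1 z2 t (p t + p t) + 0).
  rewrite (eqn _ _ t0 hWpp).
  have -> : gform B u v z1 z2 t (p t + p t) = bform (u t) (v t) (z1 t) (z2 t) (p t + p t) by [].
  have E := bform_sub (zh1 t) (z1 t) (zh2 t) (z2 t) (WhH2 (uhW (ltW t0))) (Hk0H2 (u2 tT')) (hvh t tT') (hv t tT') hpp.
  have E2 := bform_dbl (vh t - v t) (y1 t) (y2 t) (lcB HL (WhH2 (uhW (ltW t0))) (Hk0H2 (u2 tT'))) hp.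
  move: E2; rewrite -E; lra.
have c4 : (fun s => mform B ((s - t)^-1 *: (vh s - vh t)) (p s + p t) -
    ((s - t)^-1 * (mform B (v s) (p t + p t) - mform B (v t) (p t + p t)) +
     (s - t)^-1 * mform B (v s - v t) (p s - p t))) @ t^'+ -->
   mform B (ah t) (p t + p t) - (- gform B u v z1 z2 t (p t + p t) + 0).
  by apply: cvgB => //; apply: cvgD.
apply: cvg_trans c4; apply: near_eq_cvg; apply: (near_rt (ltW t0) tT) => s sT.
have h1 := hvh s sT; have h2 := hvh t tT'; have h3 := hv s sT; have h4 := hv t tT'; have h5 := hpw s sT.
have hps : H2 (p s) by apply: pH; case/andP: sT.
have E1 := subBB (vh s) (v s) (vh t) (v t).
have E2 := psdDr HL pm (lcB HL h3 h4) hpp (lcB HL hps hp).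
rewrite -(split_sum (p s) (p t)) in E2.
rewrite E1 (psdBl HL pm (lcB HL h1 h2) (lcB HL h3 h4) h5) (psdZl HL pm _ (lcB HL h1 h2) h5).
exact: (quot_split _ _ E2 (psdBl HL pm h3 h4 hpp)).
Qed.

Lemma cvg_quad (k : @controller R r) (y : R -> vec) (dy : vec) :
  cvg_semi t^'+ (@normv R r) (fun s => (s - t)^-1 *: (y s - y t)) dy ->
  cvg_semi (win t) (@normv R r) y (y t) ->
  (fun s => dotv ((s - t)^-1 *: (y s - y t)) (cP k *m (y s + y t))) @ t^'+ --> dotv dy (cP k *m (y t + y t)).
Proof.
move=> cdy cy.
have bd : bounded_by (setT : set vec) (snorm (@dotv R r)) (@dotv R r) 1.
  by move=> x x' _ _; rewrite mul1r; exact: dotv_CS.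
have cPy : cvg_semi t^'+ (snorm (@dotv R r)) (fun s => cP k *m (y s + y t)) (cP k *m (y t + y t)).
  apply/cvg_vec => q; rewrite dotv_mul (psdDl (@psd_dotv R r) I I I).
  under eq_fun do rewrite dotv_mul (psdDl (@psd_dotv R r) I I I).
  apply: cvgD; last exact: cvg_cst.
  by have /cvg_vec h := cvg_semi_finer rw cy; exact: h.
by apply: (cvg_form (lc_setT _) (@psd_dotv R r) (@psd_dotv R r) bd) cdy cPy => //; exact: nearW.
Qed.

Lemma cvg_quot_y :
  cvg_semi t^'+ (@normv R r) (fun s => (s - t)^-1 *: (y1 s - y1 t)) (cA (ctr1 B) *m y1 t + pv1 (p t) *: cb (ctr1 B)) /\
  cvg_semi t^'+ (@normv R r) (fun s => (s - t)^-1 *: (y2 s - y2 t)) (cA (ctr2 B) *m y2 t + pv0 (p t) *: cb (ctr2 B)).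
Proof.
have [_ _ _ dz _] := semi_facts; have [d1 d2] := dz t t0.
have [Cz1 Cz2 _ w1 w2] := wf.
have gen (k : @controller R r) (zh z : R -> vec) (a1 a2 a3 : R -> R) : C_in setT normv T z ->
   cvg_semi t^'+ (@normv R r) (fun s => (s - t)^-1 *: (zh s - zh t)) (cA k *m zh t + a1 t *: cb k) ->
   (forall q, is_prim 0 T (fun t => dotv (z t) q) (fun t => dotv (cA k *m z t + a2 t *: cb k) q)) ->
   continuous_in absR `[0, T] a2 -> a1 t - a2 t = a3 t ->
   cvg_semi t^'+ (@normv R r) (fun s => (s - t)^-1 *: ((zh s - z s) - (zh t - z t))) (cA k *m (zh t - z t) + a3 t *: cb k).
  move=> Cz d pz ca <-; apply/cvg_vec => q.
  have c1 : (fun s => dotv ((s - t)^-1 *: (zh s - zh t)) q) @ t^'+ --> dotv (cA k *m zh t + a1 t *: cb k) q.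
    by apply/cvg_vec : q.
  have ca' := ode_cont k q Cz ca.
  have c2 := is_prim_right ca' (pz q) (ltW t0) tT.
  have : (fun s => dotv ((s - t)^-1 *: (zh s - zh t)) q - (s - t)^-1 * (dotv (z s) q - dotv (z t) q)) @ t^'+ -->
     dotv (cA k *m zh t + a1 t *: cb k) q - dotv (cA k *m z t + a2 t *: cb k) q by exact: (cvgB c1 c2).
  have -> : dotv (cA k *m zh t + a1 t *: cb k) q - dotv (cA k *m z t + a2 t *: cb k) q =
     dotv (cA k *m (zh t - z t) + (a1 t - a2 t) *: cb k) q.
    rewrite -(psdBl (lc_setT _) (@psd_dotv R r) I I I); congr dotv.
    by rewrite mulmxBr scalerBl opprD addrACA.
  apply: cvg_trans; apply: near_eq_cvg; apply: nearW => s /=.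
  rewrite !(psdZl (lc_setT _) (@psd_dotv R r) _ I I) !(psdBl (lc_setT _) (@psd_dotv R r) I I I); ring.
split.
- exact: (gen (ctr1 B) zh1 z1 (fun s => pv1 (vh s)) (fun s => pv1 (v s)) (fun s => pv1 (p s)) Cz1 d1 w1 (v_pv_cont (isT : (1 < 2)%N) XL) (vt_pv (isT : (1 < 2)%N))).

- exact: (gen (ctr2 B) zh2 z2 (fun s => pv0 (vh s)) (fun s => pv0 (v s)) (fun s => pv0 (p s)) Cz2 d2 w2 (v_pv_cont (isT : (0 < 2)%N) XL) (vt_pv (isT : (0 < 2)%N))).
Qed.

Lemma kinetic_rate s : t < s -> s <= T -> mform B (p s) (p s) - mform B (p t) (p t) =
  - muf B (rh s - rh t) (p s + p t) +
  (s - t) * ((s - t)^-1 * mform B ((vh s - v s) - (vh t - v t)) (p s + p t)).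
Proof.
move=> ts sT; have st : s - t != 0 by rewrite subr_eq0 gt_eqF.
have sT2 : 0 <= s <= T by rewrite sT (ltW (lt_trans t0 ts)).
have hs : H2 (p s) by apply: pH; case/andP: sT2.
have ht : H2 (p t) := pH (ltW t0); have hq := lcD HL hs ht.
have hV x : 0 <= x <= T -> H2 (vh x - v x).
  by move=> xT; apply: (lcB HL); [apply/WhH2/vhW; case/andP: xT|exact: Hk0H2 (v2 xT)].
have hVV := lcB HL (hV s sT2) (hV t tT'); have hrr := lcB HL (rhH sT2) (rhH tT').
have rr0 j : (j < 2)%N -> pv L j (rh s - rh t) L = 0.
  by move=> j2; rewrite (pvB j2 XL (rhH sT2) (rhH tT')) (err_end j2 (v2 sT2)) (err_end j2 (v2 tT')) subrr.
rewrite (psd_diff_sqr HL pm hs ht) mulrA mulfV// mul1r -(mform_noend _ rr0).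
have := psdBl HL pm hVV hrr hq.
rewrite (subBB (vh s - v s) (vh t - v t) (rh s) (rh t)).
rewrite (subBr (vh s) (Pi (v s)) (v s)) (subBr (vh t) (Pi (v t)) (v t)) => ->.
by rewrite addrC.
Qed.

Lemma elastic_rate s : t < s -> s <= T -> aform B (e s) (e s) - aform B (e t) (e t) =
  (s - t) * aform B ((s - t)^-1 *: (e s - e t)) (e s + e t).
Proof.
move=> ts sT; have st : s - t != 0 by rewrite subr_eq0 gt_eqF.
have hs : H2 (e s) := eH (ltW (lt_trans t0 ts)); have ht : H2 (e t) := eH (ltW t0).
rewrite (psd_diff_sqr HL pa hs ht) (psdZl HL pa _ (lcB HL hs ht) (lcD HL hs ht)).
by rewrite mulrA mulfV// mul1r.
Qed.

Lemma cross_rate s : t < s -> s <= T -> lamf B (sg s) (e s) - lamf B (sg t) (e t) =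
  lamf B (sg s - sg t) (e t) + (s - t) * lamf B (sg s) ((s - t)^-1 *: (e s - e t)).
Proof.
move=> ts sT; have st : s - t != 0 by rewrite subr_eq0 gt_eqF.
have sT2 : 0 <= s <= T by rewrite sT (ltW (lt_trans t0 ts)).
have hs : H2 (e s) := eH (ltW (lt_trans t0 ts)); have ht : H2 (e t) := eH (ltW t0).
rewrite (psdZr HL pl _ (sgH sT2) (lcB HL hs ht)) mulrA mulfV// mul1r.
rewrite (psdBr HL pl (sgH sT2) hs ht) (psdBl HL pl (sgH sT2) (sgH tT') ht).
by rewrite [RHS]addrC subDB.
Qed.

Lemma storage_rate (k : @controller R r) (y : R -> vec) s : controller_ok k -> t < s ->
  dotv (y s) (cP k *m y s) - dotv (y t) (cP k *m y t) =
  (s - t) * dotv ((s - t)^-1 *: (y s - y t)) (cP k *m (y s + y t)).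
Proof.
move=> ok ts; have st : s - t != 0 by rewrite subr_eq0 gt_eqF.
rewrite (psd_diff_sqr (lc_setT _) (psd_quad ok) I I) (psdZl (lc_setT _) (psd_quad ok) _ I I).
by rewrite mulrA mulfV// mul1r.
Qed.

(** Right increments of the modified energy. The energy does not control the elastic
    form of sg against p, as it contains no second derivative of p; adding the cross
    term 2 lamf sg e moves the time derivative onto sg. What remains is the increment
    of the interpolation errors and a slope Z whose limit is nonpositive: the powers
    of inertia and elasticity cancel, and the controllers dissipate. *)
Lemma energy_rate : exists2 Z : R -> R, (exists2 Z0 : R, Z0 <= 0 & Z @ t^'+ --> Z0) &
  forall s, t < s -> s <= T -> Fen s - Fen t =
    (- muf B (rh s - rh t) (p s + p t) + 2 * lamf B (sg s - sg t) (e t)) + (s - t) * Z s.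
Proof.
pose zm s := (s - t)^-1 * mform B ((vh s - v s) - (vh t - v t)) (p s + p t).
pose za s := aform B ((s - t)^-1 *: (e s - e t)) (e s + e t).
pose zq1 s := dotv ((s - t)^-1 *: (y1 s - y1 t)) (cP (ctr1 B) *m (y1 s + y1 t)).
pose zq2 s := dotv ((s - t)^-1 *: (y2 s - y2 t)) (cP (ctr2 B) *m (y2 s + y2 t)).
pose zl s := lamf B (sg s) ((s - t)^-1 *: (e s - e t)).
have ht : H2 (e t) := eH (ltW t0); have hpt : H2 (p t) := pH (ltW t0); have hsg := sgH tT'.
exists (fun s => zm s + za s + zq1 s + zq2 s + 2 * zl s); last first.
  move=> s ts sT.
  have r1 := kinetic_rate ts sT; have r2 := elastic_rate ts sT; have r3 := cross_rate ts sT.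
  have r4 := storage_rate y1 ok1 ts; have r5 := storage_rate y2 ok2 ts.
  rewrite -/(zm s) in r1; rewrite -/(za s) in r2; rewrite -/(zl s) in r3.
  rewrite -/(zq1 s) in r4; rewrite -/(zq2 s) in r5.
  exact: (rate_sum r1 r2 r3 r4 r5).
have cDe := cvg_quot_e; have csg := cvg_semi_finer rw (cvg_sg tT').
have nDe : \forall s \near t^'+, H2 ((s - t)^-1 *: (e s - e t)).
  by apply: (near_rt (ltW t0) tT) => s /andP[s0 _]; exact: (lcZ HL _ (lcB HL (eH s0) ht)).
have [dy1 dy2] := cvg_quot_y; have [cy1 cy2] := cvg_y tT'.
have cm : zm @ t^'+ --> - 2 * bform (uh t - u t) (vh t - v t) (y1 t) (y2 t) (p t) := cvg_mform.
have ca : za @ t^'+ --> aform B (p t) (e t + e t).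
  have [c c0 bc] := h2b_bounded L0 pa (h2b_aform L0 cLam k10 k20).
  have ce : cvg_semi t^'+ N2 (fun s => e s + e t) (e t + e t).
    have ce := cvg_semi_finer rw (cvg_e tT'); apply: (squeeze0 _ ce).
    by apply: nearW => s; rewrite ger0_norm ?snorm_ge0// (subDr (e s) (e t) (e t)); exact: lexx.
  apply: (cvg_form HL hP pa bc hpt (lcD HL ht ht) nDe _ cDe ce).
  by apply: (near_rt (ltW t0) tT) => s /andP[s0 _]; exact: (lcD HL (eH s0) ht).
have cl : zl @ t^'+ --> lamf B (sg t) (p t).
  have [c c0 bc] := h2b_bounded L0 pl (h2b_lamf L0 cLam).
  by apply: (cvg_form HL hP pl bc hsg hpt _ nDe csg cDe); exact: (near_rt (ltW t0) tT sgH).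
have c1 : zq1 @ t^'+ --> dotv (cA (ctr1 B) *m y1 t + pv1 (p t) *: cb (ctr1 B)) (cP (ctr1 B) *m (y1 t + y1 t)).
  exact: cvg_quad.
have c2 : zq2 @ t^'+ --> dotv (cA (ctr2 B) *m y2 t + pv0 (p t) *: cb (ctr2 B)) (cP (ctr2 B) *m (y2 t + y2 t)).
  exact: cvg_quad.
eexists; last first.
  by apply: cvgD; [apply: cvgD; [apply: cvgD; [apply: cvgD; [exact: cm|exact: ca]|exact: c1]|exact: c2]|
    apply: cvgM; [exact: cvg_cst|exact: cl]].
have hu := WhH2 (uhW (ltW t0)); have hv := WhH2 (vhW (ltW t0)).
have E1 : aform B (uh t - u t) (p t) = aform B (p t) (e t) + lamf B (sg t) (p t).
  rewrite -(aform_noend _ (fun j j2 => err_end j2 (u2 tT'))) (psd_sym pa hpt ht) -(psdDl pa ht hsg hpt).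
  by rewrite (subDB (uh t) (Pi (u t)) (u t)).
have E2 j : (j < 2)%N -> pv L j (vh t - v t) L = pv L j (p t) L.
  by move=> j2; rewrite (pvB j2 XL hv (Hk0H2 (v2 tT'))) (vt_pv j2).
have E3 := psdDr HL pa hpt ht ht.
have E4 (x y : vec) k : dotv x (cP k *m (y + y)) = 2 * dotv x (cP k *m y).
  by rewrite mulmxDr dotvC (psdDl (@psd_dotv R r) I I I) dotvC; ring.
rewrite E3 !E4 /bform E1 !E2//.
have K1 := kyp_dissipation (y1 t) (pv1 (p t)) ok1; have K2 := kyp_dissipation (y2 t) (pv0 (p t)) ok2.
have K3 := @power_balance R (aform B (p t) (e t)) (lamf B (sg t) (p t)) _ _ _ _ _ _ _ _ K1 K2.
exact: K3.
Qed.

End RightLimits.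

Let Q0 (k : @controller R r) (x : vec) : controller_ok k -> 0 <= dotv x (cP k *m x).
Proof. by move=> ok; exact: (psd_ge0 (psd_quad ok) I). Qed.

Let E0 s : 0 <= s -> 0 <= Qen s.
Proof.
move=> s0; apply: addr_ge0; last exact: Q0.
apply: addr_ge0; last exact: Q0.
by apply: addr_ge0; [exact: (psd_ge0 pm (pH s0))|exact: (psd_ge0 pa (eH s0))].
Qed.

Lemma energy_cont : continuous_in absR `[0, T] Qen /\ continuous_in absR `[0, T] Fen.
Proof.
have cQ t : 0 <= t <= T -> Qen @ win t --> Qen t.
  move=> tT; have t0 : 0 <= t by case/andP: tT.
  have [cm cm0 bm] := h2b_bounded L0 pm (h2b_mform L0 cmu (ltW M0) (ltW J0)).
  have [ca ca0 ba] := h2b_bounded L0 pa (h2b_aform L0 cLam k10 k20).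
  have bd : bounded_by (setT : set vec) (snorm (@dotv R r)) (@dotv R r) 1.
    by move=> x x' _ _; rewrite mul1r; exact: dotv_CS.
  have cq (k : @controller R r) (y : R -> vec) : cvg_semi (win t) (@normv R r) y (y t) ->
     (fun s => dotv (y s) (cP k *m y s)) @ win t --> dotv (y t) (cP k *m y t).
    move=> cy.
    have cPy : cvg_semi (win t) (snorm (@dotv R r)) (fun s => cP k *m y s) (cP k *m y t).
      apply/cvg_vec => q; rewrite dotv_mul.
      under eq_fun do rewrite dotv_mul.
      by have /cvg_vec h := cy; exact: h.
    by apply: (cvg_form (lc_setT _) (@psd_dotv R r) (@psd_dotv R r) bd I I _ _ cy cPy); exact: nearW.
  have [cy1 cy2] := cvg_y tT.
  apply: cvgD; last exact: cq.
  apply: cvgD; last exact: cq.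
  apply: cvgD.
    apply: (cvg_form HL hP pm bm (pH t0) (pH t0) _ _ (cvg_p tT) (cvg_p tT)); apply: near_win => s /andP[s0 _]; exact: pH.
  apply: (cvg_form HL hP pa ba (eH t0) (eH t0) _ _ (cvg_e tT) (cvg_e tT)); apply: near_win => s /andP[s0 _]; exact: eH.
split; first exact: win_cont.
apply: win_cont => t tT; have t0 : 0 <= t by case/andP: tT.
have [c c0 bc] := h2b_bounded L0 pl (h2b_lamf L0 cLam).
apply: cvgD; first exact: cQ.
apply: cvgM; first exact: cvg_cst.
apply: (cvg_form HL hP pl bc (sgH tT) (eH t0) _ _ (cvg_sg tT) (cvg_e tT)); apply: near_win => s.
  exact: sgH.
by move=> /andP[s0 _]; exact: eH.
Qed.

Section Stability.
Variables (muM LamM U : R) (Ga Gv : R -> R).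
Hypothesis muM0 : 0 <= muM.
Hypothesis LamM0 : 0 <= LamM.
Hypothesis muMP : forall x, 0 <= x <= L -> bmu B x <= muM.
Hypothesis LamMP : forall x, 0 <= x <= L -> bLam B x <= LamM.
Hypothesis Ga2 : L2on 0 T Ga.
Hypothesis Gv2 : L2on 0 T Gv.
Hypothesis Ga0 : forall s, 0 <= Ga s.
Hypothesis Gv0 : forall s, 0 <= Gv s.
Hypothesis vGa : forall s t, 0 <= s -> s <= t -> t <= T -> nrm2 0 L (Dw L 2 (v t - v s)) <= itg s t Ga.
Hypothesis uGv : forall s t, 0 <= s -> s <= t -> t <= T -> nrm2 0 L (Dw L 4 (u t - u s)) <= itg s t Gv.
Hypothesis uU : forall t, 0 <= t <= T -> nrm2 0 L (Dw L 4 (u t)) <= U.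

Let h := L / P%:R.
Let cM := Num.sqrt muM.
Let cL := Num.sqrt LamM.

Lemma muf_le f : H2 f -> snorm (muf B) f <= cM * nrm2 0 L f.
Proof.
move=> hf; rewrite -(ger0_norm (nrm2_ge0 0 L f)) -sqrtr_sqr -sqrtrM//; apply: ler_wsqrtr.
by have := wtform_le L0 cmu (leq0n 2) hf muMP; rewrite Dw0.
Qed.

Lemma lamf_le f : H2 f -> snorm (lamf B) f <= cL * nrm2 0 L (Dw L 2 f).
Proof.
move=> hf; rewrite -(ger0_norm (nrm2_ge0 0 L (Dw L 2 f))) -sqrtr_sqr -sqrtrM//; apply: ler_wsqrtr.
exact: (wtform_le L0 cLam (leqnn 2) hf LamMP).
Qed.

Lemma proj_err_muf f : Hk0 L 2 f -> snorm (muf B) (Pi f - f) <= cM * h ^+ 2 * nrm2 0 L (Dw L 2 f).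
Proof.
move=> hf; have he := err_Hk L0 P0 wB hf.
rewrite -opprB (snormN HL pmu he); apply: le_trans (muf_le he) _.
rewrite -mulrA; apply: ler_wpM2l; first exact: sqrtr_ge0.
exact: (interp_H2 L0 P0 wB hf).
Qed.

Lemma proj_err_lamf f : Hk0 L 4 f -> snorm (lamf B) (Pi f - f) <= cL * h ^+ 2 * nrm2 0 L (Dw L 4 f).
Proof.
move=> hf; have he := err_Hk L0 P0 wB (Hk0_le L0 (isT : (2 <= 4)%N) hf).
rewrite -opprB (snormN HL pl he); apply: le_trans (lamf_le he) _.
rewrite -mulrA; apply: ler_wpM2l; first exact: sqrtr_ge0.
exact: (interp_H4 L0 P0 wB hf).
Qed.

Lemma rh_step s t : 0 <= s -> s <= t -> t <= T -> snorm (muf B) (rh t - rh s) <= cM * h ^+ 2 * itg s t Ga.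
Proof.
move=> s0 st tT.
have vs := v2 (_ : 0 <= s <= T); have {}vs := vs ltac:(by rewrite s0 (le_trans st tT)).
have vt := v2 (_ : 0 <= t <= T); have {}vt := vt ltac:(by rewrite tT (le_trans s0 st)).
have hd := lcB (lc_Hk0 L0 (isT : (2 <= 2)%N)) vt vs.
have -> : rh t - rh s = Pi (v t - v s) - (v t - v s) by rewrite (Pi_sub vt vs) (subBB (Pi (v t))).
apply: le_trans (proj_err_muf hd) _; apply: ler_wpM2l; first by rewrite mulr_ge0 ?sqrtr_ge0 ?sqr_ge0.
exact: vGa.
Qed.

Lemma sg_step s t : 0 <= s -> s <= t -> t <= T -> snorm (lamf B) (sg t - sg s) <= cL * h ^+ 2 * itg s t Gv.
Proof.
move=> s0 st tT.
have us := u4 (_ : 0 <= s <= T); have {}us := us ltac:(by rewrite s0 (le_trans st tT)).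
have ut := u4 (_ : 0 <= t <= T); have {}ut := ut ltac:(by rewrite tT (le_trans s0 st)).
have hd := lcB (lc_Hk0 L0 (isT : (2 <= 4)%N)) ut us.
have us2 := Hk0_le L0 (isT : (2 <= 4)%N) us; have ut2 := Hk0_le L0 (isT : (2 <= 4)%N) ut.
have -> : sg t - sg s = Pi (u t - u s) - (u t - u s) by rewrite (Pi_sub ut2 us2) (subBB (Pi (u t))).
apply: le_trans (proj_err_lamf hd) _; apply: ler_wpM2l; first by rewrite mulr_ge0 ?sqrtr_ge0 ?sqr_ge0.
exact: uGv.
Qed.

Lemma sg_le t : 0 <= t <= T -> snorm (lamf B) (sg t) <= cL * h ^+ 2 * U.
Proof.
move=> tT; apply: le_trans (proj_err_lamf (u4 tT)) _.
by apply: ler_wpM2l; [rewrite mulr_ge0 ?sqrtr_ge0 ?sqr_ge0|exact: uU].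
Qed.

Lemma p_le s : 0 <= s -> snorm (muf B) (p s) <= Num.sqrt (Qen s).
Proof.
move=> s0; apply: ler_wsqrtr; rewrite /Qen.
have ha := psd_ge0 pa (eH s0).
have hm : muf B (p s) (p s) <= mform B (p s) (p s).
  rewrite /mform lerDl; apply: addr_ge0; apply: mulr_ge0; rewrite ?(ltW M0) ?(ltW J0)// /pvf -expr2; exact: sqr_ge0.
have := Q0 (y1 s) ok1; have := Q0 (y2 s) ok2.
move: hm ha; move: (mform _ _ _) (muf _ _ _) (aform _ _ _) (dotv _ _) (dotv _ _) => *; lra.
Qed.

Lemma e_le s : 0 <= s -> snorm (lamf B) (e s) <= Num.sqrt (Qen s).
Proof.
move=> s0; apply: ler_wsqrtr; rewrite /Qen.
have hm := psd_ge0 pm (pH s0).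
have ha : lamf B (e s) (e s) <= aform B (e s) (e s).
  by rewrite /aform lerDl; apply: addr_ge0; apply: mulr_ge0 => //; rewrite /pvf -expr2; exact: sqr_ge0.
have := Q0 (y1 s) ok1; have := Q0 (y2 s) ok2.
move: hm ha; move: (mform _ _ _) (lamf _ _ _) (aform _ _ _) (dotv _ _) (dotv _ _) => *; lra.
Qed.

Let Ka := itg 0 T Ga.
Let Kv := itg 0 T Gv.

Definition growth_bound := h ^+ 2 * (2 * cM * Ka + 2 * cL * Kv + 4 * cL * U).

(** Let S be the largest square root of the energy. Every defect is at most S times a
    quantity of order h^2, so energy_rate and growth give S^2 <= Q 0 + g S with g the
    growth_bound; no exponential of T appears. *)
Lemma energy_stability t : 0 <= t <= T -> Num.sqrt (Qen t) <= Num.sqrt (Qen 0) + growth_bound.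
Proof.
have T0' := ltW T0; have h00 : 0 <= (0 : R) <= T by apply/andP; split.
have U0 : 0 <= U by apply: le_trans (nrm2_ge0 _ _ _) (uU h00).
have Ka0 : 0 <= Ka by apply: itg_ge0.
have Kv0 : 0 <= Kv by apply: itg_ge0.
have cM0 : 0 <= cM := sqrtr_ge0 _; have cL0 : 0 <= cL := sqrtr_ge0 _.
have h20 : 0 <= h ^+ 2 := sqr_ge0 _.
pose A := [set Num.sqrt (Qen s) | s in [set s | 0 <= s <= T]].
pose S := sup A.
have [cQ cF] := energy_cont.
have [K K0 QK] := cont_bnd cQ.
have hA : has_sup A.
  split; first by exists (Num.sqrt (Qen 0)), 0.
  exists (Num.sqrt K) => _ [s sT <-]; apply: ler_wsqrtr; exact: le_trans (ler_norm _) (QK s sT).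
have leS s : 0 <= s <= T -> Num.sqrt (Qen s) <= S by move=> sT; apply: (sup_ubound hA.2); exists s.
have S0 : 0 <= S := le_trans (sqrtr_ge0 _) (leS 0 h00).
suff main s : 0 <= s <= T -> Qen s <= Qen 0 + growth_bound * S.
  have k0 : 0 <= growth_bound by rewrite mulr_ge0// !addr_ge0// !mulr_ge0.
  have SS : S <= Num.sqrt (Qen 0 + growth_bound * S).
    apply: ge_sup; first by exists (Num.sqrt (Qen 0)), 0.
    by move=> _ [s sT <-]; apply: ler_wsqrtr; exact: main.
  have q0 := E0 (lexx 0).
  by move=> tT; exact: le_trans (leS t tT) (absorb_sup S0 k0 q0 SS).
move=> sT; have [s0 sT'] := andP sT.
have half x : 0 <= x <= T -> `|lamf B (sg x) (e x)| <= cL * h ^+ 2 * U * S.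
  move=> xT; have x0 : 0 <= x by case/andP: xT.
  apply: le_trans (psd_CS HL pl (sgH xT) (eH x0)) _; apply: ler_pM; rewrite ?snorm_ge0//; first exact: sg_le.
  exact: le_trans (e_le x0) (leS x xT).
have c2S : 0 <= 2 * S * h ^+ 2 := mulr_ge0 (mulr_ge0 (ler0n _ 2) S0) h20.
(* the cross term in Fen is bounded at both ends by half, its rate is part of KK *)
pose KK x := 2 * S * h ^+ 2 * (cM * itg 0 x Ga + cL * itg 0 x Gv).
have Gai x y : 0 <= x -> x <= y -> y <= T -> itg 0 y Ga = itg 0 x Ga + itg x y Ga.
  move=> x0 xy yT; apply: itg_split => //; apply: (intble_sub (lexx 0) yT); exact: L2on_int.
have Gvi x y : 0 <= x -> x <= y -> y <= T -> itg 0 y Gv = itg 0 x Gv + itg x y Gv.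
  move=> x0 xy yT; apply: itg_split => //; apply: (intble_sub (lexx 0) yT); exact: L2on_int.
have gr : Fen s - Fen 0 <= KK s - KK 0.
  apply: growth => //.
  - move: cF => /(continuous_in_epsP _ _ absR_ge0) cF; apply/(continuous_in_epsP _ _ absR_ge0) => x.
    rewrite /= in_itv/= => /andP[x0 xs] d d0.
    have [|d1 d10 H1] := cF x _ d d0; first by rewrite /= in_itv/= x0 (le_trans xs sT').
    exists d1 => // y; rewrite /= in_itv/= => /andP[y0 ys]; apply: H1.
    by rewrite /= in_itv/= y0 (le_trans ys sT').
  - move=> x y x0 xy ys; rewrite /KK (Gai x y x0 xy (le_trans ys sT')) (Gvi x y x0 xy (le_trans ys sT')).
    apply: ler_wpM2l; first exact: c2S.
    have i1 : 0 <= itg x y Ga by apply: itg_ge0.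
    have i2 : 0 <= itg x y Gv by apply: itg_ge0.
    by apply: lerD; apply: ler_wpM2l => //; rewrite lerDl.
  move=> x x0 xs d d0; have xT := lt_le_trans xs sT'.
  have xT2 : 0 <= x <= T by rewrite !ltW.
  have [Z [Z0 Z00 cZ] FZ] := energy_rate x0 xT.
  have [d1 d10 H1] := near_right (cvgr_le Z0 cZ _ (le_lt_trans Z00 d0)).
  exists d1 => // y xy yd ys; have yT := le_trans ys sT'.
  have y0 : 0 <= y := ltW (lt_trans x0 xy); have yT2 : 0 <= y <= T by rewrite y0.
  have hZ := H1 y xy yd; rewrite (FZ y xy yT).
  have b1 : - muf B (rh y - rh x) (p y + p x) <= cM * h ^+ 2 * itg x y Ga * (2 * S).
    apply: le_trans (ler_norm _) _; rewrite normrN.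
    have hrr := lcB HL (rhH yT2) (rhH xT2); have hpp := lcD HL (pH y0) (pH (ltW x0)).
    apply: le_trans (psd_CS HL pmu hrr hpp) _; apply: ler_pM; rewrite ?snorm_ge0//; first exact: (rh_step (ltW x0) (ltW xy) yT).
    apply: le_trans (snormD HL pmu (pH y0) (pH (ltW x0))) _.
    rewrite mulr_natl mulr2n.
    exact: (lerD (le_trans (p_le y0) (leS y yT2)) (le_trans (p_le (ltW x0)) (leS x xT2))).
  have b2 : lamf B (sg y - sg x) (e x) <= cL * h ^+ 2 * itg x y Gv * S.
    apply: le_trans (ler_norm _) _; have hss := lcB HL (sgH yT2) (sgH xT2).
    apply: le_trans (psd_CS HL pl hss (eH (ltW x0))) _; apply: ler_pM; rewrite ?snorm_ge0//; first exact: (sg_step (ltW x0) (ltW xy) yT).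
    exact: le_trans (e_le (ltW x0)) (leS x xT2).
  have b3 : (y - x) * Z y <= d * (y - x) by rewrite mulrC ler_wpM2r// subr_ge0 ltW.
  have -> : KK y - KK x = cM * h ^+ 2 * itg x y Ga * (2 * S) + 2 * (cL * h ^+ 2 * itg x y Gv * S).
    by rewrite /KK (Gai x y (ltW x0) (ltW xy) yT) (Gvi x y (ltW x0) (ltW xy) yT); ring.
  by apply: lerD => //; apply: lerD => //; apply: ler_wpM2l.
have KK0 : KK 0 = 0 by rewrite /KK !itg_pt; ring.
have KKs : KK s <= 2 * S * h ^+ 2 * (cM * Ka + cL * Kv).
  apply: ler_wpM2l; first exact: c2S.
  have i1 : 0 <= itg s T Ga by apply: itg_ge0.
  have i2 : 0 <= itg s T Gv by apply: itg_ge0.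
  rewrite /Ka /Kv (Gai s T s0 sT' (lexx T)) (Gvi s T s0 sT' (lexx T)).
  by apply: lerD; apply: ler_wpM2l => //; rewrite lerDl.
apply: (drop_cross gr KK0 KKs (half s sT) (half 0 h00)); rewrite /growth_bound; ring.
Qed.

Lemma energyE (f g : R -> Fn) (x1 x2 : R -> vec) t : H2 (f t) -> H2 (g t) ->
  energy B t f g x1 x2 = 2^-1 * (mform B (g t) (g t) + aform B (f t) (f t) +
    dotv (x1 t) (cP (ctr1 B) *m x1 t) + dotv (x2 t) (cP (ctr2 B) *m x2 t)).
Proof.
move=> hf hg; rewrite /energy -pvE -DwE /quad.
have i1 := wtform_int L0 cLam (leqnn 2) hf hf; have i2 := wtform_int L0 cmu (leq0n 2) hg hg.
have -> : \int[leb]_(x in `[0, bL B]) (bLam B x * Dw (bL B) 2 (f t) x ^+ 2 + bmu B x * g t x ^+ 2) =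
    lamf B (f t) (f t) + muf B (g t) (g t).
  rewrite /lamf /muf /wtform -(itgD i1 i2); apply: eq_itg => x _; rewrite Dw0.
  by rewrite !expr2 !mulrA.
by rewrite /mform /aform /pvf; field.
Qed.

Lemma sqrt_add3 (x y z : R) : 0 <= x -> 0 <= y -> 0 <= z ->
  Num.sqrt (x + y + z) <= Num.sqrt x + Num.sqrt y + Num.sqrt z.
Proof.
have K (c d : R) : 0 <= c -> 0 <= d -> Num.sqrt (c + d) <= Num.sqrt c + Num.sqrt d.
  move=> c0 d0; rewrite -ler_sqr ?nnegrE ?sqrtr_ge0 ?addr_ge0 ?sqrtr_ge0//.
  rewrite sqr_sqrtr ?addr_ge0// sqrrD !sqr_sqrtr//.
  have := mulr_ge0 (sqrtr_ge0 c) (sqrtr_ge0 d); lra.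
move=> x0 y0 z0; apply: le_trans (K _ _ (addr_ge0 x0 y0) z0) _.
by rewrite lerD2r; exact: K.
Qed.

Lemma sqrt_half (q : R) : 0 <= q -> Num.sqrt q <= 2 * Num.sqrt (2^-1 * q).
Proof.
move=> q0; have q1 : 0 <= 2^-1 * q by rewrite mulr_ge0// invr_ge0.
rewrite -ler_sqr ?nnegrE ?mulr_ge0 ?sqrtr_ge0// exprMn (sqr_sqrtr q0) (sqr_sqrtr q1); lra.
Qed.

Lemma psd_double (b : Fn -> Fn -> R) f g : psd H2 b -> H2 f -> H2 g ->
  b (f + g) (f + g) <= 2 * b f f + 2 * b g g.
Proof.
move=> hb hf hg; have := psd_ge0 hb (lcB HL hf hg); have hD := lcD HL hf hg; have hB := lcB HL hf hg.
rewrite (psdBl HL hb hf hg hB) (psdBr HL hb hf hf hg) (psdBr HL hb hg hf hg).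
rewrite (psdDl hb hf hg hD) (psdDr HL hb hf hf hg) (psdDr HL hb hg hf hg).
lra.
Qed.

(** The energy of (e + sg, p + rh): the interpolation errors have no boundary terms. *)
Lemma error_split t : 0 <= t <= T ->
  Num.sqrt (energy B t (fun s => uh s - u s) (fun s => vh s - v s) y1 y2) <=
  Num.sqrt (Qen t) + snorm (muf B) (rh t) + snorm (lamf B) (sg t).
Proof.
move=> tT; have t0 : 0 <= t by case/andP: tT.
have hu := WhH2 (uhW t0); have hv := WhH2 (vhW t0).
have hu' := Hk0H2 (u2 tT); have hv' := Hk0H2 (v2 tT).
rewrite (@energyE (fun s => uh s - u s) (fun s => vh s - v s) y1 y2 t (lcB HL hu hu') (lcB HL hv hv')).
have m1 := psd_double pm (pH t0) (rhH tT); have a1 := psd_double pa (eH t0) (sgH tT).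
rewrite (subDB (vh t) (Pi (v t)) (v t)) in m1; rewrite (subDB (uh t) (Pi (u t)) (u t)) in a1.
rewrite (mform_noend _ (fun j j2 => err_end j2 (v2 tT))) in m1.
rewrite (aform_noend _ (fun j j2 => err_end j2 (u2 tT))) in a1.
apply: le_trans (sqrt_add3 (E0 t0) (psd_ge0 pmu (rhH tT)) (psd_ge0 pl (sgH tT))).
apply: ler_wsqrtr; have := Q0 (y1 t) ok1; have := Q0 (y2 t) ok2.
exact: (half_sum m1 a1).
Qed.

Lemma energy_eps t : 0 <= t -> Num.sqrt (Qen t) <= 2 * Num.sqrt (energy B t e p y1 y2).
Proof.
move=> t0; rewrite (@energyE e p y1 y2 t (eH t0) (pH t0)) -/(Qen t).
exact: sqrt_half (E0 t0).
Qed.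

Hypothesis vGv : {ae leb, forall s, 0 <= s <= T -> nrm2 0 L (Dw L 2 (v s)) <= Gv s}.

Lemma nrm2_bn j (f : Fn) : nrm2 0 L (Dw L j f) = snorm (fun f g => itg 0 L (fun x => Dw L j f x * Dw L j g x)) f.
Proof. by congr Num.sqrt; apply: eq_itg => x _; rewrite expr2. Qed.

(** The value at t is at most its mean in time plus its oscillation. *)
Lemma v_D2 t : 0 <= t <= T -> nrm2 0 L (Dw L 2 (v t)) <= Kv / T + Ka.
Proof.
move=> tT; have [t0 tT'] := andP tT; have T0' := ltW T0.
have hD := psd_D L0 (leqnn 2).
have sub s s' : 0 <= s -> s <= s' -> s' <= T -> itg s s' Ga <= Ka.
  by move=> s0 ss sT; apply: le_itg_sub => //; exact: L2on_int.
have osc s : 0 <= s <= T -> nrm2 0 L (Dw L 2 (v t - v s)) <= Ka.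
  move=> /andP[s0 sT]; have [st|/ltW ts] := leP s t.
    by apply: le_trans (vGa s0 st tT') _; exact: sub.
  have vs : H2 (v s) by apply: Hk0H2 (v2 _); rewrite s0.
  have vt : H2 (v t) := Hk0H2 (v2 tT).
  rewrite -opprB nrm2_bn (snormN HL hD (lcB HL vs vt)) -nrm2_bn.
  by apply: le_trans (vGa t0 ts sT) _; exact: sub.
have : itg 0 T (fun=> nrm2 0 L (Dw L 2 (v t))) <= itg 0 T (fun s => Gv s + Ka).
  apply: ae_le_itg; [exact: intble_cst|by apply: intbleD; [exact: L2on_int|exact: intble_cst]|].
  apply: aeS vGv => s H sT; have vs := Hk0H2 (v2 sT); have vt := Hk0H2 (v2 tT).
  have := snormD HL hD vs (lcB HL vt vs); rewrite -!nrm2_bn addrC subrK => h1.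
  apply: le_trans h1 _; exact: (lerD (H sT) (osc s sT)).
rewrite itgD ?itg_cst ?subr0//; [|exact: L2on_int|exact: intble_cst].
rewrite -/Kv => h1; rewrite -(ler_pM2r T0); apply: le_trans h1 _.
by rewrite mulrDl divfK ?gt_eqF.
Qed.

Lemma error_bound t : 0 <= t <= T ->
  Num.sqrt (energy B t (fun s => uh s - u s) (fun s => vh s - v s) y1 y2) <=
  2 * Num.sqrt (energy B 0 e p y1 y2) + growth_bound + cM * h ^+ 2 * (Kv / T + Ka) + cL * h ^+ 2 * U.
Proof.
move=> tT; apply: le_trans (error_split tT) _.
apply: lerD; last exact: sg_le.
apply: lerD.
  apply: le_trans (energy_stability tT) _; rewrite lerD2r; exact: energy_eps.
apply: le_trans (proj_err_muf (v2 tT)) _; apply: ler_wpM2l; first by rewrite mulr_ge0 ?sqrtr_ge0 ?sqr_ge0.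
exact: v_D2.
Qed.

End Stability.

End ErrorEquation.

(** * The error estimate *)

Lemma Ck_in_cont (R : realType) (D : set R) k (f : R -> R^o) : Ck_in D k f -> continuous_in absR D f.
Proof. by move=> [F [<- _ H]]; exact: H. Qed.

Lemma normC_in_ub (R : realType) (L T : R) k (U : R -> R -> R^o) t : 0 < L -> C_in (Hk0 L k) (normHk L k) T U ->
  0 <= t <= T -> nrm2 0 L (Dw L k (U t)) <= normC_in (normHk L k) T U.
Proof.
move=> L0 [UY cU] tT; apply: le_trans (nrm2_le_normHk _ _ (leqnn k)) _.
have XU s : 0 <= s <= T -> Hk L k (U s) by move=> sT; have [] := UY s ltac:(by rewrite in_itv).
have cU' : continuous_in (snorm (ipHk L k)) `[0, T] U by rewrite -normHkE.
have [K K0 UK] := snorm_bounded (lc_Hk L0 k) (psd_ipHk L0 k) XU cU'.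
apply: sup_ubound; last by exists t => //; rewrite /= in_itv.
by exists K => _ [s sT <-]; rewrite normHkE; apply: UK; move: sT; rewrite /= in_itv.
Qed.

(** The rate G is a measurable version of the norm of V. *)
Lemma path_rate (R : realType) (L T : R) k (U V : R -> R -> R^o) : 0 < L -> 0 < T -> (2 <= k)%N ->
  is_time_derivative T (L2 L) (ipL2 L) U V ->
  C_in (Hk0 L k) (normHk L k) T U -> L2_in (Hk0 L k) (normHk L k) T V ->
  exists G, [/\ L2on 0 T G, forall s, 0 <= G s, itg 0 T G <= Num.sqrt T * normL2_in (normHk L k) T V,
    forall s t, 0 <= s -> s <= t -> t <= T -> nrm2 0 L (Dw L k (U t - U s)) <= itg s t G &
    {ae lebesgue_measure, forall s, 0 <= s <= T -> normHk L k (V s) = G s}].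
Proof.
move=> L0 T0 k2 UV CU LV; have Yk := lc_Hk0 L0 k2.
have YH : Hk0 L k `<=` Hk L k by move=> f [].
have LV' : L2_in (Hk0 L k) (snorm (ipHk L k)) T V by rewrite -normHkE.
have [G [G2 GE G0 GN]] := L2_in_norm Yk (psd_subset YH (psd_ipHk L0 k)) LV'.
exists G; split => //.
- have := itg_L1L2 (ltW T0) G2; rewrite subr0 GN -normHkE; apply: le_trans.
  rewrite le_eqVlt; apply/orP; left; apply/eqP; apply: eq_itg => s _; by rewrite ger0_norm.
- move=> s t s0 st tT.
  have UY x : 0 <= x <= T -> Hk0 L k (U x) by move=> xT; apply: CU.1; rewrite in_itv.
  apply: (path_bound L0 T0 Yk YH UY LV (UV_of L0 T0 Yk YH CU LV UV) (leqnn k) s0 st tT G2).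
  by apply: aeS GE => x h xT; rewrite -(h xT) -normHkE; exact: nrm2_le_normHk.
- by apply: aeS GE => x h xT; rewrite normHkE h.
Qed.

Lemma collect_constants (R : realFieldType) (a b d x y n1 n2 n3 k1 k2 T' s : R) :
  0 <= a -> 0 <= b -> 0 <= T' -> 0 <= s -> 0 <= x -> 0 <= y -> 0 <= n1 -> 0 <= n2 -> 0 <= n3 ->
  k1 <= s * n1 -> k2 <= s * n2 ->
  d = 2 + 3 * a * s + (2 * b + a * T') * s + 5 * b ->
  2 * x + y * (2 * a * k1 + 2 * b * k2 + 4 * b * n3) + a * y * (k2 * T' + k1) + b * y * n3
    <= d * (x + y * (n1 + n2 + n3)).
Proof.
move=> a0 b0 T0 s0 x0 y0 n10 n20 n30 h1 h2 ->.
have e1 : y * a * 3 * k1 <= y * a * 3 * (s * n1) by rewrite ler_wpM2l// !mulr_ge0.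
have e2 : y * (2 * b + a * T') * k2 <= y * (2 * b + a * T') * (s * n2).
  by rewrite ler_wpM2l// mulr_ge0// addr_ge0// mulr_ge0.
set A := 3 * a * s; set Bv := (2 * b + a * T') * s; set D := 5 * b.
have A0 : 0 <= A by rewrite !mulr_ge0.
have B0 : 0 <= Bv by rewrite mulr_ge0// addr_ge0// mulr_ge0.
have D0 : 0 <= D by rewrite mulr_ge0.
have r : 0 <= (A + Bv + D) * x + y * ((2 + Bv + D) * n1 + (2 + A + D) * n2 + (2 + A + Bv) * n3).
  have [q1 q2 q3 q4] : [/\ 0 <= A + Bv + D, 0 <= 2 + Bv + D, 0 <= 2 + A + D & 0 <= 2 + A + Bv] by split; lra.
  by apply: addr_ge0; apply: mulr_ge0 => //; apply: addr_ge0; [apply: addr_ge0|]; apply: mulr_ge0.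
rewrite -subr_ge0; apply: le_trans r _; rewrite /A /Bv /D in A0 B0 D0 *; lra.
Qed.

(* MathComp-Analysis.  v is the continuous representative of u_t and a = u_tt;
   eps_t is the time derivative of eps, since nodal evaluation is linear and
   continuous on H^2 and hence commutes with the time derivative. *)
Theorem theorem7 (R : realType) (r : nat) (B : @beam R r) (T : R) :
  beam_ok B -> 0 < T ->
  exists C : R,
  forall (u v a : R -> R -> R^o) (z1 z2 : R -> 'cV[R]_r)
    (u0 v0 : @triple R) (z10 z20 : 'cV[R]_r)
    (P : nat) (w : nat -> R -> R^o)
    (uh vh ah : R -> R -> R^o) (zh1 zh2 : R -> 'cV[R]_r) (uh0 vh0 : R -> R^o),
  let L := bL B in
  weak_solution B T u z1 z2 u0 v0 z10 z20 ->
  is_time_derivative T (L2 L) (ipL2 L) u v ->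
  is_time_derivative T (L2 L) (ipL2 L) v a ->
  C_in (Hk0 L 4) (normHk L 4) T u ->
  L2_in (Hk0 L 4) (normHk L 4) T v ->
  C_in (Hk0 L 2) (normHk L 2) T v ->
  L2_in (Hk0 L 2) (normHk L 2) T a ->
  (0 < P)%N ->
  hermite_basis B P w ->
  semidiscrete_solution B P uh vh ah zh1 zh2 uh0 vh0 z10 z20 ->
  let h := L / P%:R in
  let eps t := uh t - nodal_projection B P w (u t) in
  let eps_t t := vh t - nodal_projection B P w (v t) in
  let ze1 t := zh1 t - z1 t in
  let ze2 t := zh2 t - z2 t in
  forall t, 0 <= t <= T ->
  Num.sqrt (energy B t (fun s => uh s - u s) (fun s => vh s - v s) ze1 ze2)
  <= C * (Num.sqrt (energy B 0 eps eps_t ze1 ze2)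
          + h ^+ 2 * (normL2_in (normHk L 2) T a
                      + normL2_in (normHk L 4) T v
                      + normC_in (normHk L 4) T u)).
Proof.
move=> [_ [L0 M0 J0 k10 k20] [Cmu CLam] pos [ok1 ok2]] T0.
have cmu := Ck_in_cont Cmu; have cLam := Ck_in_cont CLam.
have mu0 x : 0 <= x <= bL B -> 0 <= bmu B x by move=> xL; have [/ltW] := pos x ltac:(by rewrite in_itv).
have Lam0 x : 0 <= x <= bL B -> 0 <= bLam B x by move=> xL; have [_ /ltW] := pos x ltac:(by rewrite in_itv).
have [muM muM0 hmu] := cont_bnd cmu; have [LamM LamM0 hLam] := cont_bnd cLam.
have muMP x : 0 <= x <= bL B -> bmu B x <= muM by move=> xL; exact: le_trans (ler_norm _) (hmu x xL).
have LamMP x : 0 <= x <= bL B -> bLam B x <= LamM by move=> xL; exact: le_trans (ler_norm _) (hLam x xL).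
exists (2 + 3 * Num.sqrt muM * Num.sqrt T + (2 * Num.sqrt LamM + Num.sqrt muM * T^-1) * Num.sqrt T
  + 5 * Num.sqrt LamM).
move=> u v a z1 z2 u0 v0 z10 z20 P w uh vh ah zh1 zh2 uh0 vh0 L weak uv va Cu Lv Cv La P0 wB semi h eps eps_t ze1 ze2 t tT.
have [Ga [Ga2 Ga0 GaK vGa _]] := path_rate L0 T0 (isT : (2 <= 2)%N) va Cv La.
have [Gv [Gv2 Gv0 GvK uGv vGv]] := path_rate L0 T0 (isT : (2 <= 4)%N) uv Cu Lv.
have vGv2 : {ae lebesgue_measure, forall s, 0 <= s <= T -> nrm2 0 L (Dw L 2 (v s)) <= Gv s}.
  by apply: aeS vGv => s H sT; rewrite -(H sT); exact: nrm2_le_normHk.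
have uU s : 0 <= s <= T -> nrm2 0 L (Dw L 4 (u s)) <= normC_in (normHk L 4) T u.
  by move=> sT; exact: (normC_in_ub L0 Cu sT).
have U0 : 0 <= normC_in (normHk L 4) T u := le_trans (nrm2_ge0 _ _ _) (uU t tT).
have main := error_bound L0 T0 cmu cLam mu0 Lam0 M0 J0 (ltW k10) (ltW k20) ok1 ok2 uv Cu Lv Cv weak P0 wB semi
  muM0 LamM0 muMP LamMP Ga2 Gv2 Ga0 Gv0 vGa uGv uU vGv2 tT.
apply: le_trans main _.
have T'0 : 0 <= T^-1 by rewrite invr_ge0 ltW.
have na0 : 0 <= normL2_in (normHk L 2) T a := sqrtr_ge0 _.
have nv0 : 0 <= normL2_in (normHk L 4) T v := sqrtr_ge0 _.
have hh0 : 0 <= h ^+ 2 := sqr_ge0 _.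
have e0 : 0 <= Num.sqrt (energy B 0 eps eps_t ze1 ze2) := sqrtr_ge0 _.
rewrite /growth_bound.
exact: (collect_constants (sqrtr_ge0 muM) (sqrtr_ge0 LamM) T'0 (sqrtr_ge0 T) e0 hh0 na0 nv0 U0 GaK GvK erefl).

Qed.
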